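(* Let $\tilde Z(s,z,c,[\gamma])$ be the analytic continuation of the Lerch transcendent to the universal cover $\tilde{\mathcal N}$ (see context). (1) $\tilde Z$ satisfies $\left(z\frac{\partial}{\partial z}+c\right)\tilde Z(s,z,c,[\gamma])=\tilde Z(s-1,z,c,[\gamma_-])$ and $\frac{\partial}{\partial c}\tilde Z(s,z,c,[\gamma])=-s\,\tilde Z(s+1,z,c,[\gamma_+])$, where $\gamma_\pm$ is the path that first traverses $\gamma$ and then, from its endpoint, a path changing only the $s$-variable from $s$ to $s\pm1$. (2) $\tilde Z$ satisfies on $\tilde{\mathcal N}$ the linear partial differential equation $\left(z\frac{\partial}{\partial z}\frac{\partial}{\partial c}+c\frac{\partial}{\partial c}\right)\tilde Z(s,z,c,[\gamma])=-s\,\tilde Z(s,z,c,[\gamma])$. (3) For each $[\tau]\in\pi_1(\mathcal N,x_0')$ the monodromy function $M_{[\tau]}(\tilde Z)$ satisfies on $\tilde{\mathcal N}$ the same two differential-difference equations and the same linear partial differential equation.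
   Context: $\Phi(s,z,c)=\sum_{n\ge0}z^n(n+c)^{-s}$ (principal branch powers), holomorphic for $\Re s>1$, $|z|<1$, $0<\Re c<1$. $\mathcal N=\mathbb C\times(\mathbb P^1(\mathbb C)\setminus\{0,1,\infty\})\times(\mathbb C\setminus\mathbb Z)$, base point $x_0'=(\tfrac12,-1,\tfrac12)$. $\Phi$ extends to a single-valued holomorphic function on the simply connected domain $\mathcal D=\mathbb C\times(\mathbb C\setminus\mathbb R_{\ge0})\times\{0<\Re c<1\}\ni x_0'$ and continues analytically along all paths in $\mathcal N$; points of $\tilde{\mathcal N}$ are homotopy classes $[\gamma]$ of paths from $x_0'$, with endpoint $\gamma(1)=(s,z,c)$, and $\tilde Z([\gamma])$ is the value at $\gamma(1)$ of the continuation along $\gamma$ of the germ at $x_0'$. For $[\tau]\in\pi_1(\mathcal N,x_0')$, $M_{[\tau]}(f)([\gamma])=f([\tau\gamma])-f([\gamma])$, where $\tau\gamma$ means first $\tau$, then $\gamma$. *)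

(* Defs.v *)
From HB Require Import structures.
From mathcomp Require Import all_boot all_order all_algebra.
From mathcomp Require Import all_classical all_reals all_analysis.
From mathcomp Require Import complex.
Set Implicit Arguments.
Unset Strict Implicit.
Unset Printing Implicit Defensive.
Import Order.TTheory GRing.Theory Num.Theory.
Local Open Scope ring_scope.

Section Lerch.
Variable R : realType.
Local Notation C := R[i].

Definition P3 := (C * C * C)%type.
Definition ps (x : P3) : C := x.1.1.
Definition pz (x : P3) : C := x.1.2.
Definition pc (x : P3) : C := x.2.
Definition mk3 (s z c : C) : P3 := ((s, z), c).
Definition add3 (x y : P3) : P3 := mk3 (ps x + ps y) (pz x + pz y) (pc x + pc y).
Definition sub3 (x y : P3) : P3 := mk3 (ps x - ps y) (pz x - pz y) (pc x - pc y).
Definition scal3 (a : C) (x : P3) : P3 := mk3 (a * ps x) (a * pz x) (a * pc x).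

Definition e_s : P3 := mk3 1 0 0.
Definition e_z : P3 := mk3 0 1 0.
Definition e_c : P3 := mk3 0 0 1.

Definition reC (w : C) : R := complex.Re w.
Definition imC (w : C) : R := complex.Im w.

Definition cabs (w : C) : R := Num.sqrt (reC w ^+ 2 + imC w ^+ 2).
Definition norm3 (x : P3) : R :=
  Num.max (cabs (ps x)) (Num.max (cabs (pz x)) (cabs (pc x))).

Definition cexp (w : C) : C :=
  ((expR (reC w) * cos (imC w)) +i* (expR (reC w) * sin (imC w)))%C.
Definition carg (w : C) : R :=
  if 0 <= imC w then acos (reC w / cabs w) else - acos (reC w / cabs w).
Definition cLog (w : C) : C := ((ln (cabs w)) +i* (carg w))%C.
Definition cpow (a b : C) : C := cexp (b * cLog a).

Definition inN (x : P3) : Prop :=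
  pz x != 0 /\ pz x != 1 /\ forall k : int, pc x != k%:~R.

Definition x0' : P3 := mk3 (2^-1) (-1) (2^-1).

Definition holo_at (f : P3 -> C) (x : P3) : Prop :=
  exists a1 a2 a3 : C, forall eps : R, 0 < eps -> exists del : R, 0 < del /\
    forall h : P3, norm3 h < del ->
      cabs (f (add3 x h) - f x - (a1 * ps h + a2 * pz h + a3 * pc h))
        <= eps * norm3 h.
Definition holo_on (U : P3 -> Prop) (f : P3 -> C) : Prop :=
  forall x, U x -> holo_at f x.

Definition is_pderiv (f : P3 -> C) (x v : P3) (w : C) : Prop :=
  forall eps : R, 0 < eps -> exists del : R, 0 < del /\
    forall h : C, h != 0 -> cabs h < del ->
      cabs ((f (add3 x (scal3 h v)) - f x) / h - w) < eps.

Definition cconv (u : nat -> C) (l : C) : Prop :=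
  forall eps : R, 0 < eps -> exists N : nat, forall n : nat, (N <= n)%N ->
    cabs (u n - l) < eps.

Definition Phi_partial (x : P3) (N : nat) : C :=
  \sum_(n < N) pz x ^+ n * cpow (n%:R + pc x) (- ps x).

Definition region_conv (x : P3) : Prop :=
  1 < reC (ps x) /\ cabs (pz x) < 1 /\ 0 < reC (pc x) < 1.

Definition regionD (x : P3) : Prop :=
  ~ (imC (pz x) = 0 /\ 0 <= reC (pz x)) /\ 0 < reC (pc x) < 1.

Definition Phi_ext (F : P3 -> C) : Prop :=
  holo_on regionD F /\
  forall x, regionD x -> region_conv x -> cconv (Phi_partial x) (F x).

Definition is_path (g : R -> P3) : Prop :=
  (forall t, 0 <= t <= 1 -> inN (g t)) /\
  (forall t, 0 <= t <= 1 -> forall eps : R, 0 < eps -> exists del : R,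
     0 < del /\ forall t', 0 <= t' <= 1 -> `|t' - t| < del ->
       norm3 (sub3 (g t') (g t)) < eps).
Definition path_from_x0 (g : R -> P3) : Prop := is_path g /\ g 0 = x0'.
Definition loop_at_x0 (g : R -> P3) : Prop := path_from_x0 g /\ g 1 = x0'.

Definition pconcat (a b : R -> P3) (t : R) : P3 :=
  if t <= 2^-1 then a (2 * t) else b (2 * t - 1).

Definition sshift (g : R -> P3) (d : C) : R -> P3 :=
  pconcat g (fun t => add3 (g 1) (mk3 ((t +i* 0)%C * d) 0 0)).

Definition cont_along (g : R -> P3) (f : R -> P3 -> C) (r : R -> R) : Prop :=
  (forall t, 0 <= t <= 1 ->
     0 < r t /\ (forall y, norm3 (sub3 y (g t)) < r t -> inN y) /\
     holo_on (fun y => norm3 (sub3 y (g t)) < r t) (f t)) /\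
  (forall t, 0 <= t <= 1 -> exists del : R, 0 < del /\
     forall t', 0 <= t' <= 1 -> `|t' - t| < del ->
       norm3 (sub3 (g t') (g t)) < r t /\
       exists rho : R, 0 < rho /\
         forall y, norm3 (sub3 y (g t')) < rho -> f t y = f t' y) /\
  (exists F, Phi_ext F /\ exists rho : R, 0 < rho /\
     forall y, norm3 (sub3 y x0') < rho -> f 0 y = F y).

(** g0 is the germ at g 1 of the continuation of Phi along g; thus
    Ztilde([g]) = g0 (g 1), and derivatives of Ztilde at [g] are those of g0
    at g 1. *)
Definition Zgerm (g : R -> P3) (g0 : P3 -> C) : Prop :=
  exists f r, cont_along g f r /\ g0 = f 1.

Definition DD_minus (G Gm : P3 -> C) (p : P3) : Prop :=
  forall w, is_pderiv G p e_z w -> pz p * w + pc p * G p = Gm (sub3 p e_s).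

Definition DD_plus (G Gp : P3 -> C) (p : P3) : Prop :=
  forall w, is_pderiv G p e_c w -> w = - ps p * Gp (add3 p e_s).

Definition PDE_at (G : P3 -> C) (p : P3) : Prop :=
  forall (H : P3 -> C) (rho : R) (w : C), 0 < rho ->
    (forall y, norm3 (sub3 y p) < rho -> is_pderiv G y e_c (H y)) ->
    is_pderiv H p e_z w ->
    pz p * w + pc p * H p = - ps p * G p.

End Lerch.

(* Main.v *)
(** By Goursat's argument in logarithmic polar coordinates, functions that are
merely complex differentiable at each point have Taylor expansions with Cauchy
bounds; along complex lines this gives, in three variables, Weierstrass' theorem,
holomorphy of derivatives and the identity principle.

The two differential-difference equations hold termwise for the Lerch series,
hence for its extension on the convex set [Re z < 0, 0 < Re c < 1], which is
stable under shifts of [s].  They relate values at [s] and [s - 1] or [s + 1],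
whereas a germ continued along a path only lives on a small polydisc.  The
invariant propagated along the path is therefore: the germ extends to
[C * (small bidisc in (z, c))] and the extension satisfies both equations.  It
holds at the base point, and it passes from one point of the path to the next by
Hartogs' lemma: a function holomorphic on a polydisc that is entire in [s] over a
smaller bidisc is entire in [s] over the larger bidisc.  Since the extension is
entire in [s], the germ continued along the additional [s]-segment is its
translate, for every choice of the continuation.  The partial differential
equation is the composition of the two difference equations, and all three
equations are linear, so that they pass to the monodromy functions. *)

Require Import Defs.
From HB Require Import structures.
From mathcomp Require Import all_boot all_order all_algebra.
From mathcomp Require Import all_classical all_reals all_analysis.
From mathcomp Require Import complex.
From mathcomp Require Import ring lra.
Set Implicit Arguments.
Unset Strict Implicit.
Unset Printing Implicit Defensive.
Import Order.TTheory GRing.Theory Num.Theory.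
Import numFieldNormedType.Exports.
Local Open Scope ring_scope.

(** * Modulus and coordinates of complex numbers *)

Section ComplexModulus.
Variable R : realType.
Local Notation C := R[i].
Implicit Types x y z w : C.

(** What forces Hartogs' lemma is uniformity. Propagation along [[0, 1]] is a supremum argument, and
    its step at [t] must have a length fixed before the nearby point [t1] is chosen. The bidisc on
    which the extension is known at [t1] has no lower bound, and the identity principle alone could
    never enlarge it. Hartogs' lemma returns a bidisc whose size is dictated by the polydisc of the
    germ at [t], which is a legitimate step length.

    [Zgerm] leaves the family of functions, the radii and even the extension of the series
    existential, so every statement must hold for all choices; uniqueness of continuation is used
    between independent choices throughout.

    The series gives no direct information at the base point, where [Re s = 1/2]. The equations are
    checked near an auxiliary point with larger [Re s], inside a convex domain that also contains
    the base point.

    The monodromy needs no further analysis: going around [tau] and then along the shifted path is,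
    up to parametrisation, the shift of the concatenated path, so one argument gives both germs of
    the difference. *)

Lemma cabsE w : cabs w = ComplexField.Normc.normc w.
Proof. by case: w. Qed.

Lemma cabs_ge0 w : 0 <= cabs w.
Proof. exact: sqrtr_ge0. Qed.

Lemma cabs0 : cabs (0 : C) = 0.
Proof. by rewrite cabsE ComplexField.Normc.normc0. Qed.

Lemma cabs1 : cabs (1 : C) = 1.
Proof. by rewrite cabsE ComplexField.Normc.normc1. Qed.

Lemma cabsM x y : cabs (x * y) = cabs x * cabs y.
Proof. by rewrite !cabsE ComplexField.Normc.normcM. Qed.

Lemma cabsV x : cabs (x^-1) = (cabs x)^-1.
Proof. by rewrite !cabsE ComplexField.Normc.normcV. Qed.

Lemma cabs_div x y : cabs (x / y) = cabs x / cabs y.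
Proof. by rewrite cabsM cabsV. Qed.

Lemma cabsX x n : cabs (x ^+ n) = cabs x ^+ n.
Proof. by elim: n => [|n IH]; rewrite ?expr0 ?cabs1// !exprS cabsM IH. Qed.

Lemma cabsN x : cabs (- x) = cabs x.
Proof. by rewrite /cabs /reC /imC; case: x => a b /=; rewrite !sqrrN. Qed.

Lemma cabsBC x y : cabs (x - y) = cabs (y - x).
Proof. by rewrite -cabsN opprB. Qed.

Lemma cabsD x y : cabs (x + y) <= cabs x + cabs y.
Proof. by rewrite !cabsE; exact: le_normcD. Qed.

Lemma cabsB x y : cabs (x - y) <= cabs x + cabs y.
Proof. by rewrite -[cabs y]cabsN cabsD. Qed.

Lemma cabs_dist x y z : cabs (x - z) <= cabs (x - y) + cabs (y - z).
Proof. by have := cabsD (x - y) (y - z); rewrite addrA subrK. Qed.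

Lemma cabs_subl x y : cabs x - cabs y <= cabs (x - y).
Proof. by rewrite lerBlDr; have := cabsD (x - y) y; rewrite subrK. Qed.

Lemma cabs_eq0 x : (cabs x == 0) = (x == 0).
Proof.
apply/eqP/eqP => [|->]; last exact: cabs0.
by rewrite cabsE => /ComplexField.Normc.eq0_normc.
Qed.

Lemma cabs_gt0 x : (0 < cabs x) = (x != 0).
Proof. by rewrite lt_def cabs_ge0 andbT cabs_eq0. Qed.

Lemma cabs_real (a : R) : cabs (a%:C)%C = `|a|.
Proof. by rewrite /cabs /reC /imC /= expr0n addr0 sqrtr_sqr. Qed.

Lemma cabs_re w : `|reC w| <= cabs w.
Proof.
rewrite -(sqrtr_sqr (reC w)) /cabs ler_sqrt ?lerDl ?sqr_ge0//.
by rewrite addr_ge0 ?sqr_ge0.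
Qed.

Lemma cabs_im w : `|imC w| <= cabs w.
Proof.
rewrite -(sqrtr_sqr (imC w)) /cabs ler_sqrt ?lerDr ?sqr_ge0//.
by rewrite addr_ge0 ?sqr_ge0.
Qed.

Lemma cabs_imag (a : R) : cabs (Complex 0 a) = `|a|.
Proof. by rewrite /cabs /reC /imC /= expr0n add0r sqrtr_sqr. Qed.

Lemma cabs_le_reim w : cabs w <= `|reC w| + `|imC w|.
Proof.
have -> : w = ((reC w)%:C)%C + Complex 0 (imC w).
  by apply/eqP; rewrite eq_complex /= addr0 add0r !eqxx.
apply: le_trans (cabsD _ _) _; rewrite cabs_real cabs_imag /reC /imC /=.
by rewrite addr0 add0r.
Qed.

Lemma cabs_small_eq0 x (K : R) :
  (forall eps : R, 0 < eps -> cabs x <= K * eps) -> x = 0.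
Proof.
move=> H; apply/eqP; rewrite -cabs_eq0 eq_le cabs_ge0 andbT.
apply/ler_addgt0Pr => e e0; rewrite add0r.
have K0 : 0 < `|K| + 1 by rewrite ltr_wpDl.
apply: le_trans (H (e / (`|K| + 1)) _) _; first by rewrite divr_gt0.
rewrite mulrCA ler_piMr ?(ltW e0)// ler_pdivrMr// mul1r.
by rewrite (le_trans (ler_norm K))// lerDl.
Qed.

Lemma small_eq x y :
  (forall eps : R, 0 < eps -> cabs (x - y) < eps) -> x = y.
Proof.
move=> H; apply/eqP; rewrite -subr_eq0; apply/eqP.
by apply: (@cabs_small_eq0 _ 1) => e /H; rewrite mul1r => /ltW.
Qed.

Lemma reCD x y : reC (x + y) = reC x + reC y. Proof. by case: x; case: y. Qed.
Lemma imCD x y : imC (x + y) = imC x + imC y. Proof. by case: x; case: y. Qed.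
Lemma reCN x : reC (- x) = - reC x. Proof. by case: x. Qed.
Lemma imCN x : imC (- x) = - imC x. Proof. by case: x. Qed.
Lemma reCM x y : reC (x * y) = reC x * reC y - imC x * imC y.
Proof. by case: x; case: y. Qed.
Lemma imCM x y : imC (x * y) = reC x * imC y + imC x * reC y.
Proof. by case: x => a b; case: y => c d /=; rewrite /imC /reC /=; ring. Qed.

End ComplexModulus.

(** * Limits of complex sequences *)

Section Limits.
Variable R : realType.
Local Notation C := R[i].
Implicit Types (u v : nat -> C) (l m : C).

Lemma cconv_unique {u l m} : cconv u l -> cconv u m -> l = m.
Proof.
move=> ul um; apply: small_eq => e e0.
have [N1 H1] := ul _ (divr_gt0 e0 (ltr0n _ 2)).
have [N2 H2] := um _ (divr_gt0 e0 (ltr0n _ 2)).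
have := H1 _ (leq_maxl N1 N2); have := H2 _ (leq_maxr N1 N2).
set w := u _ => h2 h1; apply: le_lt_trans (cabs_dist _ w _) _.
by rewrite cabsBC (splitr e) ltrD.
Qed.

(** Completeness is inherited from [R] through real and imaginary parts, both 1-Lipschitz for
    [cabs]. *)
Lemma cconv_cauchy u :
  (forall eps : R, 0 < eps -> exists N, forall n k, (N <= n)%N -> (N <= k)%N ->
     cabs (u n - u k) < eps) -> exists l, cconv u l.
Proof.
move=> H.
have real_lim (f : C -> R) : (forall x y, `|f x - f y| <= cabs (x - y)) ->
    exists l : R, forall eps : R, 0 < eps ->
      exists N, forall n, (N <= n)%N -> `|f (u n) - l| < eps.
  move=> fL.
  have cf : cvgn (fun n => f (u n)).
    apply: cauchy_cvg; apply: cauchy_exP => e e0.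
    have [N HN] := H e e0; exists (f (u N)); exists N => // n /= hn.
    by rewrite /ball /=; apply: le_lt_trans (fL _ _) _; apply: HN.
  exists (limn (fun n => f (u n))) => e e0.
  have /cvgrPdist_lt/(_ e e0) := cf.
  case=> N _ hN; exists N => n hn; rewrite distrC; exact: hN.
have [|a Ha] := real_lim (@reC R); first by move=> x y; rewrite -reCN -reCD cabs_re.
have [|b Hb] := real_lim (@imC R); first by move=> x y; rewrite -imCN -imCD cabs_im.
exists (Complex a b) => e e0.
have [N1 H1] := Ha _ (divr_gt0 e0 (ltr0n _ 2)).
have [N2 H2] := Hb _ (divr_gt0 e0 (ltr0n _ 2)).
exists (maxn N1 N2) => n; rewrite geq_max => /andP[n1 n2].
apply: le_lt_trans (cabs_le_reim _) _.
by rewrite [e in ltRHS]splitr !reCD !imCD !reCN !imCN ltrD ?H1 ?H2.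
Qed.

Lemma cconvB u v l m : cconv u l -> cconv v m -> cconv (fun n => u n - v n) (l - m).
Proof.
move=> ul um e e0.
have [N1 H1] := ul _ (divr_gt0 e0 (ltr0n _ 2)).
have [N2 H2] := um _ (divr_gt0 e0 (ltr0n _ 2)).
exists (maxn N1 N2) => n; rewrite geq_max => /andP[/H1 h1 /H2 h2].
have -> : u n - v n - (l - m) = (u n - l) - (v n - m) by ring.
by apply: le_lt_trans (cabsB _ _) _; rewrite (splitr e) ltrD.
Qed.

Lemma cconvD u v l m : cconv u l -> cconv v m -> cconv (fun n => u n + v n) (l + m).
Proof.
move=> ul um e e0.
have [N1 H1] := ul _ (divr_gt0 e0 (ltr0n _ 2)).
have [N2 H2] := um _ (divr_gt0 e0 (ltr0n _ 2)).
exists (maxn N1 N2) => n; rewrite geq_max => /andP[/H1 h1 /H2 h2].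
have -> : u n + v n - (l + m) = (u n - l) + (v n - m) by ring.
by apply: le_lt_trans (cabsD _ _) _; rewrite (splitr e) ltrD.
Qed.

Lemma cconvZ (c : C) u l : cconv u l -> cconv (fun n => c * u n) (c * l).
Proof.
move=> ul e e0.
have K0 : 0 < cabs c + 1 by rewrite ltr_wpDl ?cabs_ge0.
have [N1 H1] := ul _ (divr_gt0 e0 K0).
exists N1 => n /H1 h; rewrite -mulrBr cabsM.
apply: (@le_lt_trans _ _ ((cabs c + 1) * cabs (u n - l))).
  by rewrite ler_wpM2r ?cabs_ge0// lerDl.
by rewrite mulrC -ltr_pdivlMr.
Qed.

Lemma cconv_le u l (b : R) N :
  cconv u l -> (forall n, (N <= n)%N -> cabs (u n) <= b) -> cabs l <= b.
Proof.
move=> ul H; apply/ler_addgt0Pr => e e0; have [N1 H1] := ul e e0.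
have /H h := leq_maxl N N1; have /H1 h1 := leq_maxr N N1.
have := cabsD (u (maxn N N1)) (l - u (maxn N N1)).
rewrite addrC subrK => /le_trans; apply; rewrite lerD// ltW// cabsBC//.
Qed.

Lemma cconv_ext u v l : u =1 v -> cconv u l -> cconv v l.
Proof. by move=> uv ul e /ul [N H]; exists N => n /H; rewrite uv. Qed.

Lemma geo_small (q e : R) : 0 <= q < 1 -> 0 < e ->
  exists N, forall n, (N <= n)%N -> q ^+ n < e.
Proof.
move=> /andP[q0 q1] e0.
have : (GRing.exp q @ \oo --> (0 : R))%classic by apply: cvg_expr; rewrite ger0_norm.
move/cvgrPdist_lt => /(_ e e0)[N _ H]; exists N => n /H.
by rewrite /= sub0r normrN ger0_norm// exprn_ge0.
Qed.

End Limits.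

(** * Integrals of complex-valued functions on the line *)

Section RealPrimitives.
Variable R : realType.
Local Notation mu := (@lebesgue_measure R).
Implicit Types (h H : R -> R) (a b c : R).

Definition primitive H h := forall x, is_derive x (1 : R) H (h x).

Lemma primitive_unique H1 H2 h a b :
  primitive H1 h -> primitive H2 h -> H1 b - H1 a = H2 b - H2 a.
Proof.
move=> P1 P2.
suff : H1 b - H2 b = H1 a - H2 a.
  by move/eqP; rewrite subr_eq => /eqP ->; ring.
apply: (@is_derive_0_is_cst _ (H1 - H2)) => x.
by have := @is_deriveB _ _ _ _ _ x 1 _ _ (P1 x) (P2 x); rewrite subrr.
Qed.

Lemma primitive_bound H h a b (M : R) : primitive H h -> a <= b ->
  (forall x, a <= x <= b -> `|h x| <= M) -> `|H b - H a| <= M * (b - a).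
Proof.
move=> PH ab hM.
have [| |c cab ->] := @MVT_segment R H h a b ab.
- by move=> x _; exact: PH.
- by apply: derivable_within_continuous => x _; have [] := PH x.
- rewrite normrM [`|b - a|]ger0_norm ?subr_ge0// ler_wpM2r ?subr_ge0//.
  by apply: hM; rewrite in_itv in cab.
Qed.

(** The fundamental theorem of calculus applies to the integral from [- n]; subtracting the value at
    0 makes the primitives for different [n] agree, so that they can be glued. *)
Lemma local_primitive h (n : R) : 0 < n -> continuous h ->
  exists H, H 0 = 0 /\ forall x : R, - n < x < n -> is_derive x (1 : R) H (h x).
Proof.
move=> n0 ch.
pose G x := (\int[mu]_(t in [set` `[(- n), x]]) (h t))%R.
exists (fun x => G x - G 0); split; first by rewrite subrr.
move=> x /andP[nx xn].
have ih : mu.-integrable `[(- n), n] (EFin \o h).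
  apply: continuous_compact_integrable; first exact: segment_compact.
  exact: continuous_subspaceT.
have [dG GE] := continuous_FTC1_closed xn ih nx (ch x).
have dG' : is_derive x (1 : R) G (h x).
  by split; [exact: dG|rewrite -derive1E; exact: GE].
by have := @is_deriveB _ _ _ _ _ x 1 _ _ dG' (is_derive_cst (G 0) x 1); rewrite subr0.
Qed.

Lemma continuous_primitive h : continuous h -> exists H, primitive H h.
Proof.
move=> ch.
have ex (n : nat) : exists H : R -> R, H 0 = 0 /\
    forall x : R, - n.+1%:R < x < n.+1%:R -> is_derive x (1 : R) H (h x).
  by apply: local_primitive.
have [F HF] := choice ex.
have Feq n m (x : R) : (n <= m)%N -> - n.+1%:R < x < n.+1%:R -> F n x = F m x.
  move=> nm /andP[x1 x2].
  have nmR : (n.+1%:R : R) <= m.+1%:R by rewrite ler_nat.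
  have dz (y : R) : - n.+1%:R < y < n.+1%:R -> is_derive y (1 : R) (F n - F m) 0.
    move=> /andP[y1 y2]; rewrite -(subrr (h y)); apply: is_deriveB.
      by apply: (HF n).2; rewrite y1.
    apply: (HF m).2; rewrite (lt_le_trans y2) ?andbT//.
    by apply: le_lt_trans y1; rewrite lerN2.
  have key (a b : R) : a <= b -> - n.+1%:R < a -> b < n.+1%:R ->
      (F n - F m) b = (F n - F m) a.
    move=> ab na bn.
    have [| |c _] := @MVT_segment R (F n - F m) (fun=> 0) a b ab.
    - move=> y /[!in_itv]/= /andP[ya yb]; apply: dz.
      by rewrite (lt_trans na)// (lt_trans yb).
    - apply: derivable_within_continuous => y /[!in_itv]/= /andP[ya yb].
      have [] // := dz y; by rewrite (lt_le_trans na)// (le_lt_trans yb).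
    - by rewrite mul0r => /eqP; rewrite subr_eq0 => /eqP.
  have F0 : (F n - F m) 0 = 0 by rewrite !fctE (HF n).1 (HF m).1 subrr.
  have : (F n - F m) x = 0.
    case: (leP 0 x) => x0.
      by rewrite (key 0 x)// oppr_lt0 ltr0n.
    by rewrite -(key x 0)// ?ltr0n// ltW.
  by move/eqP; rewrite !fctE subr_eq0 => /eqP.
(* The extra 1 keeps a whole unit neighbourhood of [x] inside the interval of the chosen primitive,
   so the glued function coincides with a single [F n] near [x]. *)
pose N (x : R) := Num.Def.trunc (`|x| + 1).
have NP (x y : R) : `|y - x| < 1 -> - (N x).+1%:R < y < (N x).+1%:R.
  move=> yx; rewrite -ltr_norml.
  apply: (@lt_trans _ _ (`|x| + 1)); last first.
    by have := truncnS_gt (`|x| + 1).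
  by rewrite -ltrBlDl (le_lt_trans _ yx)// lerB_dist.
exists (fun x => F (N x) x) => x.
apply: (@near_eq_is_derive _ _ _ (F (N x))).
  exists 1 => //= y; rewrite /ball/= distrC => yx.
  case/orP: (leq_total (N x) (N y)) => Nxy.
    by rewrite -(Feq _ _ _ Nxy)// NP.
  by rewrite (Feq _ _ _ Nxy)// NP// subrr normr0.
by apply: (HF (N x)).2; apply: NP; rewrite subrr normr0.
Qed.

Definition has_primitive h := exists H, primitive H h.

(** The integral is the increment of a primitive on the whole line, with default 0. Linearity and
    additivity become algebra on primitives, without measurability or integrability conditions; the
    price is that integrands must be continuous on all of [R]. *)
Definition rint h a b : R :=
  match pselect (has_primitive h) with
  | left e => projT1 (cid e) b - projT1 (cid e) a
  | right _ => 0
  end.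

Lemma rintE H h a b : primitive H h -> rint h a b = H b - H a.
Proof.
move=> PH; rewrite /rint; case: pselect => [e|]; last by case; exists H.
by case: cid => H' P' /=; exact: primitive_unique P' PH.
Qed.

End RealPrimitives.

Section ComplexIntegral.
Variable R : realType.
Local Notation C := R[i].
Implicit Types (h H : R -> C) (a b c : R).

Definition ccont h := forall (t eps : R), 0 < eps -> exists del : R, 0 < del /\
  forall t', `|t' - t| < del -> cabs (h t' - h t) < eps.

Definition cprimitive H h :=
  primitive (fun t => reC (H t)) (fun t => reC (h t)) /\
  primitive (fun t => imC (H t)) (fun t => imC (h t)).

Definition cint h a b : C :=
  Complex (rint (fun t => reC (h t)) a b) (rint (fun t => imC (h t)) a b).

Lemma cintE H h a b : cprimitive H h -> cint h a b = H b - H a.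
Proof.
move=> [P1 P2]; rewrite /cint (rintE _ _ P1) (rintE _ _ P2).
by case: (H a) (H b) => x1 y1 [x2 y2].
Qed.

Lemma ccont_primitive h : ccont h -> exists H, cprimitive H h.
Proof.
move=> ch.
have [|H1 P1] := @continuous_primitive R (fun t => reC (h t)).
  move=> t; apply/cvgrPdist_lt => e /(ch t)[d [d0 hd]].
  exists d => //= t'; rewrite /= distrC => /hd; apply: le_lt_trans.
  by rewrite distrC -reCN -reCD cabs_re.
have [|H2 P2] := @continuous_primitive R (fun t => imC (h t)).
  move=> t; apply/cvgrPdist_lt => e /(ch t)[d [d0 hd]].
  exists d => //= t'; rewrite /= distrC => /hd; apply: le_lt_trans.
  by rewrite distrC -imCN -imCD cabs_im.
by exists (fun t => Complex (H1 t) (H2 t)); split.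
Qed.

Lemma cprimitiveD H1 H2 h1 h2 : cprimitive H1 h1 -> cprimitive H2 h2 ->
  cprimitive (fun t => H1 t + H2 t) (fun t => h1 t + h2 t).
Proof.
move=> [P1 Q1] [P2 Q2]; split=> t.
  rewrite reCD.
  have -> : (fun t => reC (H1 t + H2 t)) = (fun t => reC (H1 t)) + (fun t => reC (H2 t)).
    by apply/funext => s; rewrite reCD.
  exact: is_deriveD.
rewrite imCD.
have -> : (fun t => imC (H1 t + H2 t)) = (fun t => imC (H1 t)) + (fun t => imC (H2 t)).
  by apply/funext => s; rewrite imCD.
exact: is_deriveD.
Qed.

Lemma cprimitiveZ (w : C) H h : cprimitive H h ->
  cprimitive (fun t => w * H t) (fun t => w * h t).
Proof.
move=> [P Q]; split=> t.
  rewrite reCM.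
  have -> : (fun t => reC (w * H t)) =
      reC w \*: (fun t => reC (H t)) - imC w \*: (fun t => imC (H t)).
    by apply/funext => s; rewrite reCM.
  by apply: is_deriveB; apply: is_deriveZ.
rewrite imCM.
have -> : (fun t => imC (w * H t)) =
    reC w \*: (fun t => imC (H t)) + imC w \*: (fun t => reC (H t)).
  by apply/funext => s; rewrite imCM.
by apply: is_deriveD; apply: is_deriveZ.
Qed.

Lemma cint_cat h a b c : ccont h -> cint h a b + cint h b c = cint h a c.
Proof.
by move=> /ccont_primitive[H P]; rewrite !(cintE _ _ P); ring.
Qed.

Lemma cintD h1 h2 a b : ccont h1 -> ccont h2 ->
  cint (fun t => h1 t + h2 t) a b = cint h1 a b + cint h2 a b.
Proof.
move=> /ccont_primitive[H1 P1] /ccont_primitive[H2 P2].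
by rewrite (cintE _ _ P1) (cintE _ _ P2) (cintE _ _ (cprimitiveD P1 P2)); ring.
Qed.

Lemma cintZ (w : C) h a b : ccont h ->
  cint (fun t => w * h t) a b = w * cint h a b.
Proof.
move=> /ccont_primitive[H1 P1].
by rewrite (cintE _ _ P1) (cintE _ _ (cprimitiveZ w P1)); ring.
Qed.

Lemma cintB h1 h2 a b : ccont h1 -> ccont h2 ->
  cint (fun t => h1 t - h2 t) a b = cint h1 a b - cint h2 a b.
Proof.
move=> /ccont_primitive[H1 P1] /ccont_primitive[H2 P2].
have -> : (fun t => h1 t - h2 t) = (fun t => h1 t + (-1) * h2 t).
  by apply/funext => t; ring.
rewrite (cintE _ _ P1) (cintE _ _ P2).
by rewrite (cintE _ _ (cprimitiveD P1 (cprimitiveZ (-1) P2))); ring.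
Qed.

(** The factor 2 comes from bounding real and imaginary parts separately. It reappears in all Cauchy
    estimates and is harmless, since only their growth rates matter. *)
Lemma cint_bound h a b (M : R) : ccont h -> a <= b ->
  (forall t, a <= t <= b -> cabs (h t) <= M) -> cabs (cint h a b) <= 2 * M * (b - a).
Proof.
move=> /ccont_primitive[H P] ab hM; rewrite (cintE _ _ P).
have [P1 P2] := P; apply: le_trans (cabs_le_reim _) _.
rewrite reCD imCD reCN imCN -mulrA mulrDl mul1r lerD//.
  by apply: (primitive_bound P1) => // t /hM; apply: le_trans; exact: cabs_re.
by apply: (primitive_bound P2) => // t /hM; apply: le_trans; exact: cabs_im.
Qed.

Lemma ccont_cst (w : C) : ccont (fun=> w).
Proof. by move=> t e e0; exists 1; split=> // t' _; rewrite subrr cabs0. Qed.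

Lemma ccontD h1 h2 : ccont h1 -> ccont h2 -> ccont (fun t => h1 t + h2 t).
Proof.
move=> c1 c2 t e e0.
have [d1 [d10 H1]] := c1 t _ (divr_gt0 e0 (ltr0n _ 2)).
have [d2 [d20 H2]] := c2 t _ (divr_gt0 e0 (ltr0n _ 2)).
exists (Num.min d1 d2); split; first by rewrite lt_min d10.
move=> t'; rewrite lt_min => /andP[/H1 h1' /H2 h2'].
have -> : h1 t' + h2 t' - (h1 t + h2 t) = (h1 t' - h1 t) + (h2 t' - h2 t) by ring.
by apply: le_lt_trans (cabsD _ _) _; rewrite [e]splitr ltrD.
Qed.

Lemma ccontM h1 h2 : ccont h1 -> ccont h2 -> ccont (fun t => h1 t * h2 t).
Proof.
move=> c1 c2 t e e0.
pose K := cabs (h1 t) + cabs (h2 t) + 1.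
have K0 : 0 < K by rewrite ltr_wpDl// addr_ge0 ?cabs_ge0.
pose e' := Num.min 1 (e / (2 * K)).
have e'0 : 0 < e' by rewrite lt_min ltr01 divr_gt0 ?mulr_gt0.
have [d1 [d10 H1]] := c1 t _ e'0; have [d2 [d20 H2]] := c2 t _ e'0.
exists (Num.min d1 d2); split; first by rewrite lt_min d10.
move=> t'; rewrite lt_min => /andP[/H1 h1' /H2 h2'].
have -> : h1 t' * h2 t' - h1 t * h2 t =
  (h1 t' - h1 t) * (h2 t' - h2 t) + ((h1 t' - h1 t) * h2 t + h1 t * (h2 t' - h2 t)) by ring.
apply: le_lt_trans (cabsD _ _) _.
apply: (@le_lt_trans _ _ (e' * K)).
  apply: (@le_trans _ _ (e' * 1 + (e' * cabs (h2 t) + cabs (h1 t) * e'))).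
    rewrite lerD//.
      rewrite cabsM; apply: ler_pM; rewrite ?cabs_ge0 ?(ltW h1')//.
      by rewrite (le_trans (ltW h2'))// /e' ge_min lexx.
    apply: le_trans (cabsD _ _) _; rewrite !cabsM lerD//.
      by rewrite ler_wpM2r ?cabs_ge0 ?ltW.
    by rewrite ler_wpM2l ?cabs_ge0 ?ltW.
  by rewrite /K !mulrDr !mulr1; lra.
apply: (@le_lt_trans _ _ (e / (2 * K) * K)).
  by rewrite ler_wpM2r ?(ltW K0)// /e' ge_min lexx orbT.
have -> : e / (2 * K) * K = e / 2 by field; rewrite gt_eqF.
by rewrite ltr_pdivrMr// ltr_pMr// ltr1n.
Qed.

Lemma ccontN h : ccont h -> ccont (fun t => - h t).
Proof.
move=> c1 t e /(c1 t)[d [d0 H]]; exists d; split=> // t' /H.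
by rewrite -opprD cabsN.
Qed.

Lemma ccontB h1 h2 : ccont h1 -> ccont h2 -> ccont (fun t => h1 t - h2 t).
Proof. by move=> c1 c2; apply: ccontD => //; apply: ccontN. Qed.

Lemma ccontV h : ccont h -> (forall t, h t != 0) -> ccont (fun t => (h t)^-1).
Proof.
move=> c1 h0 t e e0.
have k0 : 0 < cabs (h t) by rewrite cabs_gt0.
pose e' := Num.min (cabs (h t) / 2) (e * cabs (h t) ^+ 2 / 2).
have e'0 : 0 < e' by rewrite lt_min !divr_gt0// mulr_gt0// exprn_gt0.
have [d [d0 H]] := c1 t _ e'0; exists d; split=> // t' /H {H}.
rewrite lt_min => /andP[h1 h2].
have h3 : cabs (h t) / 2 < cabs (h t').
  have := cabs_dist (h t) (h t') 0; rewrite !subr0 cabsBC => h3.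
  have -> : cabs (h t) / 2 = cabs (h t) - cabs (h t) / 2 by field.
  by rewrite ltrBlDl (le_lt_trans h3)// ltrD2r.
have -> : (h t')^-1 - (h t)^-1 = (h t - h t') / (h t' * h t).
  by field; rewrite !h0.
rewrite cabs_div cabsBC cabsM ltr_pdivrMr ?mulr_gt0// ?cabs_gt0//.
apply: lt_trans h2 _; rewrite -mulrA ltr_pM2l// expr2 mulrAC ltr_pM2r//.
Qed.

Lemma ccont_sum (F : nat -> R -> C) n : (forall i, ccont (F i)) ->
  ccont (fun t => \sum_(i < n) F i t).
Proof.
move=> cF; elim: n => [|n IH].
  have -> : (fun t => \sum_(i < 0) F i t) = (fun=> 0 : C).
    by apply/funext => t; rewrite big_ord0.
  exact: ccont_cst.
have -> : (fun t => \sum_(i < n.+1) F i t) = (fun t => \sum_(i < n) F i t + F n t).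
  by apply/funext => t; rewrite big_ord_recr.
exact: ccontD.
Qed.

Lemma cint_sum (F : nat -> R -> C) n a b : (forall i, ccont (F i)) ->
  cint (fun t => \sum_(i < n) F i t) a b = \sum_(i < n) cint (F i) a b.
Proof.
move=> cF; elim: n => [|n IH].
  have -> : (fun t => \sum_(i < 0) F i t) = (fun=> 0 * 0 : C).
    by apply/funext => t; rewrite big_ord0 mul0r.
  by rewrite big_ord0 (cintZ 0 _ _ (ccont_cst _)) mul0r.
have -> : (fun t => \sum_(i < n.+1) F i t) = (fun t => \sum_(i < n) F i t + F n t).
  by apply/funext => t; rewrite big_ord_recr.
by rewrite cintD ?IH ?big_ord_recr//; exact: ccont_sum.
Qed.

Lemma cprimitive_ccont H h : cprimitive H h -> ccont H.
Proof.
move=> [P Q] t e e0; have e2 : 0 < e / 2 by rewrite divr_gt0.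
have c1 : {for t, continuous (fun t => reC (H t))}.
  apply: differentiable_continuous; apply/derivable1_diffP.
  by have [] := P t.
have c2 : {for t, continuous (fun t => imC (H t))}.
  apply: differentiable_continuous; apply/derivable1_diffP.
  by have [] := Q t.
move/cvgrPdist_lt : c1 => /(_ _ e2)[d1 /= d10 H1].
move/cvgrPdist_lt : c2 => /(_ _ e2)[d2 /= d20 H2].
exists (Num.min d1 d2); split; first by rewrite lt_min d10.
move=> t'; rewrite lt_min => /andP[t1 t2].
apply: le_lt_trans (cabs_le_reim _) _.
rewrite [e]splitr reCD imCD reCN imCN; apply: ltrD; rewrite distrC.
  by apply: H1; rewrite /= distrC.
by apply: H2; rewrite /= distrC.
Qed.

End ComplexIntegral.

(** * Goursat's theorem and Cauchy's formula *)

Section Goursat.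
Variable R : realType.
Local Notation C := R[i].

Lemma half_pow_small (e : R) : 0 < e -> exists n, 2^-1 ^+ n < e.
Proof.
move=> e0; have [|N H] := @geo_small R 2^-1 e _ e0.
  by rewrite invr_ge0 ler0n invf_lt1 ?ltr1n.
by exists N; exact: H.
Qed.

(** The supremum of the left ends lies in every interval of the nested family. *)
Lemma nested_sup (x w : nat -> R) :
  (forall n, x n <= x n.+1) -> (forall n, x n.+1 + w n.+1 <= x n + w n) ->
  (forall n, 0 <= w n) -> exists X, forall n, x n <= X <= x n + w n.
Proof.
move=> xi wd w0.
have xm n m : (n <= m)%N -> x n <= x m.
  by move=> /subnKC <-; elim: (m - n)%N => [|k IH]; rewrite ?addn0 ?addnS// (le_trans IH).
have wm n m : (n <= m)%N -> x m + w m <= x n + w n.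
  by move=> /subnKC <-; elim: (m - n)%N => [|k IH]; rewrite ?addn0 ?addnS// (le_trans _ IH).
have ub n : ubound [set x k | k in setT]%classic (x n + w n).
  move=> _ [k _ <-]; case/orP: (leq_total k n) => kn.
    by rewrite (le_trans (xm _ _ kn))// lerDl.
  by rewrite (le_trans _ (wm _ _ kn))// lerDl.
exists (sup [set x k | k in setT]%classic) => n; apply/andP; split.
  by apply: ub_le_sup; [exists (x 0%N + w 0%N); exact: ub|exists n].
by apply: ge_sup; [exists (x 0%N); exists 0%N|exact: ub].
Qed.

(** Goursat's argument for any additive function of rectangles. Among four quarters one keeps a
    quarter of [cabs J], so some nested sequence keeps [eta * 4^-1 ^+ n]; at its limit point the
    local hypothesis gives an arbitrarily small multiple of the same power. Only rectangles
    containing the limit point need to be estimated. *)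
Lemma goursat_bisection (J : R -> R -> R -> R -> C) (a b c d : R) :
  a <= b -> c <= d ->
  (forall x1 x2 x3 y1 y2, J x1 x2 y1 y2 + J x2 x3 y1 y2 = J x1 x3 y1 y2) ->
  (forall x1 x2 y1 y2 y3, J x1 x2 y1 y2 + J x1 x2 y2 y3 = J x1 x2 y1 y3) ->
  (forall x y, a <= x <= b -> c <= y <= d -> forall eps : R, 0 < eps ->
    exists del : R, 0 < del /\ forall x1 x2 y1 y2,
      a <= x1 <= x -> x <= x2 <= b -> c <= y1 <= y -> y <= y2 <= d ->
      x2 - x1 < del -> y2 - y1 < del ->
      cabs (J x1 x2 y1 y2) <= eps * (x2 - x1 + (y2 - y1)) ^+ 2) ->
  J a b c d = 0.
Proof.
move=> ab cd addx addy loc; apply/eqP; rewrite -cabs_eq0; apply/eqP.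
apply: contrapT => /eqP eta0.
have {}eta0 : 0 < cabs (J a b c d) by rewrite lt_def eta0 cabs_ge0.
set eta := cabs _ in eta0.
pose w n := (b - a) * 2^-1 ^+ n; pose v n := (d - c) * 2^-1 ^+ n.
have hp n : 0 <= (2^-1 : R) ^+ n by rewrite exprn_ge0 ?invr_ge0.
have w0 n : 0 <= w n by rewrite mulr_ge0// subr_ge0.
have v0 n : 0 <= v n by rewrite mulr_ge0// subr_ge0.
have wS n : w n = w n.+1 + w n.+1 by rewrite /w exprS; field.
have vS n : v n = v n.+1 + v n.+1 by rewrite /v exprS; field.
pose Q n (p : R * R) := [/\ a <= p.1, p.1 + w n <= b, c <= p.2, p.2 + v n <= d
  & eta * 4^-1 ^+ n <= cabs (J p.1 (p.1 + w n) p.2 (p.2 + v n))].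
(* The hypothesis [Q] is placed under the existential so that [choice] yields a total successor
   function. *)
have step (np : nat * (R * R)) : exists p', Q np.1 np.2 ->
    [/\ Q np.1.+1 p', np.2.1 <= p'.1, p'.1 + w np.1.+1 <= np.2.1 + w np.1,
        np.2.2 <= p'.2 & p'.2 + v np.1.+1 <= np.2.2 + v np.1].
  case: np => n [x y] /=; case: (pselect (Q n (x, y))) => [q|nq]; last by exists (x, y).
  case: q => /= q1 q2 q3 q4 q5.
  have w1 := w0 n.+1; have v1 := v0 n.+1; have wn := wS n; have vn := vS n.
  pose x' := x + w n.+1; pose y' := y + v n.+1.
  (* If no quarter qualified, all four would lie below [eta * 4^-1 ^+ n.+1], and their sum below the
     value carried by the parent. *)
  apply: contrapT => H.
  have {}H px py : (px = x \/ px = x') -> (py = y \/ py = y') ->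
      cabs (J px (px + w n.+1) py (py + v n.+1)) < eta * 4^-1 ^+ n.+1.
    move=> [->|->] [->|->]; rewrite ltNge; apply/negP => h; apply: H;
      [exists (x, y)|exists (x, y')|exists (x', y)|exists (x', y')] => _ /=;
      by split; [split=> //=|..]; rewrite /= ?/x' ?/y'; lra.
  have h1 := H x y (or_introl erefl) (or_introl erefl).
  have h2 := H x y' (or_introl erefl) (or_intror erefl).
  have h3 := H x' y (or_intror erefl) (or_introl erefl).
  have h4 := H x' y' (or_intror erefl) (or_intror erefl).
  have xE : x' + w n.+1 = x + w n by rewrite /x' -addrA -wn.
  have yE : y' + v n.+1 = y + v n by rewrite /y' -addrA -vn.
  rewrite xE in h3 h4; rewrite yE in h2 h4.
  have JE : J x (x + w n) y (y + v n) =
    (J x x' y y' + J x x' y' (y + v n)) + (J x' (x + w n) y y' + J x' (x + w n) y' (y + v n)).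
    by rewrite !addy addx.
  have : cabs (J x (x + w n) y (y + v n)) < eta * 4^-1 ^+ n.
    rewrite JE; apply: le_lt_trans (cabsD _ _) _.
    apply: le_lt_trans (lerD (cabsD _ _) (cabsD _ _)) _.
    have -> : eta * 4^-1 ^+ n = eta * 4^-1 ^+ n.+1 + eta * 4^-1 ^+ n.+1 +
        (eta * 4^-1 ^+ n.+1 + eta * 4^-1 ^+ n.+1) by rewrite exprS; field.
    by do 2!rewrite ltrD//.
  by rewrite ltNge q5.
have [f Hf] := choice step.
pose p := fix p n := if n is m.+1 then f (m, p m) else (a, c).
have Qp n : Q n (p n).
  elim: n => [|n IH]; last by have [] := Hf (n, p n) IH.
  by split=> //=; rewrite /w /v !expr0 !mulr1 ?[a + _]addrC ?[c + _]addrC !subrK.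
have pS n := Hf (n, p n) (Qp n).
have [X HX] := @nested_sup (fun n => (p n).1) w (fun n => let: And5 _ h _ _ _ := pS n in h)
  (fun n => let: And5 _ _ h _ _ := pS n in h) w0.
have [Y HY] := @nested_sup (fun n => (p n).2) v (fun n => let: And5 _ _ _ h _ := pS n in h)
  (fun n => let: And5 _ _ _ _ h := pS n in h) v0.
pose L := b - a + (d - c).
have L0 : 0 <= L by rewrite addr_ge0 ?subr_ge0.
(* The [+ 1] gives the strict inequality [e * L ^+ 2 < eta], also when the rectangle is
   degenerate. *)
pose e := eta / (L ^+ 2 + 1).
have L20 : 0 < L ^+ 2 + 1 by rewrite ltr_wpDl ?sqr_ge0.
have e0 : 0 < e by rewrite divr_gt0.
have [||del [del0 Hd]] := loc X Y _ _ e e0.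
- by have := HX 0%N; rewrite /= /w expr0 mulr1 addrC subrK.
- by have := HY 0%N; rewrite /= /v expr0 mulr1 addrC subrK.
have L1 : 0 < L + 1 by rewrite ltr_wpDl.
have [n hn] := half_pow_small (divr_gt0 del0 L1).
rewrite ltr_pdivlMr// in hn.
have [q1 q2 q3 q4 q5] := Qp n.
have /andP[X1 X2] := HX n; have /andP[Y1 Y2] := HY n.
have small (z : R) : 0 <= z <= L -> z * 2^-1 ^+ n < del.
  move=> /andP[z0 zL]; apply: le_lt_trans hn; rewrite mulrC ler_wpM2l//.
  by rewrite (le_trans zL)// lerDl.
have := Hd (p n).1 ((p n).1 + w n) (p n).2 ((p n).2 + v n).
rewrite q1 X1 X2 q2 q3 Y1 Y2 q4.
have wE : (p n).1 + w n - (p n).1 = w n by rewrite addrAC subrr add0r.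
have vE : (p n).2 + v n - (p n).2 = v n by rewrite addrAC subrr add0r.
rewrite wE vE => /(_ isT isT isT isT).
have -> : w n < del by apply: small; rewrite subr_ge0 ab /L lerDl subr_ge0.
have -> : v n < del by apply: small; rewrite subr_ge0 cd /L lerDr subr_ge0.
move=> /(_ isT isT) /(le_trans q5).
have -> : w n + v n = L * 2^-1 ^+ n by rewrite /w /v -mulrDl.
rewrite exprMn -exprM mulnC exprM.
have -> : (2^-1 : R) ^+ 2 = 4^-1 by field.
rewrite mulrA ler_pM2r ?exprn_gt0//.
rewrite leNgt => /negP; apply.
by rewrite /e mulrAC ltr_pdivrMr// ltr_pM2l// ltrDl.
Qed.

End Goursat.

(** * The complex exponential along real lines *)

Section ComplexExponential.
Variable R : realType.
Local Notation C := R[i].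
Implicit Types (w z : C) (t : R).

Lemma complex_eqP z w : reC z = reC w -> imC z = imC w -> z = w.
Proof. by case: z w => a b [c d] /= -> ->. Qed.

Lemma reC_cexp w : reC (cexp w) = expR (reC w) * cos (imC w).
Proof. by []. Qed.

Lemma imC_cexp w : imC (cexp w) = expR (reC w) * sin (imC w).
Proof. by []. Qed.

Lemma cexpD z w : cexp (z + w) = cexp z * cexp w.
Proof.
apply: complex_eqP; rewrite ?reCM ?imCM /cexp /= reCD imCD expRD.
  by rewrite cosD /reC /imC /=; ring.
by rewrite sinD /reC /imC /=; ring.
Qed.

Lemma cexp0 : cexp (0 : C) = 1.
Proof. by apply: complex_eqP; rewrite /= expR0 ?cos0 ?sin0 ?mulr1 ?mulr0. Qed.

Lemma cabs_cexp w : cabs (cexp w) = expR (reC w).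
Proof.
rewrite /cabs /cexp /reC /imC /=.
have -> : (expR (complex.Re w) * cos (complex.Im w)) ^+ 2 +
    (expR (complex.Re w) * sin (complex.Im w)) ^+ 2 =
    expR (complex.Re w) ^+ 2 * (cos (complex.Im w) ^+ 2 + sin (complex.Im w) ^+ 2) by ring.
by rewrite cos2Dsin2 mulr1 sqrtr_sqr ger0_norm ?expR_ge0.
Qed.

Lemma cexp_neq0 w : cexp w != 0.
Proof. by rewrite -cabs_gt0 cabs_cexp expR_gt0. Qed.

Lemma cexpX w n : cexp w ^+ n = cexp (n%:R * w).
Proof.
elim: n => [|n IH]; first by rewrite expr0 mul0r cexp0.
by rewrite exprS IH -cexpD; congr cexp; rewrite -natr1; ring.
Qed.

Lemma reC_real t w : reC ((t%:C)%C * w) = t * reC w.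
Proof. by rewrite reCM /reC /imC /= mul0r subr0. Qed.

Lemma imC_real t w : imC ((t%:C)%C * w) = t * imC w.
Proof. by rewrite imCM /reC /imC /= mul0r addr0. Qed.

Lemma cexp_line w : cprimitive (fun t => cexp ((t%:C)%C * w))
  (fun t => w * cexp ((t%:C)%C * w)).
Proof.
pose a := reC w; pose b := imC w.
split=> t.
  have -> : (fun s => reC (cexp ((s%:C)%C * w))) = (fun s => expR (s * a) * cos (s * b)).
    by apply/funext => s; rewrite /cexp {1}/reC /= reC_real imC_real.
  apply: is_derive_eq; rewrite reCM /cexp {2}/reC {3}/imC /= reC_real imC_real.
  by rewrite -/a -/b /GRing.scale /=; ring.
have -> : (fun s => imC (cexp ((s%:C)%C * w))) = (fun s => expR (s * a) * sin (s * b)).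
  by apply/funext => s; rewrite /cexp {1}/imC /= reC_real imC_real.
apply: is_derive_eq; rewrite imCM /cexp {2}/imC {2}/reC /= reC_real imC_real.
by rewrite -/a -/b /GRing.scale /=; ring.
Qed.

Lemma cprimitive_ftc_bound (H h : R -> C) (a b M : R) : cprimitive H h -> ccont h ->
  (forall t, Num.min a b <= t <= Num.max a b -> cabs (h t) <= M) ->
  cabs (H b - H a) <= 2 * M * `|b - a|.
Proof.
move=> P ch hM; case: (leP a b) => ab.
  rewrite -(cintE a b P) ger0_norm ?subr_ge0//; apply: cint_bound => // t tab.
  by apply: hM; rewrite min_l// max_r.
rewrite cabsBC -(cintE b a P) distrC ger0_norm ?subr_ge0 ?(ltW ab)//.
have ba : b <= a by exact: ltW.
by apply: cint_bound => // t tab; apply: hM; rewrite min_r// max_l.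
Qed.

Lemma cexp_line_ccont w : ccont (fun t => cexp ((t%:C)%C * w)).
Proof. exact: cprimitive_ccont (cexp_line w). Qed.

Lemma cexp_line_lip w (a b M : R) :
  (forall t, Num.min a b <= t <= Num.max a b -> cabs (cexp ((t%:C)%C * w)) <= M) ->
  cabs (cexp ((b%:C)%C * w) - cexp ((a%:C)%C * w)) <= 2 * (cabs w * M) * `|b - a|.
Proof.
move=> hM; apply: (cprimitive_ftc_bound (cexp_line w)).
  by apply: ccontM; [exact: ccont_cst|exact: cexp_line_ccont].
by move=> t /hM h; rewrite cabsM ler_wpM2l ?cabs_ge0.
Qed.

Definition cis t : C := cexp ((t%:C)%C * Complex 0 1).

Lemma cabs_cis t : cabs (cis t) = 1.
Proof. by rewrite cabs_cexp reC_real /reC /= mulr0 expR0. Qed.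

Lemma cis_neq0 t : cis t != 0.
Proof. exact: cexp_neq0. Qed.

Lemma cis0 : cis 0 = 1.
Proof. by rewrite /cis mul0r cexp0. Qed.

Lemma cis2pi : cis (2 * pi) = 1.
Proof.
apply: complex_eqP; rewrite /cis ?reC_cexp ?imC_cexp reC_real imC_real /reC /imC /=.
  by rewrite mulr0 expR0 mul1r mulr1 mulr_natl cos2pi.
by rewrite mulr0 expR0 mul1r mulr1 mulr_natl sin2pi.
Qed.

Lemma cis_ccont : ccont cis.
Proof. exact: cexp_line_ccont. Qed.

Lemma cis_lip (a b : R) : cabs (cis b - cis a) <= 2 * `|b - a|.
Proof.
have := @cexp_line_lip (Complex 0 1) a b 1.
rewrite cabs_imag normr1 !mulr1; apply => t _.
by rewrite -/(cis t) cabs_cis.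
Qed.

Lemma cexp_lip w : cabs (cexp w - 1) <= 2 * (cabs w * expR (cabs w)).
Proof.
have := @cexp_line_lip w 0 1 (expR (cabs w)) _.
rewrite mul1r mul0r cexp0 subr0 normr1 mulr1; apply.
rewrite min_l// max_r// => t /andP[t0 t1].
rewrite cabs_cexp reC_real ler_expR.
apply: le_trans (ler_norm _) _; rewrite normrM ger0_norm//.
by apply: le_trans (cabs_re w); rewrite ler_piMl.
Qed.

(** The left side is the integral over [[0, 1]] of [w * (cexp (t * w) - 1)], whose second factor is
    bounded by the Lipschitz estimate [cexp_lip]. *)
Lemma cexp_second_order w :
  cabs (cexp w - 1 - w) <= 4 * cabs w ^+ 2 * expR (cabs w).
Proof.
pose h t := w * (cexp ((t%:C)%C * w) - 1).
have ch : ccont h.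
  apply: ccontM; first exact: ccont_cst.
  by apply: ccontB; [exact: cexp_line_ccont|exact: ccont_cst].
have P : cprimitive (fun t => cexp ((t%:C)%C * w) - (t%:C)%C * w) h.
  have Pid : cprimitive (fun t => w * (t%:C)%C) (fun=> w * 1).
    apply: cprimitiveZ; split => t; rewrite /reC /imC /=.
      exact: is_derive_id.
    exact: is_derive_cst.
  have := cprimitiveD (cexp_line w) (cprimitiveZ (-1) Pid).
  congr cprimitive; apply/funext => t; first by ring.
  by rewrite /h; ring.
have := cint_bound (a := 0) (b := 1) (M := cabs w * (2 * (cabs w * expR (cabs w)))) ch ler01.
rewrite (cintE _ _ P) mul1r mul0r cexp0 !subr0 mulr1.
have -> : cexp w - w - 1 = cexp w - 1 - w by ring.
move=> /(_ _)/le_trans; apply; last by rewrite expr2; lra.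
move=> t /andP[t0 t1]; rewrite /h cabsM ler_wpM2l ?cabs_ge0//.
apply: le_trans (cexp_lip _) _.
rewrite cabsM cabs_real ger0_norm//.
have tw : t * cabs w <= cabs w by rewrite ler_piMl ?cabs_ge0.
by rewrite ler_wpM2l// ler_pM ?mulr_ge0 ?cabs_ge0 ?expR_ge0// ler_expR.
Qed.

End ComplexExponential.

(** * Cauchy's formula on a circle, by contraction towards the evaluation point *)

Section CauchyFormula.
Variable R : realType.
Local Notation C := R[i].

Lemma twice_add (x : R) : 2 * x = x + x.
Proof. by ring. Qed.

Implicit Types (f phi : C -> C) (z w a : C).

Definition cdiff phi z a := forall eps : R, 0 < eps -> exists del : R, 0 < del /\
  forall h, cabs h < del -> cabs (phi (z + h) - phi z - a * h) <= eps * cabs h.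

Definition ccontinuous_at f z := forall eps : R, 0 < eps -> exists del : R, 0 < del /\
  forall w, cabs (w - z) < del -> cabs (f w - f z) < eps.

Lemma cdiff_continuous phi z a : cdiff phi z a -> ccontinuous_at phi z.
Proof.
move=> D e e0; have [d [d0 H]] := D 1 ltr01.
have K0 : 0 < 1 + cabs a by rewrite ltr_pwDl ?cabs_ge0.
exists (Num.min d (e / (1 + cabs a))); split; first by rewrite lt_min d0 divr_gt0.
move=> w; rewrite lt_min => /andP[/H]; rewrite [z + _]addrC subrK mul1r => h1 h2.
have -> : phi w - phi z = (phi w - phi z - a * (w - z)) + a * (w - z) by ring.
apply: le_lt_trans (cabsD _ _) _; rewrite cabsM.
rewrite ltr_pdivlMr// mulrC in h2; apply: le_lt_trans h2.
by rewrite mulrDl mul1r lerD.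
Qed.

(** Radial retraction onto the closed disc. Precomposing with it turns a function known on the disc
    into one continuous on all of [C], as integrands with global primitives require. *)
Definition disc_retract (r : R) z : C := ((r / Num.max r (cabs z))%:C)%C * z.

Lemma disc_retract_id (r : R) z : 0 < r -> cabs z <= r -> disc_retract r z = z.
Proof.
by move=> r0 zr; rewrite /disc_retract max_l// divff ?gt_eqF// rmorph1 mul1r.
Qed.

Lemma disc_retract_le (r : R) z : 0 < r -> cabs (disc_retract r z) <= r.
Proof.
move=> r0; rewrite cabsM cabs_real.
have m0 : 0 < Num.max r (cabs z) by rewrite lt_max r0.
rewrite ger0_norm ?divr_ge0 ?(ltW r0) ?(ltW m0)//.
by rewrite mulrAC ler_pdivrMr// ler_pM2l// le_max lexx orbT.
Qed.

Lemma disc_retract_lip (r : R) z w : 0 < r ->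
  cabs (disc_retract r z - disc_retract r w) <= 2 * cabs (z - w).
Proof.
move=> r0; rewrite /disc_retract; set m := Num.max r (cabs z); set n := Num.max r (cabs w).
have m0 : 0 < m by rewrite lt_max r0.
have n0 : 0 < n by rewrite lt_max r0.
have -> : ((r / m)%:C)%C * z - ((r / n)%:C)%C * w =
    ((r / m)%:C)%C * (z - w) + ((r / m * ((n - m) / n))%:C)%C * w.
  have -> : r / m * ((n - m) / n) = r / m - r / n by field; rewrite !gt_eqF.
  by rewrite rmorphB; ring.
have rm : 0 <= r / m <= 1.
  by rewrite divr_ge0 ?(ltW r0) ?(ltW m0)//= ler_pdivrMr// mul1r le_max lexx.
case/andP: rm => rm0 rm1.
have zw : `|n - m| <= cabs (z - w).
  have h1 := cabs_subl z w; have h2 := cabs_subl w z; rewrite cabsBC in h2.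
  have h3 := cabs_ge0 (z - w).
  rewrite ler_norml /n /m.
  by case: (leP r (cabs w)); case: (leP r (cabs z)) => ? ?; lra.
apply: le_trans (cabsD _ _) _; rewrite twice_add lerD//.
  by rewrite cabsM cabs_real ger0_norm// ler_piMl// cabs_ge0.
rewrite cabsM cabs_real normrM ger0_norm// -mulrA; apply: le_trans zw.
apply: (@le_trans _ _ (`|(n - m) / n| * cabs w)).
  by rewrite ler_piMl// mulr_ge0 ?cabs_ge0.
rewrite normrM normfV (gtr0_norm n0) -mulrA ler_piMr//.
by rewrite mulrC ler_pdivrMr// mul1r le_max lexx orbT.
Qed.

Lemma ccont_comp f (g : R -> C) : (forall z, ccontinuous_at f z) -> ccont g ->
  ccont (fun t => f (g t)).
Proof.
move=> cf cg t e e0; have [d [d0 H]] := cf (g t) e e0.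
by have [d' [d'0 H']] := cg t d d0; exists d'; split=> // t' /H' /H.
Qed.

Section Homotopy.
Variables (f : C -> C) (r : R) (a : C).
Hypothesis r_gt0 : 0 < r.
Hypothesis a_lt : cabs a < r.
Hypothesis f_cont : forall z, ccontinuous_at f z.
(** Increments stay in the closed disc: a holomorphic function composed with [disc_retract] need not
    be differentiable across the circle. *)
Hypothesis f_diff : forall z, cabs z <= r -> exists b, forall eps : R, 0 < eps ->
  exists del : R, 0 < del /\ forall w, cabs w <= r -> cabs (w - z) < del ->
    cabs (f w - f z - b * (w - z)) <= eps * cabs (w - z).

Let k (t : R) : C := (r%:C)%C * cis t - a.
Let k' (t : R) : C := (r%:C)%C * (Complex 0 1 * cis t).
Let B (t : R) : C := k' t / k t.
Let e (u : R) : C := cexp ((u%:C)%C * 1).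
Let p (u t : R) : C := a + e u * k t.

(* [p u] sweeps the circle of radius [r] towards [a]; in the coordinates
   [(u, t)] the form [f(z) dz / (z - a)] reads [f (p u t) (du + B t dt)]. *)
Let J (g : C -> C) (x1 x2 y1 y2 : R) : C :=
  cint (fun u => g (p u y1) - g (p u y2)) x1 x2 +
  cint (fun t => (g (p x2 t) - g (p x1 t)) * B t) y1 y2.

Let k_ge t : r - cabs a <= cabs (k t).
Proof.
have := cabs_subl ((r%:C)%C * cis t) a.
by rewrite cabsM cabs_real cabs_cis mulr1 gtr0_norm.
Qed.

Let k_neq0 t : k t != 0.
Proof. by rewrite -cabs_gt0 (lt_le_trans _ (k_ge t))// subr_gt0. Qed.

Let k_le t : cabs (k t) <= 2 * r.
Proof.
apply: le_trans (cabsB _ _) _.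
rewrite cabsM cabs_real cabs_cis mulr1 gtr0_norm//.
by rewrite twice_add lerD2l ltW.
Qed.

Let KB := r / (r - cabs a).

Let KB_ge0 : 0 <= KB.
Proof. by rewrite divr_ge0 ?(ltW r_gt0)// subr_ge0 ltW. Qed.

Let B_le t : cabs (B t) <= KB.
Proof.
rewrite cabs_div !cabsM cabs_real cabs_cis cabs_imag normr1 !mulr1 gtr0_norm//.
rewrite /KB ler_wpM2l ?(ltW r_gt0)// lef_pV2 ?posrE ?k_ge//.
  by rewrite cabs_gt0.
by rewrite subr_gt0.
Qed.

Let k_prim : cprimitive k k'.
Proof.
have P0 : cprimitive (fun=> - a) (fun=> 0 : C).
  by split=> t; exact: is_derive_cst.
have := cprimitiveD (cprimitiveZ (r%:C)%C (cexp_line (Complex 0 1))) P0.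
by congr cprimitive; apply/funext => t; rewrite ?addr0.
Qed.

Let k_cont : ccont k. Proof. exact: cprimitive_ccont k_prim. Qed.

Let k'_cont : ccont k'.
Proof.
apply: ccontM; first exact: ccont_cst.
by apply: ccontM; [exact: ccont_cst|exact: cis_ccont].
Qed.

Let B_cont : ccont B.
Proof. by apply: ccontM => //; apply: ccontV. Qed.

Let e_prim : cprimitive e e.
Proof.
by have := cexp_line (1 : C); congr cprimitive; apply/funext => t; rewrite mul1r.
Qed.

Let e_cont : ccont e. Proof. exact: cprimitive_ccont e_prim. Qed.

Let eE u : e u = ((expR u)%:C)%C.
Proof.
by apply: complex_eqP; rewrite /e ?reC_cexp ?imC_cexp reC_real imC_real /reC /imC /=;
  rewrite mulr1 mulr0 ?cos0 ?sin0 ?mulr1 ?mulr0.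
Qed.

Let p_contu t : ccont (fun u => p u t).
Proof.
apply: ccontD; first exact: ccont_cst.
by apply: ccontM => //; exact: ccont_cst.
Qed.

Let p_contt u : ccont (p u).
Proof.
apply: ccontD; first exact: ccont_cst.
by apply: ccontM => //; exact: ccont_cst.
Qed.

(** For [u <= 0] the point is a convex combination of [a] and a point of the circle. *)
Let p_le u t : u <= 0 -> cabs (p u t) <= r.
Proof.
move=> u0; have e1 : expR u <= 1 by rewrite expR_le1.
have -> : p u t = ((1 - expR u)%:C)%C * a + ((expR u * r)%:C)%C * cis t.
  by rewrite /p /k eE rmorphB rmorphM rmorph1; ring.
apply: le_trans (cabsD _ _) _; rewrite !cabsM !cabs_real cabs_cis mulr1.
rewrite ger0_norm ?subr_ge0// ger0_norm ?mulr_ge0 ?expR_ge0 ?(ltW r_gt0)//.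
have : (1 - expR u) * cabs a <= (1 - expR u) * r.
  by apply: ler_wpM2l; [rewrite subr_ge0|exact: ltW].
by lra.
Qed.

Let p_lip u t x y : u <= 0 -> x <= 0 ->
  cabs (p u t - p x y) <= 4 * r * (`|u - x| + `|t - y|).
Proof.
move=> u0 x0.
have -> : p u t - p x y = e u * (k t - k y) + (e u - e x) * k y by rewrite /p; ring.
have e1 : cabs (e u - e x) <= 2 * `|u - x|.
  have := @cexp_line_lip R 1 x u 1; rewrite cabs1 (_ : 2 * (1 * 1) = 2); last by ring.
  apply => s /andP[_ hs].
  rewrite cabs_cexp mulr1 /reC /= expR_le1 (le_trans hs)//.
  by rewrite ge_max u0 x0.
have k1 : cabs (k t - k y) <= r * (2 * `|t - y|).
  have -> : k t - k y = (r%:C)%C * (cis t - cis y) by rewrite /k; ring.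
  rewrite cabsM cabs_real gtr0_norm// ler_pM2l//; exact: cis_lip.
have e2 : cabs (e u) <= 1 by rewrite eE cabs_real ger0_norm ?expR_ge0// expR_le1.
apply: le_trans (cabsD _ _) _; rewrite !cabsM.
have h1 : cabs (e u) * cabs (k t - k y) <= r * (2 * `|t - y|).
  apply: le_trans k1; rewrite ler_piMl ?cabs_ge0//.
have h2 : cabs (e u - e x) * cabs (k y) <= 2 * `|u - x| * (2 * r).
  by apply: ler_pM; rewrite ?cabs_ge0.
have h3 : 0 <= r * `|t - y| by rewrite mulr_ge0// ltW.
by lra.
Qed.

(** Both integrals are explicit, because [e] is its own derivative and [B * k = k']. This removes
    the first-order part of [f] in [J_local]. *)
Let J_affine (al be : C) x1 x2 y1 y2 : J (fun z => al + be * (z - a)) x1 x2 y1 y2 = 0.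
Proof.
rewrite /J.
have -> : (fun u => al + be * (p u y1 - a) - (al + be * (p u y2 - a))) =
    (fun u => be * (k y1 - k y2) * e u).
  by apply/funext => u; rewrite /p; ring.
have -> : (fun t => (al + be * (p x2 t - a) - (al + be * (p x1 t - a))) * B t) =
    (fun t => be * (e x2 - e x1) * k' t).
  by apply/funext => t; rewrite /p /B; field.
rewrite (cintZ (be * (k y1 - k y2)) x1 x2 e_cont) (cintZ (be * (e x2 - e x1)) y1 y2 k'_cont).
by rewrite (cintE _ _ e_prim) (cintE _ _ k_prim); ring.
Qed.

Let J_contu (g : C -> C) y1 y2 : (forall z, ccontinuous_at g z) ->
  ccont (fun u => g (p u y1) - g (p u y2)).
Proof. by move=> cg; apply: ccontB; apply: ccont_comp. Qed.

Let J_contt (g : C -> C) x1 x2 : (forall z, ccontinuous_at g z) ->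
  ccont (fun t => (g (p x2 t) - g (p x1 t)) * B t).
Proof. by move=> cg; apply: ccontM => //; apply: ccontB; apply: ccont_comp. Qed.

Let affine_cont (al be : C) z : ccontinuous_at (fun z => al + be * (z - a)) z.
Proof.
apply: (@cdiff_continuous _ _ be) => ep ep0; exists 1; split=> // h _.
have -> : al + be * (z + h - a) - (al + be * (z - a)) - be * h = 0 by ring.
by rewrite cabs0 mulr_ge0 ?cabs_ge0// ltW.
Qed.

Let contB (g1 g2 : C -> C) z : ccontinuous_at g1 z -> ccontinuous_at g2 z ->
  ccontinuous_at (fun z => g1 z - g2 z) z.
Proof.
move=> c1 c2 ep ep0; have ep2 : 0 < ep / 2 by rewrite divr_gt0.
have [d1 [d10 H1]] := c1 _ ep2; have [d2 [d20 H2]] := c2 _ ep2.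
exists (Num.min d1 d2); split; first by rewrite lt_min d10.
move=> w; rewrite lt_min => /andP[/H1 h1 /H2 h2].
have -> : g1 w - g2 w - (g1 z - g2 z) = (g1 w - g1 z) - (g2 w - g2 z) by ring.
by apply: le_lt_trans (cabsB _ _) _; rewrite [ep]splitr ltrD.
Qed.

Let JB (g1 g2 : C -> C) x1 x2 y1 y2 : (forall z, ccontinuous_at g1 z) ->
  (forall z, ccontinuous_at g2 z) ->
  J (fun z => g1 z - g2 z) x1 x2 y1 y2 = J g1 x1 x2 y1 y2 - J g2 x1 x2 y1 y2.
Proof.
move=> c1 c2; rewrite /J.
have -> : (fun u => g1 (p u y1) - g2 (p u y1) - (g1 (p u y2) - g2 (p u y2))) =
    (fun u => (g1 (p u y1) - g1 (p u y2)) - (g2 (p u y1) - g2 (p u y2))).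
  by apply/funext => u; ring.
have -> : (fun t => (g1 (p x2 t) - g2 (p x2 t) - (g1 (p x1 t) - g2 (p x1 t))) * B t) =
    (fun t => (g1 (p x2 t) - g1 (p x1 t)) * B t - (g2 (p x2 t) - g2 (p x1 t)) * B t).
  by apply/funext => u; ring.
rewrite (cintB _ _ (J_contu y1 y2 c1) (J_contu y1 y2 c2)).
by rewrite (cintB _ _ (J_contt x1 x2 c1) (J_contt x1 x2 c2)); ring.
Qed.

(** After subtraction of the affine approximation at [p x y], the integrand is a small multiple of
    the size of the rectangle, and the lengths of the sides supply the second factor. *)
Let J_local (U : R) x y : - U <= x <= 0 -> 0 <= y <= 2 * pi ->
  forall ep : R, 0 < ep -> exists del : R, 0 < del /\ forall x1 x2 y1 y2,
    - U <= x1 <= x -> x <= x2 <= 0 -> 0 <= y1 <= y -> y <= y2 <= 2 * pi ->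
    x2 - x1 < del -> y2 - y1 < del ->
    cabs (J f x1 x2 y1 y2) <= ep * (x2 - x1 + (y2 - y1)) ^+ 2.
Proof.
move=> /andP[_ x0] _ ep ep0.
have [b Db] := f_diff (p_le y x0).
(* The integrand is at most [ep / K * (4 * r * s)]; two values per integral and the factor 2 of
   [cint_bound] give another 4, and the two kinds of sides weigh 1 and [KB]. *)
pose K := 16 * r * (1 + KB).
have K0 : 0 < K by rewrite !mulr_gt0// ltr_pwDl.
have [d [d0 Hd]] := Db _ (divr_gt0 ep0 K0).
(* [p] is Lipschitz with constant [4 * r] for the sum of two side lengths, hence the 8. *)
exists (d / (8 * r)); split; first by rewrite divr_gt0// mulr_gt0.
move=> x1 x2 y1 y2 /andP[_ x1x] /andP[xx2 x20] /andP[_ y1y] /andP[yy2 _] dx dy.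
pose z0 := p x y.
pose g z := f z - (f z0 - b * (z0 - a) + b * (z - a)).
have -> : J f x1 x2 y1 y2 = J g x1 x2 y1 y2.
  rewrite JB// ?J_affine ?subr0// => z; exact: affine_cont.
have cg z : ccontinuous_at g z by apply: contB => //; exact: affine_cont.
set s := x2 - x1 + (y2 - y1).
have s0 : 0 <= s by rewrite /s; lra.
have gE u t : x1 <= u <= x2 -> y1 <= t <= y2 ->
    cabs (g (p u t)) <= ep / K * (4 * r * s).
  move=> /andP[u1 u2] /andP[t1 t2].
  have pl : cabs (p u t - z0) <= 4 * r * s.
    apply: le_trans (p_lip t y _ x0) _; first by rewrite (le_trans u2).
    rewrite ler_pM2l ?mulr_gt0// /s lerD//.
      by rewrite ler_norml; lra.
    by rewrite ler_norml; lra.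
  have pd : cabs (p u t - z0) < d.
    apply: le_lt_trans pl _; rewrite /s.
    move: dx dy; rewrite !ltr_pdivlMr ?mulr_gt0// => dx dy.
    by rewrite -(ltr_pM2l (ltr0n _ 2)); lra.
  have h := Hd _ (p_le t (le_trans u2 x20)) pd; rewrite -/z0 in h.
  have -> : g (p u t) = f (p u t) - f z0 - b * (p u t - z0) by rewrite /g; ring.
  by apply: le_trans h _; rewrite ler_wpM2l// divr_ge0 ?ltW.
have x12 : x1 <= x2 by rewrite (le_trans x1x).
have y12 : y1 <= y2 by rewrite (le_trans y1y).
set M := ep / K * (4 * r * s) in gE.
have ME : M = ep / K * (4 * r * s) by [].
have M0 : 0 <= M by rewrite !mulr_ge0 ?invr_ge0 ?(ltW K0) ?(ltW ep0) ?(ltW r_gt0).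
clearbody M; rewrite /J; apply: le_trans (cabsD _ _) _.
have b1 : cabs (cint (fun u => g (p u y1) - g (p u y2)) x1 x2) <= 2 * (2 * M) * (x2 - x1).
  apply: cint_bound => //; first exact: J_contu.
  move=> u ux; apply: le_trans (cabsB _ _) _; rewrite twice_add lerD// gE//.
    by rewrite lexx y12.
  by rewrite lexx y12.
have b2 : cabs (cint (fun t => (g (p x2 t) - g (p x1 t)) * B t) y1 y2) <=
    2 * (2 * M * KB) * (y2 - y1).
  apply: cint_bound => //; first exact: J_contt.
  move=> t ty; rewrite cabsM; apply: ler_pM; rewrite ?cabs_ge0//.
  by apply: le_trans (cabsB _ _) _; rewrite twice_add lerD// gE// lexx x12.
apply: le_trans (lerD b1 b2) _.
have sx : x2 - x1 <= s by rewrite /s; lra.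
have sy : y2 - y1 <= s by rewrite /s; lra.
have h1 : 2 * (2 * M) * (x2 - x1) <= 2 * (2 * M) * s.
  by apply: ler_wpM2l; rewrite // !mulr_ge0.
have h2 : 2 * (2 * M * KB) * (y2 - y1) <= 2 * (2 * M * KB) * s.
  by apply: ler_wpM2l => //; rewrite mulr_ge0// mulr_ge0 ?KB_ge0// mulr_ge0.
apply: le_trans (lerD h1 h2) _.
have -> : ep * s ^+ 2 = 2 * (2 * M) * s + 2 * (2 * M * KB) * s.
  by rewrite ME /K; field; rewrite !gt_eqF// ltr_pwDl.
exact: lexx.
Qed.

(** The two radial sides of the rectangle cancel since [cis 0 = cis (2 * pi)], leaving the two
    circles. *)
Lemma circle_homotopy (U : R) : 0 <= U ->
  cint (fun t => f (p 0 t) * B t) 0 (2 * pi) =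
  cint (fun t => f (p (- U) t) * B t) 0 (2 * pi).
Proof.
move=> U0.
have pi0 : 0 <= 2 * (pi : R) by rewrite mulr_ge0// pi_ge0.
have := @goursat_bisection R (J f) (- U) 0 0 (2 * pi).
rewrite oppr_le0 => /(_ U0 pi0 _ _ (@J_local U)) H.
have {H} : J f (- U) 0 0 (2 * pi) = 0.
  apply: H => [x1 x2 x3 y1 y2|x1 x2 y1 y2 y3].
    rewrite /J -(@cint_cat _ _ x1 x2 x3); last exact: J_contu.
    have -> : (fun t => (f (p x3 t) - f (p x1 t)) * B t) =
      (fun t => (f (p x2 t) - f (p x1 t)) * B t + (f (p x3 t) - f (p x2 t)) * B t).
      by apply/funext => t; ring.
    by rewrite (cintD _ _ (J_contt x1 x2 f_cont) (J_contt x2 x3 f_cont)); ring.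
  rewrite /J -(@cint_cat _ _ y1 y2 y3); last exact: J_contt.
  have -> : (fun u => f (p u y1) - f (p u y3)) =
      (fun u => (f (p u y1) - f (p u y2)) + (f (p u y2) - f (p u y3))).
    by apply/funext => t; ring.
  by rewrite (cintD _ _ (J_contu y1 y2 f_cont) (J_contu y2 y3 f_cont)); ring.
rewrite /J.
have -> : (fun u => f (p u 0) - f (p u (2 * pi))) = (fun=> 0 * 0).
  by apply/funext => u; rewrite /p /k cis0 cis2pi subrr mul0r.
rewrite (cintZ 0 _ _ (ccont_cst _)) mul0r add0r.
have -> : (fun t => (f (p 0 t) - f (p (- U) t)) * B t) =
   (fun t => f (p 0 t) * B t - f (p (- U) t) * B t).
  by apply/funext => t; ring.
have fpB u : ccont (fun t => f (p u t) * B t).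
  by apply: ccontM => //; apply: ccont_comp.
by rewrite cintB// => /eqP; rewrite subr_eq0 => /eqP.
Qed.

(** The inner circle shrinks to [a], where [f] is nearly constant. The winding integral of [B] is
    left unevaluated here; the kernel series of the constant 1 gives it later. *)
Lemma cauchy_formula :
  cint (fun t => f ((r%:C)%C * cis t) * B t) 0 (2 * pi) = f a * cint B 0 (2 * pi).
Proof.
have pi0 : 0 < 2 * (pi : R) by rewrite mulr_gt0// pi_gt0.
have -> : (fun t => f ((r%:C)%C * cis t) * B t) = (fun t => f (p 0 t) * B t).
  by apply/funext => t; rewrite /p eE expR0 rmorph1 mul1r /k addrC subrK.
have fpB u : ccont (fun t => f (p u t) * B t).
  by apply: ccontM => //; apply: ccont_comp.
apply/eqP; rewrite -subr_eq0; apply/eqP.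
apply: (@cabs_small_eq0 _ _ (2 * KB * (2 * pi))) => ep ep0.
have [d [d0 Hd]] := f_cont a ep0.
(* Since [1 + U <= expR U], the contracted circle lies within [2 * r / (1 + U) < d] of [a]. *)
pose U := 2 * r / d.
have U0 : 0 <= U by rewrite divr_ge0 ?mulr_ge0 ?(ltW r_gt0) ?(ltW d0).
rewrite (circle_homotopy U0) -cintZ// -cintB//; last first.
  by apply: ccontM => //; exact: ccont_cst.
have -> : 2 * KB * (2 * pi) * ep = 2 * (ep * KB) * (2 * pi - 0) by ring.
apply: cint_bound; [|exact: ltW|].
  by apply: ccontB => //; apply: ccontM => //; exact: ccont_cst.
move=> t _; rewrite -mulrBl cabsM ler_pM ?cabs_ge0//.
apply/ltW/Hd; rewrite /p addrAC subrr add0r cabsM eE cabs_real ger0_norm ?expR_ge0//.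
rewrite expRN.
have eU : 1 + U <= expR U by exact: expR_ge1Dx.
have U1 : 0 < 1 + U by rewrite ltr_pwDl.
apply: (@le_lt_trans _ _ ((1 + U)^-1 * (2 * r))).
  by rewrite ler_pM ?invr_ge0 ?expR_ge0 ?cabs_ge0// lef_pV2 ?posrE// (lt_le_trans U1).
rewrite mulrC ltr_pdivrMr// mulrDr mulr1 /U.
have -> : d * (2 * r / d) = 2 * r by field; rewrite gt_eqF.
by rewrite ltrDr.
Qed.

End Homotopy.
End CauchyFormula.

(** * Taylor expansions *)

Section Taylor.
Variable R : realType.
Local Notation C := R[i].
Implicit Types (phi : C -> C) (z w a : C).

Lemma cabs_lip z w : `|cabs z - cabs w| <= cabs (z - w).
Proof.
rewrite ler_norml cabs_subl andbT lerNl opprB cabsBC; exact: cabs_subl.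
Qed.

Lemma ccont_bounded (h : R -> C) (a b : R) : a <= b -> ccont h ->
  exists M : R, 0 <= M /\ forall t, a <= t <= b -> cabs (h t) <= M.
Proof.
move=> ab ch.
have [|c cab H] := @EVT_max R (fun t => cabs (h t)) a b ab.
  apply: continuous_subspaceT => t; apply/cvgrPdist_lt => e /(ch t)[d [d0 hd]].
  exists d => //= t'; rewrite /= distrC => /hd; apply: le_lt_trans.
  by rewrite distrC cabs_lip.
exists (cabs (h c)); split=> [|t tab]; first exact: cabs_ge0.
by apply: H; rewrite in_itv.
Qed.

Lemma geometric_remainder (x : C) N : x != 1 ->
  (1 - x)^-1 = \sum_(n < N) x ^+ n + x ^+ N / (1 - x).
Proof.
move=> x1; have x0 : 1 - x != 0 by rewrite subr_eq0 eq_sym.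
elim: N => [|N IH]; first by rewrite big_ord0 add0r expr0 mul1r.
by rewrite big_ord_recr /= [LHS]IH exprS; field.
Qed.

Let q (a : C) (r t : R) : C := a / (r%:C)%C * cis (- t).

Lemma cisN t : cis (- t) = (cis t)^-1 :> C.
Proof.
apply: (mulfI (cis_neq0 t)); rewrite divff ?cis_neq0// -cexpD -mulrDl -rmorphD.
by rewrite subrr mul0r cexp0.
Qed.

(** The kernel is [i / (1 - q)] with [q] of constant modulus [cabs a / r < 1]. A finite geometric
    sum with explicit remainder avoids any exchange of limit and integral. *)
Lemma cauchy_kernel_series (h : R -> C) (r : R) (a : C) : 0 < r -> cabs a < r -> ccont h ->
  cconv (fun N => \sum_(n < N)
      (Complex 0 1 * cint (fun t => h t * cis (- t) ^+ n) 0 (2 * pi) / (r%:C)%C ^+ n) * a ^+ n)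
    (cint (fun t => h t * ((r%:C)%C * (Complex 0 1 * cis t) / ((r%:C)%C * cis t - a))) 0 (2 * pi)).
Proof.
move=> r0 ar ch.
have pi0 : 0 <= 2 * (pi : R) by rewrite mulr_ge0// pi_ge0.
have [M [M0 hM]] := ccont_bounded pi0 ch.
have rC0 : (r%:C)%C != 0 :> C by rewrite -cabs_gt0 cabs_real gtr0_norm.
have cisNc : ccont (fun t => cis (- t) : C).
  have -> : (fun t => cis (- t) : C) = (fun t => cexp ((t%:C)%C * - Complex 0 1)).
    by apply/funext => t; rewrite /cis rmorphN mulNr mulrN.
  exact: cexp_line_ccont.
have cisX n : ccont (fun t => cis (- t) ^+ n : C).
  elim: n => [|n IH].
    have -> : (fun t => cis (- t) ^+ 0 : C) = (fun=> 1) by apply/funext.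
    exact: ccont_cst.
  have -> : (fun t => cis (- t) ^+ n.+1 : C) = (fun t => cis (- t) * cis (- t) ^+ n).
    by apply/funext => t; rewrite exprS.
  exact: ccontM.
have xq t : cabs (q a r t) = cabs a / r.
  by rewrite /q cabsM cabs_cis mulr1 cabs_div cabs_real gtr0_norm.
have ar1 : cabs a / r < 1 by rewrite ltr_pdivrMr ?mul1r.
have q1 t : 1 - cabs a / r <= cabs (1 - q a r t).
  by have := cabs_subl 1 (q a r t); rewrite cabs1 xq.
have q10 t : 1 - q a r t != 0.
  by rewrite -cabs_gt0 (lt_le_trans _ (q1 t))// subr_gt0.
have qc : ccont (q a r) by apply: ccontM => //; exact: ccont_cst.
have BE N t : (r%:C)%C * (Complex 0 1 * cis t) / ((r%:C)%C * cis t - a) =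
    \sum_(n < N) (Complex 0 1 * (a / (r%:C)%C) ^+ n) * cis (- t) ^+ n +
    Complex 0 1 * (a / (r%:C)%C) ^+ N * (cis (- t) ^+ N / (1 - q a r t)).
  have -> : (r%:C)%C * (Complex 0 1 * cis t) / ((r%:C)%C * cis t - a) =
      Complex 0 1 * (1 - q a r t)^-1.
    have := q10 t; rewrite /q cisN => h0.
    have k0 : (r%:C)%C * cis t - a != 0.
      rewrite -cabs_gt0; have := cabs_subl ((r%:C)%C * cis t) a.
      by rewrite cabsM cabs_real cabs_cis mulr1 gtr0_norm//; apply: lt_le_trans; rewrite subr_gt0.
    by field; rewrite k0 rC0 cis_neq0.
  rewrite [X in Complex 0 1 * X = _](@geometric_remainder _ N); last first.
    by rewrite -subr_eq0 -opprB oppr_eq0.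
  rewrite mulrDr mulr_sumr /q; congr (_ + _).
    by apply: eq_bigr => n _; rewrite exprMn mulrA.
  by rewrite exprMn; ring.
pose K := 2 * (M * (1 - cabs a / r)^-1) * (2 * pi).
have K0 : 0 <= K.
  by rewrite !mulr_ge0// ?invr_ge0 ?subr_ge0 ?(ltW ar1)// pi_ge0.
have rem (N : nat) : cabs (\sum_(n < N)
      (Complex 0 1 * cint (fun t => h t * cis (- t) ^+ n) 0 (2 * pi) / (r%:C)%C ^+ n) * a ^+ n
    - cint (fun t => h t * ((r%:C)%C * (Complex 0 1 * cis t) / ((r%:C)%C * cis t - a))) 0 (2 * pi))
    <= (cabs a / r) ^+ N * K.
  have -> : (fun t => h t * ((r%:C)%C * (Complex 0 1 * cis t) / ((r%:C)%C * cis t - a))) =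
     (fun t => \sum_(n < N) (Complex 0 1 * (a / (r%:C)%C) ^+ n) * (h t * cis (- t) ^+ n) +
      Complex 0 1 * (a / (r%:C)%C) ^+ N * (h t * (cis (- t) ^+ N / (1 - q a r t)))).
    apply/funext => t; rewrite (BE N) mulrDr mulr_sumr; congr (_ + _); last exact: mulrCA.
    by apply: eq_bigr => n _; exact: mulrCA.
  have c1 n : ccont (fun t => h t * cis (- t) ^+ n) by exact: ccontM.
  have c2 : ccont (fun t => h t * (cis (- t) ^+ N / (1 - q a r t))).
    apply: ccontM => //; apply: ccontM => //; apply: ccontV => //.
    by apply: ccontB => //; exact: ccont_cst.
  have c3 n : ccont (fun t => Complex 0 1 * (a / (r%:C)%C) ^+ n * (h t * cis (- t) ^+ n)).
    by apply: ccontM => //; exact: ccont_cst.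
  rewrite cintD; last 2 first.
  - exact: (@ccont_sum _ (fun n t => Complex 0 1 * (a / (r%:C)%C) ^+ n * (h t * cis (- t) ^+ n))).
  - by apply: ccontM => //; exact: ccont_cst.
  rewrite (@cint_sum _ (fun n t => Complex 0 1 * (a / (r%:C)%C) ^+ n * (h t * cis (- t) ^+ n)))//.
  rewrite (cintZ _ _ _ c2) opprD addrA -sumrB big1; last first.
    move=> n _; rewrite (cintZ _ _ _ (c1 n)) expr_div_n; field.
    by rewrite expf_neq0.
  rewrite add0r cabsN !cabsM cabs_imag normr1 mul1r cabsX cabs_div cabs_real gtr0_norm//.
  rewrite ler_wpM2l ?exprn_ge0 ?divr_ge0 ?cabs_ge0 ?(ltW r0)//.
  have -> : K = 2 * (M * (1 - cabs a / r)^-1) * (2 * pi - 0) by rewrite subr0.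
  apply: cint_bound => // t tt.
  rewrite cabsM ler_pM ?cabs_ge0 ?hM// cabs_div cabsX cabs_cis expr1n mul1r.
  rewrite lef_pV2 ?posrE ?q1// ?cabs_gt0 ?q10// subr_gt0//.
move=> e e0.
have K1 : 0 < K + 1 by rewrite ltr_wpDl.
have [|N HN] := @geo_small R (cabs a / r) _ _ (divr_gt0 e0 K1).
  by rewrite divr_ge0 ?cabs_ge0 ?(ltW r0).
exists N => n /HN; rewrite ltr_pdivlMr// => hn.
apply: le_lt_trans (rem n) _; apply: le_lt_trans hn.
by rewrite ler_wpM2l ?lerDl// exprn_ge0// divr_ge0 ?cabs_ge0 ?(ltW r0).
Qed.

(** The factor [1 *] matches the coefficients of [cauchy_kernel_series] for the constant function
    1. *)
Lemma cint_cis_pow n : cint (fun t => 1 * cis (- t) ^+ n) 0 (2 * pi) =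
  if n == 0%N then ((2 * pi)%:C)%C else 0 :> C.
Proof.
case: eqP => [->|/eqP n0].
  have P : cprimitive (fun t => (t%:C)%C) (fun t => 1 * cis (- t) ^+ 0 : C).
    split=> t; rewrite expr0 mulr1 /reC /imC /=; first exact: is_derive_id.
    exact: is_derive_cst.
  by rewrite (cintE _ _ P) rmorph0 subr0.
have nC : n%:R != 0 :> C by rewrite pnatr_eq0.
pose w : C := - (n%:R * Complex 0 1).
have w0 : w != 0.
  by rewrite oppr_eq0 mulf_neq0// -cabs_gt0 cabs_imag normr1.
have P : cprimitive (fun t => w^-1 * cexp ((t%:C)%C * w)) (fun t => 1 * cis (- t) ^+ n : C).
  have := cprimitiveZ w^-1 (cexp_line w); congr cprimitive; apply/funext => t.
  rewrite mulrA mulVf// !mul1r /cis cexpX; congr cexp.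
  by rewrite /w rmorphN; ring.
rewrite (cintE _ _ P) mul0r cexp0 -mulrBr.
have -> : ((2 * pi)%:C)%C * w = n%:R * (((- (2 * pi))%:C)%C * Complex 0 1).
  by rewrite /w rmorphN; ring.
by rewrite -cexpX -/(cis _) cisN cis2pi invr1 expr1n subrr mulr0.
Qed.

Lemma taylor_expansion phi (r : R) : 0 < r ->
  (forall z, cabs z <= r -> exists b, cdiff phi z b) ->
  exists A : nat -> C,
    (forall z, cabs z < r -> cconv (fun N => \sum_(n < N) A n * z ^+ n) (phi z)) /\
    (forall M : R, (forall z, cabs z = r -> cabs (phi z) <= M) ->
       forall n, cabs (A n) * r ^+ n <= 2 * M).
Proof.
move=> r0 phid.
pose f z := phi (disc_retract r z).
have fE z : cabs z <= r -> f z = phi z by move=> zr; rewrite /f disc_retract_id.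
have fc z : ccontinuous_at f z.
  move=> e e0; have [b Db] := phid _ (disc_retract_le z r0).
  have [d [d0 H]] := cdiff_continuous Db e0.
  exists (d / 2); split; first by rewrite divr_gt0.
  move=> w wd; apply: H; apply: le_lt_trans (disc_retract_lip _ _ r0) _.
  by rewrite mulrC -ltr_pdivlMr.
have fd z : cabs z <= r -> exists b, forall eps : R, 0 < eps ->
  exists del : R, 0 < del /\ forall w, cabs w <= r -> cabs (w - z) < del ->
    cabs (f w - f z - b * (w - z)) <= eps * cabs (w - z).
  move=> zr; have [b Db] := phid z zr; exists b => e e0.
  have [d [d0 H]] := Db e e0; exists d; split=> // w wr wz.
  by rewrite !fE//; have := H _ wz; rewrite [z + _]addrC subrK.
have rC0 : (r%:C)%C != 0 :> C by rewrite -cabs_gt0 cabs_real gtr0_norm.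
have pi0 : 0 < 2 * (pi : R) by rewrite mulr_gt0// pi_gt0.
have piC : ((2 * pi)%:C)%C != 0 :> C by rewrite -cabs_gt0 cabs_real gtr0_norm.
have i0 : Complex 0 1 != 0 :> C by rewrite -cabs_gt0 cabs_imag normr1.
pose h t := f ((r%:C)%C * cis t).
have ch : ccont h.
  by apply: ccont_comp => //; apply: ccontM; [exact: ccont_cst|exact: cis_ccont].
have cis_r t : cabs ((r%:C)%C * cis t) = r.
  by rewrite cabsM cabs_real cabs_cis mulr1 gtr0_norm.
pose A0 n := cint (fun t => h t * cis (- t) ^+ n) 0 (2 * pi).
exists (fun n => A0 n / (((2 * pi)%:C)%C * (r%:C)%C ^+ n)); split.
  move=> z zr; have := cauchy_kernel_series r0 zr ch.
  rewrite (cauchy_formula r0 zr fc fd) fE ?ltW//.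
  set I1 := cint _ _ _.
  (* Only the zeroth term of the kernel series of the constant 1 survives, which evaluates the
     winding integral. *)
  have -> : I1 = Complex 0 1 * ((2 * pi)%:C)%C.
    have H1 := cauchy_kernel_series r0 zr (@ccont_cst R 1).
    have -> : I1 = cint (fun t => 1 * ((r%:C)%C * (Complex 0 1 * cis t) /
        ((r%:C)%C * cis t - z))) 0 (2 * pi).
      by rewrite /I1; congr cint; apply/funext => t; rewrite mul1r.
    apply: cconv_unique H1 _ => e e0; exists 1%N => -[//|n] _.
    rewrite big_ord_recl big1 => [|i _]; last first.
      by rewrite cint_cis_pow /= mulr0 mul0r mul0r.
    by rewrite cint_cis_pow /= !expr0 divr1 mulr1 addr0 subrr cabs0.
  move=> /(cconvZ (Complex 0 1 * ((2 * pi)%:C)%C)^-1).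
  have -> : (Complex 0 1 * ((2 * pi)%:C)%C)^-1 * (phi z * (Complex 0 1 * ((2 * pi)%:C)%C)) = phi z.
    by rewrite mulrC mulfK// mulf_neq0.
  apply: cconv_ext => N; rewrite mulr_sumr; apply: eq_bigr => n _.
  rewrite -/(A0 n); move: piC; set P := ((2 * pi)%:C)%C; clearbody P => P0.
  by field; rewrite P0 i0 expf_neq0.
move=> M hM n.
have : cabs (A0 n) <= 2 * M * (2 * pi - 0).
  apply: cint_bound => //; last 2 first.
  - exact: ltW.
  - move=> t _; rewrite cabsM cabsX cabs_cis expr1n mulr1 /h fE ?cis_r//.
    exact/hM/cis_r.
  apply: ccontM => //.
  have -> : (fun t => cis (- t) ^+ n : C) = (fun t => cexp ((t%:C)%C * (- (n%:R * Complex 0 1)))).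
    by apply/funext => t; rewrite /cis cexpX; congr cexp; rewrite rmorphN; ring.
  exact: cexp_line_ccont.
rewrite subr0 cabs_div cabsM !cabsX !cabs_real (gtr0_norm pi0) (gtr0_norm r0) => H.
rewrite invfM mulrA divfK ?expf_neq0 ?gt_eqF//.
by rewrite ler_pdivrMr.
Qed.

End Taylor.

(** * Power series under Cauchy bounds *)

Section PowerSeries.
Variable R : realType.
Local Notation C := R[i].
Implicit Types (A B : nat -> C) (phi : C -> C) (z w a : C).

Definition psum A z N : C := \sum_(n < N) A n * z ^+ n.

Lemma psumS A z N : psum A z N.+1 = psum A z N + A N * z ^+ N.
Proof. by rewrite /psum big_ord_recr. Qed.

(** On the half disc the terms decay with ratio at most [1/2], so a tail is at most twice the bound
    of its first term. This is why later radii are halved. *)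
Lemma psum_tail A z (r K : R) N k : 0 < r -> 0 <= K ->
  (forall n, cabs (A n) * r ^+ n <= K) -> cabs z <= r / 2 ->
  cabs (psum A z (N + k) - psum A z N) <= 2 * K * (cabs z / r) ^+ N.
Proof.
move=> r0 K0 hA zr; set q := cabs z / r.
have q0 : 0 <= q by rewrite divr_ge0 ?cabs_ge0// ltW.
have q1 : q <= 2^-1 by rewrite /q ler_pdivrMr// mulrC.
have hn n : cabs (A n * z ^+ n) <= K * q ^+ n.
  rewrite cabsM cabsX /q expr_div_n mulrCA.
  have rn : 0 < r ^+ n by rewrite exprn_gt0.
  apply: (@le_trans _ _ (cabs (A n) * r ^+ n * (cabs z ^+ n / r ^+ n))).
    by rewrite mulrA mulrAC mulrK ?unitfE ?gt_eqF.
  by rewrite [X in _ <= X]mulrCA ler_wpM2r// divr_ge0 ?exprn_ge0 ?cabs_ge0// ltW.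
(* [2 * (1 - 2^-1 ^+ k)] is the sum of the first [k] powers of [1/2], the form that passes through
   the induction. *)
suff : cabs (psum A z (N + k) - psum A z N) <= K * q ^+ N * (2 * (1 - 2^-1 ^+ k)).
  move=> H; apply: le_trans H _.
  have -> : 2 * K * q ^+ N = K * q ^+ N * 2 by ring.
  rewrite ler_wpM2l ?mulr_ge0 ?exprn_ge0// ler_piMr// gerBl exprn_ge0//.
elim: k => [|k IH]; first by rewrite addn0 subrr cabs0 expr0 subrr !mulr0.
rewrite addnS psumS addrAC; apply: le_trans (cabsD _ _) _.
apply: le_trans (lerD IH (hn _)) _.
rewrite exprD mulrA exprS.
have h : K * q ^+ N * q ^+ k <= K * q ^+ N * 2^-1 ^+ k.
  apply: ler_wpM2l; first by rewrite mulr_ge0 ?exprn_ge0.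
  by apply: lerXn2r; rewrite ?nnegrE ?invr_ge0.
apply: le_trans (lerD (lexx _) h) _.
by rewrite le_eqVlt; apply/orP; left; apply/eqP; field.
Qed.

Lemma psum_lim_tail A z (r K : R) N S : 0 < r -> 0 <= K ->
  (forall n, cabs (A n) * r ^+ n <= K) -> cabs z <= r / 2 ->
  cconv (psum A z) S -> cabs (S - psum A z N) <= 2 * K * (cabs z / r) ^+ N.
Proof.
move=> r0 K0 hA zr cS.
have c0 : cconv (fun=> psum A z N) (psum A z N).
  by move=> e e0; exists 0%N => n _; rewrite subrr cabs0.
apply: (@cconv_le _ _ _ _ N (cconvB cS c0)) => n /subnKC <-.
exact: psum_tail.
Qed.

Lemma psum_converges A z (r K : R) : 0 < r -> 0 <= K ->
  (forall n, cabs (A n) * r ^+ n <= K) -> cabs z <= r / 2 ->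
  exists S, cconv (psum A z) S.
Proof.
move=> r0 K0 hA zr; apply: cconv_cauchy => e e0.
have q0 : 0 <= cabs z / r by rewrite divr_ge0 ?cabs_ge0// ltW.
have q1 : cabs z / r < 1.
  by rewrite ltr_pdivrMr// mul1r (le_lt_trans zr)//; lra.
have K1 : 0 < 4 * K + 1 by rewrite ltr_wpDl// mulr_ge0.
have [|N HN] := @geo_small R (cabs z / r) _ _ (divr_gt0 e0 K1); first by rewrite q0.
have h n : (N <= n)%N -> cabs (psum A z n - psum A z N) <= 2 * K * (cabs z / r) ^+ N.
  by move=> /subnKC <-; exact: psum_tail.
exists N => n k /h hn /h hk.
apply: le_lt_trans (cabs_dist _ (psum A z N) _) _.
rewrite [cabs (psum A z N - _)]cabsBC; apply: le_lt_trans (lerD hn hk) _.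
have := HN N (leqnn N); rewrite ltr_pdivlMr//; apply: le_lt_trans.
have := exprn_ge0 N q0; set t := _ ^+ N => t0; nra.
Qed.

(** Once the earlier coefficients vanish, dividing by [t ^+ n] leaves [A n] up to an error of order
    [t]. *)
Lemma psum_eq0 A (r K d : R) : 0 < r -> 0 <= K -> 0 < d ->
  (forall n, cabs (A n) * r ^+ n <= K) ->
  (forall z, cabs z < d -> cconv (psum A z) 0) -> forall n, A n = 0.
Proof.
move=> r0 K0 d0 hA h0; elim/ltn_ind => n IH.
apply: (@cabs_small_eq0 _ _ (2 * K / r ^+ n.+1)) => e e0.
pose t := Num.min e (Num.min (d / 2) (r / 2)).
have t0 : 0 < t by rewrite !lt_min e0 !divr_gt0.
have td : t < d.
  by apply: (@le_lt_trans _ _ (d / 2)); [rewrite !ge_min lexx orbT|lra].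
have tr : t <= r / 2 by rewrite !ge_min lexx !orbT.
have te : t <= e by rewrite !ge_min lexx.
have cz : cabs ((t%:C)%C : C) = t by rewrite cabs_real gtr0_norm.
have := @psum_lim_tail A (t%:C)%C r K n.+1 0 r0 K0 hA.
rewrite cz => /(_ tr (h0 _ _)); rewrite cz => /(_ td).
have -> : psum A (t%:C)%C n.+1 = A n * (t%:C)%C ^+ n.
  rewrite psumS /psum big1 ?add0r// => i _.
  by rewrite IH ?mul0r.
rewrite sub0r cabsN cabsM cabsX cz expr_div_n [t ^+ n.+1]exprSr => h.
have tn : 0 < t ^+ n by rewrite exprn_gt0.
rewrite -(ler_pM2r tn); apply: le_trans h _.
have rn : 0 < r ^+ n.+1 by rewrite exprn_gt0.
have -> : 2 * K * (t ^+ n * t / r ^+ n.+1) = 2 * K / r ^+ n.+1 * t * t ^+ n by ring.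
by rewrite ler_pM2r// ler_wpM2l// divr_ge0 ?mulr_ge0// ltW.
Qed.

(** Different radii are allowed so that the bounds of two expansions, obtained on different discs,
    can be transferred to the same coefficients. *)
Lemma psum_unique A B (S : C -> C) (r1 r2 K1 K2 d : R) : 0 < r1 -> 0 < r2 -> 0 < d ->
  (forall n, cabs (A n) * r1 ^+ n <= K1) -> (forall n, cabs (B n) * r2 ^+ n <= K2) ->
  (forall z, cabs z < d -> cconv (psum A z) (S z)) ->
  (forall z, cabs z < d -> cconv (psum B z) (S z)) -> A =1 B.
Proof.
move=> r10 r20 d0 hA hB cA cB n; apply/eqP; rewrite -subr_eq0; apply/eqP.
have K10 : 0 <= K1 by apply: le_trans (hA 0%N); rewrite expr0 mulr1 cabs_ge0.
have K20 : 0 <= K2 by apply: le_trans (hB 0%N); rewrite expr0 mulr1 cabs_ge0.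
pose r := Num.min r1 r2; have r0 : 0 < r by rewrite lt_min r10.
apply: (@psum_eq0 (fun n => A n - B n) r (K1 + K2) d) => //.
- by rewrite addr_ge0.
- move=> k; apply: le_trans (_ : (cabs (A k) + cabs (B k)) * r ^+ k <= _).
    by rewrite ler_wpM2r ?exprn_ge0 ?cabsB// ltW.
  rewrite mulrDl; apply: lerD.
    apply: le_trans (hA k); rewrite ler_wpM2l ?cabs_ge0//.
    by rewrite lerXn2r ?nnegrE ?(ltW r0) ?(ltW r10)// ge_min lexx.
  apply: le_trans (hB k); rewrite ler_wpM2l ?cabs_ge0//.
  by rewrite lerXn2r ?nnegrE ?(ltW r0) ?(ltW r20)// ge_min lexx orbT.
- move=> z zd; rewrite -(subrr (S z)).
  apply: cconv_ext (cconvB (cA z zd) (cB z zd)) => N.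
  by rewrite /psum -sumrB; apply: eq_bigr => i _; rewrite mulrBl.
Qed.

Lemma cdiff_unique phi z a b : cdiff phi z a -> cdiff phi z b -> a = b.
Proof.
move=> Da Db; apply/eqP; rewrite -subr_eq0; apply/eqP.
apply: (@cabs_small_eq0 _ _ 2) => e e0.
have [d1 [d10 H1]] := Da e e0; have [d2 [d20 H2]] := Db e e0.
pose t := Num.min d1 d2 / 2.
have m0 : 0 < Num.min d1 d2 by rewrite lt_min d10.
have t0 : 0 < t by rewrite divr_gt0.
have tm : t < Num.min d1 d2 by rewrite /t; lra.
have cz : cabs ((t%:C)%C : C) = t by rewrite cabs_real gtr0_norm.
have := H1 (t%:C)%C; have := H2 (t%:C)%C; rewrite cz.
move: tm; rewrite lt_min => /andP[-> ->] /(_ isT) h2 /(_ isT) h1.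
rewrite -(ler_pM2r t0) -[in X in _ * X <= _]cz -cabsM.
have -> : (a - b) * (t%:C)%C = (phi (z + (t%:C)%C) - phi z - b * (t%:C)%C)
  - (phi (z + (t%:C)%C) - phi z - a * (t%:C)%C) by ring.
by apply: le_trans (cabsB _ _) _; lra.
Qed.

(** Taylor expansion at radius [rho / 2], evaluated on its half disc. The constants depend on [M]
    and [rho] only, and this uniformity makes limits of holomorphic functions differentiable. *)
Lemma cdiff_second_order phi (rho M : R) c : 0 < rho -> 0 <= M ->
  (forall z, cabs z < rho -> exists b, cdiff phi z b) ->
  (forall z, cabs z < rho -> cabs (phi z) <= M) -> cdiff phi 0 c ->
  cabs c <= 4 * M / rho /\ forall z, cabs z <= rho / 4 ->
    cabs (phi z - phi 0 - c * z) <= 16 * M * (cabs z / rho) ^+ 2.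
Proof.
move=> rho0 M0 hd hM Dc; pose r := rho / 2.
have r0 : 0 < r by rewrite divr_gt0.
have rr : r < rho by rewrite /r; lra.
have [|A [cA hA]] := @taylor_expansion R phi r r0.
  by move=> z zr; apply: hd; exact: le_lt_trans rr.
have {}hA : forall n, cabs (A n) * r ^+ n <= 2 * M.
  by apply: hA => z zr; apply: hM; rewrite zr.
have M20 : 0 <= 2 * M by rewrite mulr_ge0.
have tl z N : cabs z <= r / 2 -> cabs (phi z - psum A z N) <= 2 * (2 * M) * (cabs z / r) ^+ N.
  move=> zr; apply: psum_lim_tail => //; apply: cA; apply: le_lt_trans zr _; lra.
have A0 : A 0%N = phi 0.
  have := tl 0 1%N; rewrite cabs0 mul0r expr1 mulr0 => /(_ _).
  rewrite psumS /psum big_ord0 add0r expr0 mulr1 => h.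
  have : cabs (phi 0 - A 0%N) <= 0 by apply: h; rewrite divr_ge0// ltW.
  rewrite le_eqVlt ltNge cabs_ge0 orbF cabs_eq0 subr_eq0 => /eqP; by [].
have p2 z : phi z - psum A z 2 = phi z - phi 0 - A 1%N * z.
  by rewrite !psumS /psum big_ord0 A0 expr0 expr1; ring.
have q2 z : cabs z <= rho / 4 -> cabs (phi z - phi 0 - A 1%N * z) <= 16 * M * (cabs z / rho) ^+ 2.
  move=> zr; rewrite -p2; apply: le_trans (tl z 2%N _) _; first by rewrite /r; lra.
  rewrite le_eqVlt; apply/orP; left; apply/eqP; rewrite /r; field.
  by rewrite gt_eqF.
have <- : A 1%N = c.
  apply: (cdiff_unique _ Dc) => e e0.
  have K0 : 0 < 16 * M + 1 by rewrite ltr_wpDl// mulr_ge0.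
  exists (Num.min (rho / 4) (e * rho ^+ 2 / (16 * M + 1))); split.
    by rewrite lt_min !divr_gt0// mulr_gt0// exprn_gt0.
  move=> h; rewrite lt_min => /andP[h1 h2]; rewrite add0r.
  apply: le_trans (q2 _ (ltW h1)) _.
  rewrite ltr_pdivlMr// in h2; rewrite expr_div_n mulrA ler_pdivrMr ?exprn_gt0//.
  have := cabs_ge0 h; move: h2; set t := cabs h; set s := rho ^+ 2 => h2 t0; nra.
split=> //; have := hA 1%N; rewrite expr1 /r mulrA ler_pdivrMr// ler_pdivlMr//; lra.
Qed.

End PowerSeries.

(** * Holomorphic functions of three variables *)

Section ThreeVariables.
Variable R : realType.
Local Notation C := R[i].
Local Notation P := (P3 R).
Implicit Types (f g : P -> C) (x y h v a : P).

Lemma P3_eq x y : ps x = ps y -> pz x = pz y -> pc x = pc y -> x = y.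
Proof. by case: x => [[? ?] ?]; case: y => [[? ?] ?]; rewrite /ps /pz /pc /= => -> -> ->. Qed.

Lemma add3_sub3 x y : add3 x (sub3 y x) = y.
Proof. by apply: P3_eq; rewrite /add3 /sub3 /mk3 /ps /pz /pc /=; ring. Qed.

Lemma sub3_add3 x h : sub3 (add3 x h) x = h.
Proof. by apply: P3_eq; rewrite /add3 /sub3 /mk3 /ps /pz /pc /=; ring. Qed.

Lemma add3_scal0 x v : add3 x (scal3 0 v) = x.
Proof. by apply: P3_eq; rewrite /add3 /scal3 /mk3 /ps /pz /pc /=; ring. Qed.

Lemma add3_scalD x v (l m : C) : add3 x (scal3 (l + m) v) = add3 (add3 x (scal3 l v)) (scal3 m v).
Proof. by apply: P3_eq; rewrite /add3 /scal3 /mk3 /ps /pz /pc /=; ring. Qed.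

Lemma norm3_ge0 x : 0 <= norm3 x.
Proof. by rewrite /norm3 le_max cabs_ge0. Qed.

Lemma norm3_lt x (e : R) : norm3 x < e <->
  [/\ cabs (ps x) < e, cabs (pz x) < e & cabs (pc x) < e].
Proof.
rewrite /norm3 !gt_max; split; first by case/and3P.
by case=> -> -> ->.
Qed.

Lemma norm3_le x (e : R) : norm3 x <= e <->
  [/\ cabs (ps x) <= e, cabs (pz x) <= e & cabs (pc x) <= e].
Proof.
rewrite /norm3 !ge_max; split; first by case/and3P.
by case=> -> -> ->.
Qed.

Lemma ps_le x : cabs (ps x) <= norm3 x.
Proof. by have /norm3_le[] := lexx (norm3 x). Qed.
Lemma pz_le x : cabs (pz x) <= norm3 x.
Proof. by have /norm3_le[] := lexx (norm3 x). Qed.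
Lemma pc_le x : cabs (pc x) <= norm3 x.
Proof. by have /norm3_le[] := lexx (norm3 x). Qed.

Lemma norm3D x y : norm3 (add3 x y) <= norm3 x + norm3 y.
Proof.
by apply/norm3_le; split; apply: le_trans (cabsD _ _) _; rewrite lerD// ?ps_le ?pz_le ?pc_le.
Qed.

Lemma norm3_scal (l : C) x : norm3 (scal3 l x) = cabs l * norm3 x.
Proof.
by rewrite /norm3 /scal3 /ps /pz /pc /= !cabsM !maxr_pMr ?cabs_ge0.
Qed.

Lemma norm3_subC x y : norm3 (sub3 x y) = norm3 (sub3 y x).
Proof. by rewrite /norm3 /sub3 /ps /pz /pc /= ![cabs (x.1.1 - _)]cabsBC ![cabs (x.1.2 - _)]cabsBC ![cabs (x.2 - _)]cabsBC. Qed.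

Lemma norm3_dist x y v : norm3 (sub3 x v) <= norm3 (sub3 x y) + norm3 (sub3 y v).
Proof.
have -> : sub3 x v = add3 (sub3 x y) (sub3 y v).
  by apply: P3_eq; rewrite /add3 /sub3 /mk3 /ps /pz /pc /=; ring.
exact: norm3D.
Qed.

Lemma norm3_sub_self x : norm3 (sub3 x x) = 0.
Proof. by rewrite /norm3 /sub3 /ps /pz /pc /= !subrr cabs0 !maxxx. Qed.

Lemma norm3_eq0 x : norm3 x = 0 -> x = mk3 0 0 0.
Proof.
move=> x0; have := ps_le x; have := pz_le x; have := pc_le x; rewrite x0.
have H (w : C) : cabs w <= 0 -> w = 0.
  by move=> w0; apply/eqP; rewrite -cabs_eq0 eq_le w0 cabs_ge0.
by move=> /H h1 /H h2 /H h3; apply: P3_eq.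
Qed.

Definition dot a h : C := ps a * ps h + pz a * pz h + pc a * pc h.

Lemma dotZ a (l : C) h : dot a (scal3 l h) = l * dot a h.
Proof. by rewrite /dot /scal3 /ps /pz /pc /=; ring. Qed.

Lemma dotB a b h : dot (sub3 a b) h = dot a h - dot b h.
Proof. by rewrite /dot /sub3 /ps /pz /pc /=; ring. Qed.

Lemma dot_es a : dot a (e_s R) = ps a.
Proof. by rewrite /dot /ps /pz /pc /=; ring. Qed.
Lemma dot_ez a : dot a (e_z R) = pz a.
Proof. by rewrite /dot /ps /pz /pc /=; ring. Qed.
Lemma dot_ec a : dot a (e_c R) = pc a.
Proof. by rewrite /dot /ps /pz /pc /=; ring. Qed.

Lemma norm3_es : norm3 (e_s R) = 1.
Proof. by rewrite /norm3 /ps /pz /pc /= cabs1 cabs0 maxxx max_l. Qed.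
Lemma norm3_ez : norm3 (e_z R) = 1.
Proof. by rewrite /norm3 /ps /pz /pc /= cabs1 cabs0 [Num.max 1 0]max_l// max_r. Qed.
Lemma norm3_ec : norm3 (e_c R) = 1.
Proof. by rewrite /norm3 /ps /pz /pc /= cabs1 cabs0 [Num.max 0 1]max_r// max_r. Qed.

Definition hdiff f x a := forall eps : R, 0 < eps -> exists del : R, 0 < del /\
  forall h, norm3 h < del -> cabs (f (add3 x h) - f x - dot a h) <= eps * norm3 h.

Lemma holo_atP f x : holo_at f x <-> exists a, hdiff f x a.
Proof.
split=> [[a1 [a2 [a3 H]]]|[[[a1 a2] a3] H]]; first by exists (mk3 a1 a2 a3).
by exists a1, a2, a3.
Qed.

Lemma hdiff_ext f g x a (rho : R) : 0 < rho ->
  (forall y, norm3 (sub3 y x) < rho -> f y = g y) -> hdiff f x a -> hdiff g x a.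
Proof.
move=> r0 fg D e /D[d [d0 H]]; exists (Num.min d rho); split; first by rewrite lt_min d0.
move=> h; rewrite lt_min => /andP[hd hr]; rewrite -!fg ?H ?sub3_add3 ?norm3_sub_self//.
Qed.

Lemma holo_at_ext f g x (rho : R) : 0 < rho ->
  (forall y, norm3 (sub3 y x) < rho -> f y = g y) -> holo_at f x -> holo_at g x.
Proof.
by move=> r0 fg /holo_atP[a D]; apply/holo_atP; exists a; exact: hdiff_ext fg D.
Qed.

Lemma hdiff_line f x v (l : C) a : hdiff f (add3 x (scal3 l v)) a ->
  cdiff (fun m => f (add3 x (scal3 m v))) l (dot a v).
Proof.
move=> D e e0; have K0 : 0 < norm3 v + 1 by rewrite ltr_wpDl ?norm3_ge0.
have [d [d0 H]] := D _ (divr_gt0 e0 K0).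
exists (d / (norm3 v + 1)); split=> [|h]; first by rewrite divr_gt0.
rewrite ltr_pdivlMr// => hd; rewrite add3_scalD mulrC -dotZ.
have hv : cabs h * norm3 v <= cabs h * (norm3 v + 1) by rewrite ler_wpM2l ?cabs_ge0// lerDl.
apply: le_trans (H _ _) _; rewrite norm3_scal; first exact: le_lt_trans hv hd.
rewrite mulrAC ler_pdivrMr// -mulrA ler_wpM2l// ltW//.
Qed.

Lemma hdiff_pderiv f x v a : hdiff f x a -> is_pderiv f x v (dot a v).
Proof.
move=> D e e0; have D0 : hdiff f (add3 x (scal3 0 v)) a by rewrite add3_scal0.
have e2 : 0 < e / 2 by rewrite divr_gt0.
have [d [d0 H]] := hdiff_line D0 e2.
exists d; split=> // h h0 /H; rewrite add0r add3_scal0 => hh.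
have ch : 0 < cabs h by rewrite cabs_gt0.
have -> : (f (add3 x (scal3 h v)) - f x) / h - dot a v =
   (f (add3 x (scal3 h v)) - f x - dot a v * h) / h by field.
rewrite cabs_div ltr_pdivrMr//; apply: le_lt_trans hh _.
by rewrite ltr_pM2r//; lra.
Qed.

Lemma is_pderiv_unique f x v w1 w2 : is_pderiv f x v w1 -> is_pderiv f x v w2 -> w1 = w2.
Proof.
move=> D1 D2; apply: small_eq => e e0; have e2 : 0 < e / 2 by rewrite divr_gt0.
have [d1 [d10 H1]] := D1 _ e2; have [d2 [d20 H2]] := D2 _ e2.
pose t : R := Num.min d1 d2 / 2.
have m0 : 0 < Num.min d1 d2 by rewrite lt_min d10.
have t0 : 0 < t by rewrite divr_gt0.
have tm : t < Num.min d1 d2 by rewrite /t; lra.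
have cz : cabs ((t%:C)%C : C) = t by rewrite cabs_real gtr0_norm.
have n0 : (t%:C)%C != 0 :> C by rewrite -cabs_gt0 cz.
move: tm; rewrite lt_min => /andP[t1 t2].
have := H1 _ n0; have := H2 _ n0; rewrite cz => /(_ t2) h2 /(_ t1) h1.
set q := _ / _ in h1 h2.
have -> : w1 - w2 = (q - w2) - (q - w1) by ring.
by apply: le_lt_trans (cabsB _ _) _; rewrite [e]splitr ltrD.
Qed.

Lemma is_pderiv_ext f g x v w (rho : R) : 0 < rho ->
  (forall y, norm3 (sub3 y x) < rho -> f y = g y) -> is_pderiv f x v w -> is_pderiv g x v w.
Proof.
move=> r0 fg D e e0; have [d [d0 H]] := D e e0.
have K0 : 0 < norm3 v + 1 by rewrite ltr_wpDl ?norm3_ge0.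
exists (Num.min d (rho / (norm3 v + 1))); split; first by rewrite lt_min d0 divr_gt0.
move=> h h0; rewrite lt_min => /andP[hd]; rewrite ltr_pdivlMr// => hr.
rewrite -!fg ?H ?sub3_add3 ?norm3_sub_self//.
rewrite norm3_scal; apply: le_lt_trans hr.
by rewrite ler_wpM2l ?cabs_ge0// lerDl.
Qed.

Lemma hdiffB f g x a b : hdiff f x a -> hdiff g x b ->
  hdiff (fun y => f y - g y) x (sub3 a b).
Proof.
move=> Df Dg e e0; have e2 : 0 < e / 2 by rewrite divr_gt0.
have [d1 [d10 H1]] := Df _ e2; have [d2 [d20 H2]] := Dg _ e2.
exists (Num.min d1 d2); split; first by rewrite lt_min d10.
move=> h; rewrite lt_min => /andP[/H1 h1 /H2 h2]; rewrite dotB.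
have -> : f (add3 x h) - g (add3 x h) - (f x - g x) - (dot a h - dot b h) =
   (f (add3 x h) - f x - dot a h) - (g (add3 x h) - g x - dot b h) by ring.
by apply: le_trans (cabsB _ _) _; lra.
Qed.

Lemma holoB f g x : holo_at f x -> holo_at g x -> holo_at (fun y => f y - g y) x.
Proof.
move=> /holo_atP[a Da] /holo_atP[b Db]; apply/holo_atP; exists (sub3 a b).
exact: hdiffB.
Qed.

Lemma holo_bounded f x : holo_at f x -> exists rho M : R, [/\ 0 < rho, 0 <= M &
  forall y, norm3 (sub3 y x) < rho -> cabs (f y) <= M].
Proof.
move=> /holo_atP[a D]; have [d [d0 H]] := D 1 ltr01.
exists (Num.min d 1), (cabs (f x) + (cabs (ps a) + cabs (pz a) + cabs (pc a)) + 1); split.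
- by rewrite lt_min d0 ltr01.
- by rewrite !addr_ge0 ?cabs_ge0.
move=> y; rewrite lt_min => /andP[/H]; rewrite add3_sub3 mul1r => h1 h2.
have h3 : cabs (dot a (sub3 y x)) <= cabs (ps a) + cabs (pz a) + cabs (pc a).
  have comp (u w : C) : cabs w <= norm3 (sub3 y x) -> cabs (u * w) <= cabs u.
    by move=> hw; rewrite cabsM ler_piMr ?cabs_ge0// (le_trans hw)// ltW.
  apply: le_trans (cabsD _ _) _; rewrite lerD ?comp ?pc_le//.
  by apply: le_trans (cabsD _ _) _; rewrite lerD ?comp ?ps_le ?pz_le.
have -> : f y = (f y - f x - dot a (sub3 y x)) + (f x + dot a (sub3 y x)) by ring.
apply: le_trans (cabsD _ _) _.
have := cabsD (f x) (dot a (sub3 y x)); lra.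
Qed.

(** The one-variable estimate on the complex line through [x] with direction [h] normalised to norm
    1; the constants do not depend on the direction. *)
Lemma hdiff_second_order f x a (rho M : R) : 0 < rho -> 0 <= M ->
  (forall y, norm3 (sub3 y x) < rho -> holo_at f y) ->
  (forall y, norm3 (sub3 y x) < rho -> cabs (f y) <= M) -> hdiff f x a ->
  (forall h, cabs (dot a h) <= 4 * M / rho * norm3 h) /\
  forall h, norm3 h <= rho / 4 ->
    cabs (f (add3 x h) - f x - dot a h) <= 16 * M * (norm3 h / rho) ^+ 2.
Proof.
move=> r0 M0 hf hM Da.
have key h : norm3 h != 0 -> cabs (dot a h) <= 4 * M / rho * norm3 h /\
    (norm3 h <= rho / 4 ->
    cabs (f (add3 x h) - f x - dot a h) <= 16 * M * (norm3 h / rho) ^+ 2).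
  move=> h0; have hp : 0 < norm3 h by rewrite lt_def h0 norm3_ge0.
  pose N : C := ((norm3 h)%:C)%C.
  have cN : cabs N = norm3 h by rewrite cabs_real gtr0_norm.
  have N0 : N != 0 by rewrite -cabs_gt0 cN.
  pose v := scal3 N^-1 h.
  have v1 : norm3 v = 1 by rewrite norm3_scal cabsV cN mulVf.
  have hv : h = scal3 N v.
    by apply: P3_eq; rewrite /v /scal3 /ps /pz /pc /=; field.
  have ball l : cabs l < rho -> norm3 (sub3 (add3 x (scal3 l v)) x) < rho.
    by rewrite sub3_add3 norm3_scal v1 mulr1.
  have [|||hb hq] := @cdiff_second_order R (fun l => f (add3 x (scal3 l v))) rho M (dot a v) r0 M0.
  - move=> l lr; have /holo_atP[b Db] := hf _ (ball _ lr).
    by exists (dot b v); exact: hdiff_line.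
  - by move=> l lr; apply: hM; exact: ball.
  - by apply: hdiff_line; rewrite add3_scal0.
  split; first by rewrite {1}hv dotZ cabsM cN mulrC ler_wpM2r// norm3_ge0.
  by move=> hr; have := hq N; rewrite cN add3_scal0 -hv [dot a v * N]mulrC -dotZ -hv; exact.
have zero h : norm3 h = 0 -> dot a h = 0 /\ add3 x h = x.
  move=> /norm3_eq0 ->; split; first by rewrite /dot /ps /pz /pc /=; ring.
  by apply: P3_eq; rewrite /add3 /ps /pz /pc /=; ring.
split=> h; have [h0|h0] := eqVneq (norm3 h) 0.
- by have [-> _] := zero h h0; rewrite h0 cabs0 mulr0.
- by have [] := key h h0.
- have [-> ->] := zero h h0.
  by rewrite h0 subrr subr0 cabs0 mul0r expr0n mulr0.
- by have [_] := key h h0.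
Qed.

(** Cauchy estimates for [F n - F m] make the gradients converge and bound its second-order
    remainder uniformly; the remainder of [f] is then that of one [F N] plus a small one.
    Convergence of the gradients is part of the conclusion so that differential equations pass to
    the limit. *)
Lemma weierstrass (F : nat -> P -> C) (A : nat -> P) f x (rho : R) : 0 < rho ->
  (forall n y, norm3 (sub3 y x) < rho -> holo_at (F n) y) ->
  (forall eps : R, 0 < eps -> exists N, forall n y, (N <= n)%N ->
     norm3 (sub3 y x) < rho -> cabs (F n y - f y) <= eps) ->
  (forall n, hdiff (F n) x (A n)) ->
  exists a, hdiff f x a /\ forall v, cconv (fun n => dot (A n) v) (dot a v).
Proof.
move=> r0 hF cF dF.
have FF eps : 0 < eps -> exists N, forall n m y, (N <= n)%N -> (N <= m)%N ->
     norm3 (sub3 y x) < rho -> cabs (F n y - F m y) <= eps.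
  move=> e0; have [N HN] := cF _ (divr_gt0 e0 (ltr0n R 2)).
  exists N => n m y nN mN yr.
  apply: le_trans (cabs_dist _ (f y) _) _; rewrite [cabs (f y - _)]cabsBC.
  by rewrite [eps]splitr lerD// HN.
have diffQ eps : 0 < eps -> exists N, forall n m, (N <= n)%N -> (N <= m)%N ->
    (forall h, cabs (dot (A n) h - dot (A m) h) <= 4 * eps / rho * norm3 h) /\
    forall h, norm3 h <= rho / 4 ->
     cabs (F n (add3 x h) - F m (add3 x h) - (F n x - F m x) - (dot (A n) h - dot (A m) h))
       <= 16 * eps * (norm3 h / rho) ^+ 2.
  move=> e0; have [N HN] := FF eps e0; exists N => n m nN mN.
  have [||||h1 h2] := @hdiff_second_order (fun y => F n y - F m y) x (sub3 (A n) (A m)) rho eps r0.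
  - exact: ltW.
  - by move=> y yr; apply: holoB; exact: hF.
  - by move=> y yr; exact: HN.
  - exact: hdiffB.
  by split=> h; [rewrite -dotB|move=> /h2; rewrite dotB].
have cauchy h : norm3 h <= 1 -> exists l, cconv (fun n => dot (A n) h) l.
  move=> h1; apply: cconv_cauchy => e e0.
  have [N HN] := diffQ (e * rho / 8) (divr_gt0 (mulr_gt0 e0 r0) (ltr0n R 8)).
  exists N => n m nN mN; have [H _] := HN n m nN mN.
  apply: le_lt_trans (H h) _.
  have -> : 4 * (e * rho / 8) / rho = e / 2 by field; rewrite gt_eqF.
  have := norm3_ge0 h; nra.
have [|as_ Hs] := cauchy (e_s R); first by rewrite norm3_es.
have [|az Hz] := cauchy (e_z R); first by rewrite norm3_ez.
have [|ac Hc] := cauchy (e_c R); first by rewrite norm3_ec.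
pose a := mk3 as_ az ac.
have Ha v : cconv (fun n => dot (A n) v) (dot a v).
  have := cconvD (cconvD (cconvZ (ps v) Hs) (cconvZ (pz v) Hz)) (cconvZ (pc v) Hc).
  have -> : dot a v = ps v * as_ + pz v * az + pc v * ac.
    by rewrite /dot /ps /pz /pc /=; ring.
  by apply: cconv_ext => n; rewrite dot_es dot_ez dot_ec /dot; ring.
exists a; split=> // e e0.
(* With this bound the second-order estimate is at most [e / 2 * norm3 h] once [norm3 h <= rho / 4];
   the other half is left to [F N]. *)
have e8 : 0 < e * rho / 8 by rewrite divr_gt0// mulr_gt0.
have [N HN] := diffQ _ e8.
have [d [d0 Hd]] := dF N _ (divr_gt0 e0 (ltr0n R 2)).
exists (Num.min d (rho / 4)); split; first by rewrite lt_min d0 divr_gt0.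
move=> h; rewrite lt_min => /andP[hd hr4].
have pw y : norm3 (sub3 y x) < rho -> cconv (fun n => F n y) (f y).
  move=> yr ep ep0; have [K HK] := cF _ (divr_gt0 ep0 (ltr0n R 2)).
  by exists K => n nK; apply: le_lt_trans (HK n y nK yr) _; lra.
have xr : norm3 (sub3 x x) < rho by rewrite norm3_sub_self.
have hr : norm3 (sub3 (add3 x h) x) < rho by rewrite sub3_add3 (lt_trans hr4)//; lra.
have cst w : cconv (fun=> w : C) w.
  by move=> ? ?; exists 0%N => ? _; rewrite subrr cabs0.
have lim := cconvB (cconvB (cconvB (pw _ hr) (cst (F N (add3 x h))))
  (cconvB (pw _ xr) (cst (F N x)))) (cconvB (Ha h) (cst (dot (A N) h))).
have b1 := @cconv_le _ _ _ (16 * (e * rho / 8) * (norm3 h / rho) ^+ 2) N lim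
  (fun n nN => (HN n N nN (leqnn N)).2 h (ltW hr4)).
have b2 := Hd h hd.
have -> : f (add3 x h) - f x - dot a h =
  (f (add3 x h) - F N (add3 x h) - (f x - F N x) - (dot a h - dot (A N) h)) +
  (F N (add3 x h) - F N x - dot (A N) h) by ring.
apply: le_trans (cabsD _ _) _; apply: le_trans (lerD b1 b2) _.
have -> : 16 * (e * rho / 8) * (norm3 h / rho) ^+ 2 = 2 * e * norm3 h * (norm3 h / rho).
  by field; rewrite gt_eqF.
have : norm3 h / rho <= 4^-1 by rewrite ler_pdivrMr//; lra.
have := norm3_ge0 h; set t := norm3 h; set q := t / rho => t0 q4.
have : e * t * q <= e * t * 4^-1 by rewrite ler_wpM2l// mulr_ge0// ltW.
by lra.
Qed.

(** The default 0 makes the derivative a total function, which can be differentiated again and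
    compared by the identity principle. *)
Definition dpart f v x : C :=
  match pselect (exists w, is_pderiv f x v w) with
  | left e => projT1 (cid e)
  | right _ => 0
  end.

Lemma dpartE f v x w : is_pderiv f x v w -> dpart f v x = w.
Proof.
move=> D; rewrite /dpart; case: pselect => [e|]; last by case; exists w.
by case: cid => w' /= D'; exact: is_pderiv_unique D' D.
Qed.

Lemma dpartP f v x : holo_at f x -> is_pderiv f x v (dpart f v x).
Proof. by case/holo_atP => a /(@hdiff_pderiv _ _ v) D; rewrite (dpartE D). Qed.

Lemma hdiff_translate f x h a : hdiff f (add3 x h) a -> hdiff (fun y => f (add3 y h)) x a.
Proof.
move=> D e /D[d [d0 H]]; exists d; split=> // k /H.
have -> : add3 (add3 x h) k = add3 (add3 x k) h; last by [].
by apply: P3_eq; rewrite /add3 /ps /pz /pc /=; ring.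
Qed.

Lemma holo_translate f x h : holo_at f (add3 x h) -> holo_at (fun y => f (add3 y h)) x.
Proof. by move=> /holo_atP[a D]; apply/holo_atP; exists a; exact: hdiff_translate. Qed.

Lemma hdiffZ f x a (w : C) : hdiff f x a -> hdiff (fun y => w * f y) x (scal3 w a).
Proof.
move=> D e e0; have K0 : 0 < cabs w + 1 by rewrite ltr_wpDl ?cabs_ge0.
have [d [d0 H]] := D _ (divr_gt0 e0 K0); exists d; split=> // h /H hh.
have -> : w * f (add3 x h) - w * f x - dot (scal3 w a) h =
    w * (f (add3 x h) - f x - dot a h).
  by rewrite /dot /scal3 /ps /pz /pc /=; ring.
rewrite cabsM; apply: le_trans (ler_wpM2l (cabs_ge0 w) hh) _.
rewrite mulrA ler_wpM2r ?norm3_ge0// mulrCA ler_piMr ?(ltW e0)//.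
by rewrite ler_pdivrMr// mul1r lerDl.
Qed.

Lemma holoZ f x (w : C) : holo_at f x -> holo_at (fun y => w * f y) x.
Proof. by move=> /holo_atP[a D]; apply/holo_atP; exists (scal3 w a); exact: hdiffZ. Qed.

(** The difference quotients with step [t n] are holomorphic and, by the uniform second-order
    estimate, converge uniformly to the derivative near [x]; Weierstrass' theorem concludes. *)
Lemma holo_dpart f v x (rho : R) : 0 < rho -> norm3 v <= 1 ->
  (forall y, norm3 (sub3 y x) < rho -> holo_at f y) -> holo_at (dpart f v) x.
Proof.
move=> r0 v1 hf.
have [r1 [M [r10 M0 hM]]] : exists rho M : R, [/\ 0 < rho, 0 <= M &
  forall y, norm3 (sub3 y x) < rho -> cabs (f y) <= M].
  by apply: holo_bounded; apply: hf; rewrite norm3_sub_self.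
pose r := Num.min rho r1 / 2.
have m0 : 0 < Num.min rho r1 by rewrite lt_min r0.
have rp : 0 < r by rewrite divr_gt0.
have r_rho : 2 * r <= rho by rewrite /r mulrC divfK ?pnatr_eq0// ge_min lexx.
have r_r1 : 2 * r <= r1 by rewrite /r mulrC divfK ?pnatr_eq0// ge_min lexx orbT.
pose t n : R := r / 4 / n.+1%:R.
have t0 n : 0 < t n by rewrite !divr_gt0.
have t4 n : t n <= r / 4.
  have r4 : 0 <= r / 4 by rewrite divr_ge0// ltW.
  by rewrite /t ler_pdivrMr// ler_peMr// ler1n.
pose T n : C := ((t n)%:C)%C.
have cT n : cabs (T n) = t n by rewrite cabs_real gtr0_norm.
have T0 n : T n != 0 by rewrite -cabs_gt0 cT.
pose F n y := (T n)^-1 * (f (add3 y (scal3 (T n) v)) - f y).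
have ball2 y h : norm3 (sub3 y x) < r -> norm3 h < r -> norm3 (sub3 (add3 y h) x) < 2 * r.
  move=> yr hr; apply: le_lt_trans (norm3_dist _ y _) _; rewrite sub3_add3.
  by rewrite twice_add ltrD.
have ball1 y k : norm3 (sub3 y x) < r -> norm3 (sub3 k y) < r -> norm3 (sub3 k x) < 2 * r.
  by move=> yr kr; rewrite -(add3_sub3 y k) ball2.
have Tv n : norm3 (scal3 (T n) v) <= t n.
  by rewrite norm3_scal cT ler_piMr// ltW.
have FH n y : norm3 (sub3 y x) < r -> holo_at (F n) y.
  move=> yr; apply: holoZ; apply: holoB.
    apply: holo_translate; apply: hf; apply: lt_le_trans r_rho; apply: ball2 => //.
    by apply: le_lt_trans (Tv n) _; apply: le_lt_trans (t4 n) _; lra.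
  by apply: hf; apply: lt_le_trans r_rho; lra.
have xr : norm3 (sub3 x x) < r by rewrite norm3_sub_self.
have [A HA] := choice (fun n => (holo_atP (F n) x).1 (FH n x xr)).
have [||a [Da _]] := @weierstrass F A (dpart f v) x r rp FH; last first.
- by apply/holo_atP; exists a.
- exact: HA.
move=> e e0.
have K0 : 0 < 16 * M / r ^+ 2 + 1.
  by apply: ltr_wpDl => //; apply: divr_ge0; rewrite ?sqr_ge0 ?mulr_ge0.
have [N HN] : exists N, forall n, (N <= n)%N -> t n * (16 * M / r ^+ 2 + 1) < e.
  exists (Num.Def.trunc (r / 4 * (16 * M / r ^+ 2 + 1) / e)) => n hn.
  have : r / 4 * (16 * M / r ^+ 2 + 1) / e < n.+1%:R.
    by apply: lt_le_trans (truncnS_gt _) _; rewrite ler_nat.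
  rewrite ltr_pdivrMr// => h.
  by rewrite /t mulrAC ltr_pdivrMr// [ltRHS]mulrC.
exists N => n y /HN hn yr.
have yrho : norm3 (sub3 y x) < rho by apply: lt_le_trans r_rho; lra.
have /holo_atP[b Db] := hf y yrho.
rewrite (dpartE (hdiff_pderiv v Db)).
have [||_ hq] := @hdiff_second_order f y b r M rp M0 _ _ Db.
- by move=> k ky; apply: hf; exact: (lt_le_trans (ball1 y k yr ky) r_rho).
- by move=> k ky; apply: hM; exact: (lt_le_trans (ball1 y k yr ky) r_r1).
have := hq (scal3 (T n) v) (le_trans (Tv n) (t4 n)); rewrite dotZ => h.
have -> : F n y - dot b v = (T n)^-1 * (f (add3 y (scal3 (T n) v)) - f y - T n * dot b v).
  by rewrite /F [in RHS]mulrBr mulKf.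
rewrite cabsM cabsV cT mulrC ler_pdivrMr//; apply: le_trans h _.
apply: (@le_trans _ _ (16 * M * (t n / r) ^+ 2)).
  have tr : norm3 (scal3 (T n) v) / r <= t n / r by rewrite ler_pM2r ?invr_gt0.
  have n0 : 0 <= norm3 (scal3 (T n) v) / r by rewrite divr_ge0 ?norm3_ge0// ltW.
  apply: ler_wpM2l; first by rewrite mulr_ge0.
  by apply: lerXn2r => //; rewrite nnegrE (le_trans n0).
have -> : 16 * M * (t n / r) ^+ 2 = t n * (16 * M / r ^+ 2) * t n by rewrite expr_div_n; ring.
by rewrite ler_pM2r// ltW// (le_lt_trans _ hn)// ler_pM2l// lerDl.
Qed.

End ThreeVariables.

(** * The identity principle, and the algebra of holomorphic functions *)

Section IdentityPrinciple.
Variable R : realType.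
Local Notation C := R[i].
Local Notation P := (P3 R).
Implicit Types (f g : P -> C) (x y h v a : P) (U : P -> Prop).

(** Connectedness of the interval. The length [del] depends on [t] alone, not on witnesses hidden in
    [Q t1]; each use must therefore recover a radius that is independent of those witnesses. *)
Lemma unit_interval_induction (Q : R -> Prop) : Q 0 ->
  (forall t, 0 <= t <= 1 -> exists del : R, 0 < del /\ forall t1 t2, 0 <= t1 <= 1 ->
     0 <= t2 <= 1 -> `|t1 - t| < del -> `|t2 - t| < del -> Q t1 -> Q t2) ->
  forall t, 0 <= t <= 1 -> Q t.
Proof.
move=> Q0 loc.
pose S := [set t | 0 <= t <= 1 /\ forall u, 0 <= u <= t -> Q u]%classic.
have S0 : S 0.
  split; first by rewrite lexx ler01.
  by move=> u /andP[u0 u1]; have -> : u = 0 by apply/eqP; rewrite eq_le u0 u1.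
have ubS : ubound S 1 by move=> t [/andP[_ t1] _].
pose m := sup S.
have m0 : 0 <= m by apply: ub_le_sup S0; exists 1.
have m1 : m <= 1 by apply: ge_sup => //; exists 0.
have [|d [d0 Hd]] := loc m; first by rewrite m0 m1.
have [t1 St1 mt1] : exists2 t1, S t1 & m - d < t1.
  by apply: sup_gt; [exists 0|rewrite gtrBl].
have t1m : t1 <= m by apply: ub_le_sup St1; exists 1.
have [/andP[t10 t11] Qt1] := St1.
have Qn u : 0 <= u <= 1 -> `|u - m| < d -> Q u.
  move=> u01 um; apply: (Hd t1 u) => //; first by rewrite t10 t11.
    by rewrite ltr_norml; lra.
  by apply: Qt1; rewrite t10 lexx.
have Sx t : 0 <= t <= 1 -> t < m + d -> S t.
  move=> /andP[ta tb] tm; split; first by rewrite ta tb.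
  move=> u /andP[ua ub]; have [ut|ut] := leP u t1; first by apply: Qt1; rewrite ua.
  by apply: Qn; rewrite ?ua ?(le_trans ub)// ltr_norml; lra.
have [md|md] := ltP 1 (m + d).
  have [|_ H] := Sx 1 _ md; first by rewrite ler01 lexx.
  by move=> t t01; exact: H.
have : S (m + d / 2) by apply: Sx; lra.
by move=> /(ub_le_sup (ex_intro _ 1 ubS)); rewrite -/m; lra.
Qed.

Definition open3 U := forall x, U x -> exists rho : R, 0 < rho /\
  forall y, norm3 (sub3 y x) < rho -> U y.

Definition starshaped x U := forall y (t : R), U y -> 0 <= t <= 1 ->
  U (add3 x (scal3 (t%:C)%C (sub3 y x))).

(** Vanishing near the centre kills all Taylor coefficients, hence the function on the whole disc,
    however small [d] is. *)
Lemma vanish_recenter (phi : C -> C) (r M d : R) : 0 < r -> 0 < d ->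
  (forall z, cabs z <= r -> exists b, cdiff phi z b) ->
  (forall z, cabs z <= r -> cabs (phi z) <= M) ->
  (forall z, cabs z < d -> phi z = 0) -> forall z, cabs z < r -> phi z = 0.
Proof.
move=> r0 d0 hd hM h0; have [A [cA hA]] := taylor_expansion r0 hd.
have M0 : 0 <= M by apply: le_trans (hM 0 _); rewrite ?cabs_ge0 ?cabs0 ?ltW.
have {}hA : forall n, cabs (A n) * r ^+ n <= 2 * M.
  by apply: hA => z zr; apply: hM; rewrite zr.
have A0 : forall n, A n = 0.
  apply: (@psum_eq0 R A r (2 * M) (Num.min d r)) => //; first by rewrite mulr_ge0.
    by rewrite lt_min d0.
  by move=> z; rewrite lt_min => /andP[zd zr]; rewrite -(h0 z zd); exact: cA.
move=> z zr; apply: cconv_unique (cA z zr) _ => e e0; exists 0%N => n _.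
by rewrite big1 ?subrr ?cabs0// => i _; rewrite A0 mul0r.
Qed.

(** On the complex line through [x] and [y], vanishing near a parameter is propagated over [[0, 1]]
    by recentring Taylor expansions; only the segment from [x] to [y] has to lie in [U]. *)
Lemma identity_principle U f x (d : R) : open3 U -> starshaped x U ->
  (forall y, U y -> holo_at f y) -> 0 < d ->
  (forall y, norm3 (sub3 y x) < d -> f y = 0) -> forall y, U y -> f y = 0.
Proof.
move=> oU sU hf d0 f0 y Uy; pose v := sub3 y x.
pose phi (l : C) := f (add3 x (scal3 l v)).
have K0 : 0 < norm3 v + 1 by rewrite ltr_wpDl ?norm3_ge0.
pose Q (t : R) := exists rho : R, 0 < rho /\ forall l : C, cabs l < rho -> phi ((t%:C)%C + l) = 0.
have lv (l : C) rho : cabs l < rho / (norm3 v + 1) -> norm3 (scal3 l v) < rho.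
  rewrite ltr_pdivlMr// norm3_scal; apply: le_lt_trans.
  by rewrite ler_wpM2l ?cabs_ge0// lerDl.
suff : Q 1.
  case=> rho [r0 H]; have := H 0; rewrite cabs0 addr0 => /(_ r0).
  rewrite /phi; have -> // : add3 x (scal3 1 v) = y.
  by apply: P3_eq; rewrite /v /add3 /scal3 /sub3 /mk3 /ps /pz /pc /=; ring.
apply: (@unit_interval_induction Q); last by rewrite ler01 lexx.
  exists (d / (norm3 v + 1)); split; first by rewrite divr_gt0.
  by move=> l /lv h; rewrite add0r /phi f0// sub3_add3.
move=> t t01; have Up := sU y t Uy t01; set p := add3 x _ in Up.
have [r1 [r10 H1]] := oU _ Up.
have [r2 [M [r20 M0 H2]]] := holo_bounded (hf _ Up).
pose r := Num.min r1 r2 / (norm3 v + 1).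
have r0 : 0 < r by rewrite divr_gt0// lt_min r10.
have near (l : C) : cabs l < r -> norm3 (sub3 (add3 x (scal3 ((t%:C)%C + l) v)) p) < Num.min r1 r2.
  by move=> /lv h; rewrite add3_scalD sub3_add3.
(* A disc of radius [r / 2] about [t1] stays in the good disc about [t] and contains the disc of
   radius [r / 8] about [t2]. *)
exists (r / 8); split; first by rewrite divr_gt0.
move=> t1 t2 _ _ tt1 tt2 [d1 [d10 Z1]].
pose s (t' : R) : C := ((t' - t)%:C)%C.
have sE t' : (t'%:C)%C = (t%:C)%C + s t' :> C by rewrite /s rmorphB addrC subrK.
have cs t' : cabs (s t') = `|t' - t| by rewrite cabs_real.
have l1 (l : C) : cabs l <= r / 2 -> cabs (s t1 + l) < r.
  by move=> h; apply: le_lt_trans (cabsD _ _) _; rewrite cs; lra.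
have Z : forall l : C, cabs l < r / 2 -> phi ((t1%:C)%C + l) = 0.
  apply: (@vanish_recenter (fun l => phi ((t1%:C)%C + l)) (r / 2) M d1) => //.
  - by rewrite divr_gt0.
  - move=> l /l1 lr.
    have : holo_at f (add3 x (scal3 ((t1%:C)%C + l) v)).
      apply/hf/H1; rewrite (sE t1) -addrA; apply: lt_le_trans (near _ lr) _.
      by rewrite ge_min lexx.
    case/holo_atP => b Db; exists (dot b v) => e e0.
    have [dl [dl0 Hdl]] := hdiff_line Db e0.
    by exists dl; split=> // h /Hdl; rewrite addrA.
  - move=> l /l1 lr; apply: H2; rewrite (sE t1) -addrA; apply: lt_le_trans (near _ lr) _.
    by rewrite ge_min lexx orbT.
exists (r / 8); split; first by rewrite divr_gt0.
move=> l lr; have -> : (t2%:C)%C + l = (t1%:C)%C + (s t2 - s t1 + l) by rewrite (sE t1) (sE t2); ring.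
apply: Z; apply: le_lt_trans (cabsD _ _) _; have := cabsB (s t2) (s t1).
by rewrite !cs; lra.
Qed.

Lemma identity_principle2 U f g x (d : R) : open3 U -> starshaped x U ->
  (forall y, U y -> holo_at f y) -> (forall y, U y -> holo_at g y) -> 0 < d ->
  (forall y, norm3 (sub3 y x) < d -> f y = g y) -> forall y, U y -> f y = g y.
Proof.
move=> oU sU hf hg d0 fg y Uy; apply/eqP; rewrite -subr_eq0; apply/eqP.
apply: (identity_principle (f := fun y => f y - g y) oU sU _ d0 _ Uy).
  by move=> k Uk; apply: holoB; [exact: hf|exact: hg].
by move=> k /fg ->; rewrite subrr.
Qed.

Definition ball3 x (r : R) y := norm3 (sub3 y x) < r.

(** No condition on [s]: the set is convex and stable under shifts of [s]. *)
Definition tube x (r : R) y := cabs (pz y - pz x) < r /\ cabs (pc y - pc x) < r.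

Lemma open_ball3 x r : open3 (ball3 x r).
Proof.
move=> y yr; exists (r - norm3 (sub3 y x)); split; first by rewrite subr_gt0.
by move=> k ky; apply: le_lt_trans (norm3_dist _ y _) _; rewrite -ltrBrDr.
Qed.

Lemma star_ball3 x r : starshaped x (ball3 x r).
Proof.
move=> y t yr /andP[t0 t1]; rewrite /ball3 sub3_add3 norm3_scal cabs_real ger0_norm//.
by apply: le_lt_trans yr; rewrite ler_piMl ?norm3_ge0.
Qed.

Lemma open_tube x r : open3 (tube x r).
Proof.
move=> y [h1 h2].
exists (Num.min (r - cabs (pz y - pz x)) (r - cabs (pc y - pc x))); split.
  by rewrite lt_min !subr_gt0 h1.
move=> k; rewrite lt_min => /andP[/norm3_lt[_ k1 _] /norm3_lt[_ _ k2]].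
split; apply: le_lt_trans (cabs_dist _ _ _) _; rewrite -ltrBrDr; [exact: k1|exact: k2].
Qed.

Lemma star_tube x r p : tube x r p -> starshaped p (tube x r).
Proof.
move=> [p1 p2] y t [h1 h2] /andP[t0 t1].
have H (a b c : C) : cabs (a - c) < r -> cabs (b - c) < r ->
    cabs (a + (t%:C)%C * (b - a) - c) < r.
  move=> ha hb; have -> : a + (t%:C)%C * (b - a) - c =
      ((1 - t)%:C)%C * (a - c) + (t%:C)%C * (b - c) by rewrite rmorphB rmorph1; ring.
  apply: le_lt_trans (cabsD _ _) _; rewrite !cabsM !cabs_real !ger0_norm ?subr_ge0//.
  have := cabs_ge0 (a - c); have := cabs_ge0 (b - c).
  have [t1'|t1'] := ltP t 1; last first.
    have -> : t = 1 by apply/eqP; rewrite eq_le t1 t1'.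
    by lra.
  nra.
by split; apply: H.
Qed.

Lemma ball3_tube x r y : ball3 x r y -> tube x r y.
Proof. by move=> /norm3_lt[_ ? ?]. Qed.

Lemma ball3_self x r : 0 < r -> ball3 x r x.
Proof. by rewrite /ball3 norm3_sub_self. Qed.

Lemma ball3_dist x y (r s : R) k : ball3 x r y -> ball3 y s k -> ball3 x (r + s) k.
Proof. by move=> h1 h2; apply: le_lt_trans (norm3_dist _ y _) _; rewrite addrC ltrD. Qed.

Lemma tube_dist x y (r s : R) k : tube x r y -> tube y s k -> tube x (r + s) k.
Proof.
by move=> [h1 h2] [h3 h4]; split; apply: le_lt_trans (cabs_dist _ _ _) _; rewrite addrC ltrD//;
  [exact: h1|exact: h3|exact: h2|exact: h4].
Qed.

Lemma ball3_le x (r s : R) y : r <= s -> ball3 x r y -> ball3 x s y.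
Proof. by move=> rs h; exact: lt_le_trans rs. Qed.

Lemma tube_le x (r s : R) y : r <= s -> tube x r y -> tube x s y.
Proof. by move=> rs [h1 h2]; split; [exact: lt_le_trans rs|exact: lt_le_trans rs]. Qed.

Lemma ball3_sym x y r : ball3 x r y -> ball3 y r x.
Proof. by rewrite /ball3 norm3_subC. Qed.

Lemma hdiffM f g x a b : hdiff f x a -> hdiff g x b ->
  hdiff (fun y => f y * g y) x (add3 (scal3 (f x) b) (scal3 (g x) a)).
Proof.
move=> Df Dg e e0.
pose na := cabs (ps a) + cabs (pz a) + cabs (pc a).
have na0 : 0 <= na by rewrite !addr_ge0 ?cabs_ge0.
have adot h : cabs (dot a h) <= na * norm3 h.
  rewrite /na !mulrDl; apply: le_trans (cabsD _ _) _; rewrite lerD//.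
    by apply: le_trans (cabsD _ _) _; rewrite lerD// cabsM ler_wpM2l ?cabs_ge0 ?ps_le ?pz_le.
  by rewrite cabsM ler_wpM2l ?cabs_ge0 ?pc_le.
pose K := cabs (f x) + cabs (g x) + na + 2.
have K0 : 0 < K by rewrite ltr_wpDl// !addr_ge0 ?cabs_ge0.
pose e1 := Num.min 1 (e / (2 * K)).
have e10 : 0 < e1 by rewrite lt_min ltr01 divr_gt0// mulr_gt0.
have e11 : e1 <= 1 by rewrite ge_min lexx.
have e1K : e1 * (2 * K) <= e by rewrite -ler_pdivlMr ?mulr_gt0// ge_min lexx orbT.
have [d1 [d10 H1]] := Df _ e10; have [d2 [d20 H2]] := Dg _ e10.
pose nb := cabs (ps b) + cabs (pz b) + cabs (pc b).
have nb0 : 0 <= nb by rewrite !addr_ge0 ?cabs_ge0.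
have bdot h : cabs (dot b h) <= nb * norm3 h.
  rewrite /nb !mulrDl; apply: le_trans (cabsD _ _) _; rewrite lerD//.
    by apply: le_trans (cabsD _ _) _; rewrite lerD// cabsM ler_wpM2l ?cabs_ge0 ?ps_le ?pz_le.
  by rewrite cabsM ler_wpM2l ?cabs_ge0 ?pc_le.
pose d3 := e1 / (1 + nb).
have d30 : 0 < d3 by rewrite divr_gt0// ltr_pwDl.
exists (Num.min d1 (Num.min d2 d3)); split; first by rewrite !lt_min d10 d20.
move=> h; rewrite !lt_min => /andP[/H1 h1 /andP[/H2 h2 h3]].
set F := f (add3 x h) - f x - dot a h in h1.
set G := g (add3 x h) - g x - dot b h in h2.
have -> : f (add3 x h) * g (add3 x h) - f x * g x - dot (add3 (scal3 (f x) b) (scal3 (g x) a)) h =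
   f x * G + (g x * F + (F + dot a h) * (G + dot b h)).
  by rewrite /F /G /dot /add3 /scal3 /ps /pz /pc /=; ring.
have n0 := norm3_ge0 h.
have hF : cabs (F + dot a h) <= (1 + na) * norm3 h.
  apply: le_trans (cabsD _ _) _; rewrite mulrDl lerD//.
  by apply: le_trans h1 _; rewrite ler_wpM2r.
have hG : cabs (G + dot b h) <= e1.
  apply: le_trans (cabsD _ _) _; apply: (@le_trans _ _ ((1 + nb) * norm3 h)).
    by rewrite mulrDl lerD//; apply: le_trans h2 _; rewrite ler_wpM2r.
  by rewrite mulrC -ler_pdivlMr ?ltr_pwDl// ltW.
have b1 : cabs (f x * G) <= cabs (f x) * (e1 * norm3 h) by rewrite cabsM ler_wpM2l ?cabs_ge0.
have b2 : cabs (g x * F) <= cabs (g x) * (e1 * norm3 h) by rewrite cabsM ler_wpM2l ?cabs_ge0.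
have b3 : cabs ((F + dot a h) * (G + dot b h)) <= (1 + na) * norm3 h * e1.
  by rewrite cabsM ler_pM ?cabs_ge0.
apply: le_trans (cabsD _ _) _; apply: le_trans (lerD b1 (cabsD _ _)) _.
apply: (@le_trans _ _ (e1 * (2 * K) * norm3 h)); last by rewrite ler_wpM2r.
have t0 : 0 <= e1 * norm3 h by rewrite mulr_ge0// ltW.
have : 0 <= (e1 * norm3 h) * (K + 1).
  by rewrite mulr_ge0// addr_ge0// ltW.
have : e1 * (2 * K) * norm3 h = cabs (f x) * (e1 * norm3 h) + cabs (g x) * (e1 * norm3 h)
  + (1 + na) * norm3 h * e1 + (e1 * norm3 h) * (K + 1) by rewrite /K; ring.
by lra.
Qed.

Lemma holoM f g x : holo_at f x -> holo_at g x -> holo_at (fun y => f y * g y) x.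
Proof.
move=> /holo_atP[a Da] /holo_atP[b Db]; apply/holo_atP.
by eexists; exact: hdiffM Da Db.
Qed.

Lemma hdiff_dot a x (w : C) : hdiff (fun y => dot a y + w) x a.
Proof.
move=> e e0; exists 1; split=> // h _.
have -> : dot a (add3 x h) + w - (dot a x + w) - dot a h = 0.
  by rewrite /dot /add3 /ps /pz /pc /=; ring.
by rewrite cabs0 mulr_ge0 ?norm3_ge0 ?ltW.
Qed.

Lemma hdiff_ps x : hdiff (fun y => ps y) x (e_s R).
Proof.
have := @hdiff_dot (e_s R) x 0; apply: hdiff_ext (ltr01) _ => y _.
by rewrite /dot /ps /pz /pc /=; ring.
Qed.

Lemma hdiff_pz x : hdiff (fun y => pz y) x (e_z R).
Proof.
have := @hdiff_dot (e_z R) x 0; apply: hdiff_ext (ltr01) _ => y _.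
by rewrite /dot /ps /pz /pc /=; ring.
Qed.

Lemma hdiff_pc x : hdiff (fun y => pc y) x (e_c R).
Proof.
have := @hdiff_dot (e_c R) x 0; apply: hdiff_ext (ltr01) _ => y _.
by rewrite /dot /ps /pz /pc /=; ring.
Qed.

Lemma holo_pz x : holo_at (fun y : P => pz y) x.
Proof. by apply/holo_atP; exists (e_z R); exact: hdiff_pz. Qed.
Lemma holo_pc x : holo_at (fun y : P => pc y) x.
Proof. by apply/holo_atP; exists (e_c R); exact: hdiff_pc. Qed.
Lemma holo_ps x : holo_at (fun y : P => ps y) x.
Proof. by apply/holo_atP; exists (e_s R); exact: hdiff_ps. Qed.

Lemma holo_cst (w : C) x : holo_at (fun _ : P => w) x.
Proof.
apply/holo_atP; exists (mk3 0 0 0) => e e0; exists 1; split=> // h _.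
have -> : w - w - dot (mk3 0 0 0) h = 0 by rewrite /dot /ps /pz /pc /=; ring.
by rewrite cabs0 mulr_ge0 ?norm3_ge0 ?ltW.
Qed.

Lemma holoD f g x : holo_at f x -> holo_at g x -> holo_at (fun y => f y + g y) x.
Proof.
move=> hf hg; apply: (holo_at_ext (f := fun y => f y - (-1) * g y) ltr01).
  by move=> y _; ring.
by apply: holoB => //; exact: holoZ.
Qed.

End IdentityPrinciple.

(** * Hartogs' lemma *)

Section TubeBound.
Variable R : realType.
Local Notation C := R[i].
Local Notation P := (P3 R).

Let box := ((R * R) * (R * R) * (R * R))%type.

Let pt (q : P) (u : box) : P :=
  add3 q (mk3 (Complex u.1.1.1 u.1.1.2) (Complex u.1.2.1 u.1.2.2) (Complex u.2.1 u.2.2)).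

Let cabs_coord (a b a' b' e : R) : `|a - a'| < e / 2 -> `|b - b'| < e / 2 ->
  cabs (Complex a b - Complex a' b') < e.
Proof.
move=> h1 h2; apply: le_lt_trans (cabs_le_reim _) _; rewrite /reC /imC /=.
by rewrite [e]splitr ltrD.
Qed.

Let pt_ball q (u u' : box) (e : R) : ball u (e / 2) u' -> ball3 (pt q u) e (pt q u').
Proof.
case=> [[[h1 h2] [h3 h4]] [h5 h6]]; rewrite /ball3 /pt.
apply/norm3_lt; rewrite /add3 /sub3 /mk3 /ps /pz /pc /=.
have H (w v v' : C) : w + v - (w + v') = v - v' by ring.
by split; rewrite H; apply: cabs_coord; rewrite distrC.
Qed.

(** Local boundedness and compactness of a box in real coordinates. Coordinates of size [rho / 3]
    give modulus at most [2 * rho / 3], so the squares stay inside the discs of radius [rho]. *)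
Lemma holo_tube_bounded (E : P -> C) q (rho r : R) : 0 < rho ->
  (forall y, tube q rho y -> holo_at E y) ->
  exists M : R, forall y, cabs (ps y - ps q) <= r -> cabs (pz y - pz q) <= rho / 3 ->
    cabs (pc y - pc q) <= rho / 3 -> cabs (E y) <= M.
Proof.
move=> rho0 hE.
pose sq (a : R) := (`[(- a), a] `*` `[(- a), a])%classic : set (R * R).
have csq a : compact (sq a) by apply: compact_setX; exact: segment_compact.
pose K : set box := (sq r `*` sq (rho / 3) `*` sq (rho / 3))%classic.
have cK : compact K by do 2! apply: compact_setX => //.
have sqE (w : C) a : cabs w <= a -> sq a (reC w, imC w).
  move=> wa; rewrite /sq /= !in_itv /= -!ler_norml.
  by split; [apply: le_trans (cabs_re w) wa|apply: le_trans (cabs_im w) wa].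
have sqz (a b : R) : sq (rho / 3) (a, b) -> cabs (Complex a b) < rho.
  rewrite /sq /= !in_itv /= -!ler_norml => -[h1 h2].
  by apply: le_lt_trans (cabs_le_reim _) _; rewrite /reC /imC /=; lra.
have cov := (compact_near_coveringP K).1 cK R +oo%R
  (fun M u => cabs (E (pt q u)) <= M) _.
have : \forall M \near +oo, (K `<=` (fun u => cabs (E (pt q u)) <= M))%classic.
  apply: cov => -[[[a1 a2] [b1 b2]] [c1 c2]] [[_ Kz] Kc].
  have tu : tube q rho (pt q (((a1, a2), (b1, b2)), (c1, c2))).
    rewrite /tube /pt /add3 /mk3 /pz /pc /= ![_ + Complex _ _]addrC !addrK.
    by split; apply: sqz.
  set u0 := (_, _, _) in tu *.
  have [d [M [d0 M0 HM]]] := holo_bounded (hE _ tu).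
  exists (ball u0 (d / 2), [set m | M < m]%classic) => /=.
    split; first by apply: nbhsx_ballx; rewrite divr_gt0.
    by exists M; split; [exact: num_real|].
  case=> u m [/= /pt_ball hu hm]; apply: le_trans (ltW hm); apply: HM.
  exact: hu.
case=> M [_ HM]; exists (M + 1) => y ys yz yc.
have M1 : M < M + 1 by rewrite ltrDl.
have := HM (M + 1) M1.
pose d := sub3 y q.
have -> : E y = E (pt q (((reC (ps d), imC (ps d)), (reC (pz d), imC (pz d))), (reC (pc d), imC (pc d)))).
  congr E; apply: P3_eq; rewrite /pt /d /add3 /sub3 /mk3 /ps /pz /pc /=;
  by apply: complex_eqP; rewrite ?reCD ?imCD ?reCN ?imCN /reC /imC /=; ring.
by apply; split; [split|]; exact: sqE.
Qed.

End TubeBound.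

Section Hartogs.
Variable R : realType.
Local Notation C := R[i].
Local Notation P := (P3 R).
Implicit Types (f E : P -> C) (x y q : P).

(** Log-convexity with the rational weights [N / N.+1] and [1 / N.+1], expressed by powers in place
    of logarithms. *)
Lemma geometric_interpolation (X p1 p2 t C1 C2 : R) N : 0 <= X -> 0 <= p1 -> 0 <= p2 ->
  0 <= t -> X * p1 <= C1 -> X * p2 <= C2 -> t ^+ N.+1 <= p1 ^+ N * p2 -> X * t <= C1 + C2.
Proof.
move=> X0 p10 p20 t0 h1 h2 ht.
have C10 : 0 <= C1 by apply: le_trans h1; rewrite mulr_ge0.
have C20 : 0 <= C2 by apply: le_trans h2; rewrite mulr_ge0.
have Xt : 0 <= X * t by rewrite mulr_ge0.
have CC : 0 <= C1 + C2 by rewrite addr_ge0.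
rewrite -(@ler_pXn2r _ N.+1)// exprMn.
apply: (@le_trans _ _ (X ^+ N.+1 * (p1 ^+ N * p2))).
  by rewrite ler_wpM2l ?exprn_ge0.
have -> : X ^+ N.+1 * (p1 ^+ N * p2) = (X * p1) ^+ N * (X * p2).
  by rewrite exprMn exprSr; ring.
rewrite exprSr; apply: ler_pM; rewrite ?exprn_ge0 ?mulr_ge0//.
  by apply: lerXn2r; rewrite ?nnegrE ?mulr_ge0// (le_trans h1)// lerDl.
by rewrite (le_trans h2)// lerDr.
Qed.

Lemma holo_freeze_s f (s : C) y : holo_at f (mk3 s (pz y) (pc y)) ->
  holo_at (fun x => f (mk3 s (pz x) (pc x))) y.
Proof.
move=> /holo_atP[a D]; apply/holo_atP; exists (mk3 0 (pz a) (pc a)) => e e0.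
have [d [d0 H]] := D e e0; exists d; split=> // h hd.
pose k := mk3 0 (pz h) (pc h).
have kh : norm3 k <= norm3 h.
  by apply/norm3_le; split; rewrite /k /ps /pz /pc /= ?cabs0 ?norm3_ge0 ?pz_le ?pc_le.
have := H k (le_lt_trans kh hd).
have -> : add3 (mk3 s (pz y) (pc y)) k = mk3 s (pz (add3 y h)) (pc (add3 y h)).
  by apply: P3_eq; rewrite /k /add3 /mk3 /ps /pz /pc /=; ring.
have -> : dot a k = dot (mk3 0 (pz a) (pc a)) h.
  by rewrite /dot /k /mk3 /ps /pz /pc /=; ring.
by move=> /le_trans; apply; rewrite ler_wpM2l// ltW.
Qed.

Lemma holo_psum (A : P -> nat -> C) (S : P -> C) N y :
  (forall n, (n < N)%N -> holo_at (fun x => A x n) y) -> holo_at S y ->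
  holo_at (fun x => psum (A x) (S x) N) y.
Proof.
move=> hA hS; have hX n : holo_at (fun x => S x ^+ n) y.
  elim: n => [|n IH]; first by apply: (holo_at_ext ltr01 _ (holo_cst 1 y)) => ? _; rewrite expr0.
  by apply: (holo_at_ext ltr01 _ (holoM hS IH)) => ? _; rewrite exprS.
elim: N hA => [|N IH] hA.
  by apply: (holo_at_ext ltr01 _ (holo_cst 0 y)) => x _; rewrite /psum big_ord0.
apply: (holo_at_ext ltr01 (f := fun x => psum (A x) (S x) N + A x N * S x ^+ N)).
  by move=> x _; rewrite psumS.
apply: holoD; first by apply: IH => n nN; apply: hA; exact: ltnW.
by apply: holoM => //; exact: hA.
Qed.

Section Extension.
Variables (f E : P -> C) (q : P) (r rho M : R).
Hypothesis r_gt0 : 0 < r.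
Hypothesis rho_gt0 : 0 < rho.
Hypothesis rho_le : rho <= r.
Hypothesis M_ge0 : 0 <= M.
Hypothesis f_holo : forall y, ball3 q r y -> holo_at f y.
Hypothesis f_le : forall y, ball3 q r y -> cabs (f y) <= M.
Hypothesis E_holo : forall y, tube q rho y -> holo_at E y.
Hypothesis E_f : forall y, ball3 q rho y -> E y = f y.

Let sline (y : P) (w : C) : P := mk3 (ps q + w) (pz y) (pc y).

Let sline_ball y w (d : R) : tube q d y -> cabs w < d -> ball3 q d (sline y w).
Proof.
move=> [h1 h2] wr; apply/norm3_lt; rewrite /sub3 /sline /mk3 /ps /pz /pc /=.
by split => //; rewrite addrAC subrr add0r.
Qed.

Let sline_tube y w d : tube q d y -> tube q d (sline y w).
Proof. by []. Qed.

Let sline_diff g y w : holo_at g (sline y w) -> exists b, cdiff (fun w => g (sline y w)) w b.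
Proof.
move=> /holo_atP[a D].
have slE w' : sline y w' = add3 (sline y 0) (scal3 w' (e_s R)).
  by apply: P3_eq; rewrite /sline /add3 /scal3 /mk3 /ps /pz /pc /=; ring.
rewrite slE in D; have Dl := hdiff_line D.
by exists (dot a (e_s R)) => e /Dl[d [d0 H]]; exists d; split=> // h /H; rewrite -!slE.
Qed.

Let r2 : R := r / 2.
Let r2_gt0 : 0 < r2. Proof. by rewrite divr_gt0. Qed.
Let r2_lt : r2 < r. Proof. by move: r_gt0; rewrite /r2; lra. Qed.

Let coefs y : exists A : nat -> C, tube q r y ->
  (forall w, cabs w < r2 -> cconv (psum A w) (f (sline y w))) /\
  forall n, cabs (A n) * r2 ^+ n <= 2 * M.
Proof.
case: (pselect (tube q r y)) => [ty|nty]; last by exists (fun=> 0).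
have [|A [cA hA]] := @taylor_expansion R (fun w => f (sline y w)) r2 r2_gt0.
  move=> w wr; apply: sline_diff; apply: f_holo; apply: sline_ball => //.
  exact: le_lt_trans r2_lt.
exists A => _; split=> //; apply: hA => w wr; apply: f_le; apply: sline_ball => //.
by rewrite wr.
Qed.

Let A0 := projT1 (choice coefs).
(** Evaluation at [s = 0] makes the chosen coefficients depend on [(z, c)] only, by construction. *)
Let a y n := A0 (mk3 0 (pz y) (pc y)) n.

Let a_spec y : tube q r y ->
  (forall w, cabs w < r2 -> cconv (psum (a y) w) (f (sline y w))) /\
  forall n, cabs (a y n) * r2 ^+ n <= 2 * M.
Proof.
move=> ty; rewrite /a /A0; case: choice => A H /=.
exact: (H (mk3 0 (pz y) (pc y)) ty).
Qed.

Let a_le y n : tube q r y -> cabs (a y n) <= 2 * M / r2 ^+ n.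
Proof. by move=> /a_spec[_ h]; rewrite ler_pdivlMr ?exprn_gt0. Qed.

(** The coefficient is the uniform limit, as [T] tends to 0, of [f] at [ps q + T] minus its earlier
    Taylor terms, divided by [T ^+ n]. Strong induction and Weierstrass' theorem replace
    differentiation under an integral. *)
Let a_holo n y : tube q r y -> holo_at (fun x => a x n) y.
Proof.
elim/ltn_ind: n y => n IH y ty.
have [d [d0 Hd]] := open_tube ty.
pose t j : R := r2 / 2 / j.+1%:R.
have t0 j : 0 < t j by rewrite !divr_gt0.
have tr j : t j <= r2 / 2.
  have r4 : 0 <= r2 / 2 by rewrite divr_ge0// ltW.
  by rewrite /t ler_pdivrMr// ler_peMr// ler1n.
pose T j : C := ((t j)%:C)%C.
have cT j : cabs (T j) = t j by rewrite cabs_real gtr0_norm.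
have T0 j : T j != 0 by rewrite -cabs_gt0 cT.
have Tr j : cabs (T j) < r2.
  by rewrite cT (le_lt_trans (tr j))//; move: r2_gt0; lra.
pose F j x := (T j ^+ n)^-1 * (f (sline x (T j)) - psum (a x) (T j) n).
have FH j x : norm3 (sub3 x y) < d -> holo_at (F j) x.
  move=> xd; have tx := Hd _ xd; apply: holoZ; apply: holoB.
    apply: holo_freeze_s; apply: f_holo; apply: sline_ball => //.
    exact: lt_trans (Tr j) r2_lt.
  by apply: holo_psum; [move=> k kn; exact: IH|exact: holo_cst].
have yd : norm3 (sub3 y y) < d by rewrite norm3_sub_self.
have [B HB] := choice (fun j => (holo_atP (F j) y).1 (FH j y yd)).
have [||b [Db _]] := @weierstrass R F B (fun x => a x n) y d d0 FH; last first.
- by apply/holo_atP; exists b.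
- exact: HB.
move=> e e0; pose K := 4 * M / r2 ^+ n.+1.
have rn : 0 < r2 ^+ n.+1 by rewrite exprn_gt0.
have K0 : 0 <= K by rewrite divr_ge0 ?mulr_ge0// ltW.
have K1 : 0 < K + 1 by rewrite ltr_wpDl.
exists (Num.Def.trunc (r2 / 2 * (K + 1) / e)) => j x hj xd.
have tj : t j * (K + 1) < e.
  have : r2 / 2 * (K + 1) / e < j.+1%:R.
    by apply: lt_le_trans (truncnS_gt _) _; rewrite ler_nat.
  rewrite ltr_pdivrMr// => h.
  by rewrite /t mulrAC ltr_pdivrMr// [ltRHS]mulrC.
have [ca ha] := a_spec (Hd _ xd).
have M20 : 0 <= 2 * M by rewrite mulr_ge0.
have tl := @psum_lim_tail R (a x) (T j) r2 (2 * M) n.+1 _ r2_gt0 M20 ha.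
have {}tl := tl _ _ (ca _ (Tr j)); rewrite cT in tl.
have -> : F j x - a x n = (T j ^+ n)^-1 * (f (sline x (T j)) - psum (a x) (T j) n.+1).
  by rewrite /F psumS opprD addrA [in RHS]mulrBr mulrCA mulVf ?expf_neq0// mulr1.
have tn : 0 < t j ^+ n by rewrite exprn_gt0.
rewrite cabsM cabsV cabsX cT mulrC ler_pdivrMr//.
apply: le_trans (tl (tr j)) _.
have -> : 2 * (2 * M) * (t j / r2) ^+ n.+1 = t j * K * t j ^+ n.
  by rewrite /K expr_div_n [t j ^+ n.+1]exprS; ring.
rewrite ler_pM2r// ltW// (le_lt_trans _ tj)// ler_pM2l// lerDl//.
Qed.

(** Over the small bidisc [E] is entire in [s], so Cauchy bounds hold at every radius [S];
    uniqueness of expansions transfers them to [a]. The third of [rho] comes from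
    [holo_tube_bounded]. *)
Let a_le_tube (S : R) : 0 < S -> exists K : R, 0 <= K /\
  forall y n, tube q (rho / 3) y -> cabs (a y n) * S ^+ n <= K.
Proof.
move=> S0; have [M' HM] := holo_tube_bounded S rho_gt0 E_holo.
exists (2 * `|M'|); split; first by rewrite mulr_ge0.
move=> y n ty3.
have rho3 : rho / 3 <= rho by move: rho_gt0; lra.
have ty := tube_le rho3 ty3.
have [|B [cB hB]] := @taylor_expansion R (fun w => E (sline y w)) S S0.
  by move=> w _; apply: sline_diff; apply: E_holo; exact: sline_tube.
have {}hB : forall n, cabs (B n) * S ^+ n <= 2 * `|M'|.
  apply: hB => w wS; apply: le_trans (ler_norm _).
  have [h1 h2] := ty3; apply: HM; rewrite /sline /ps /pz /pc /=.
  - by rewrite addrAC subrr add0r wS.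
  - exact: ltW.
  - exact: ltW.
have [ca ha] := a_spec (tube_le rho_le ty).
pose d := Num.min (Num.min S r2) rho.
have d0 : 0 < d by rewrite !lt_min S0 r2_gt0 rho_gt0.
rewrite (@psum_unique R (a y) B (fun w => f (sline y w)) r2 S (2 * M) (2 * `|M'|) d)//.
- by move=> w; rewrite !lt_min => /andP[/andP[_ wr] _]; exact: ca.
- move=> w; rewrite !lt_min => /andP[/andP[wS _] wrho].
  by rewrite -E_f; [exact: cB|exact: sline_ball].
Qed.

(* Hartogs' lemma: the Taylor coefficients in [s] satisfy the bound [r2 ^- n] on
   the large bidisc and every bound [S ^- n] on a small one, hence, by
   log-convexity applied to their own expansions along complex lines through
   [q], every bound [S ^- n] on the intermediate bidisc. *)
Let a_le_large (S : R) : 0 < S -> exists K : R, 0 <= K /\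
  forall y n, tube q (r / 8) y -> cabs (a y n) * S ^+ n <= K.
Proof.
move=> S0; pose l0 := rho / r.
have l00 : 0 < l0 by rewrite divr_gt0.
(* The interpolation weights: [N0] ensures [2 ^+ N0.+1 <= 4 ^+ N0 * l0], so radius 2 lies below the
   weighted mean of the radii 4 and [l0]. *)
have [N0 HN0] : exists N, (2^-1 : R) ^+ N < l0 / 2.
  by apply: half_pow_small; rewrite divr_gt0.
have N2 : 2 <= 2 ^+ N0 * l0.
  have p2 : 0 < (2 : R) ^+ N0 by rewrite exprn_gt0.
  by move: HN0; rewrite exprVn ltr_pdivlMr// mulrC ltr_pdivrMr// mulrC => /ltW.
(* [Q] is the radius in [s] that the small bidisc must supply for the weighted mean of [r2] and [Q]
   to be [S]. *)
have [Q [Q0 QE]] : exists Q : R, 0 < Q /\ r2 ^+ N0 * Q = S ^+ N0.+1.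
  exists (S ^+ N0.+1 / r2 ^+ N0); rewrite divr_gt0 ?exprn_gt0//; split=> //.
  by rewrite mulrCA divff ?mulr1// expf_neq0// gt_eqF.
have [K [K0 HK]] := a_le_tube Q0.
exists (2 * (2 * (2 * M) + 2 * K)); split; first by rewrite mulr_ge0// addr_ge0 ?mulr_ge0.
move=> y n ty.
pose v : P := mk3 0 (pz y - pz q) (pc y - pc q).
have [vz vc] := ty.
have vt (l : C) (c d : R) : cabs l <= c -> 0 <= c -> c * (r / 8) < d -> tube q d (add3 q (scal3 l v)).
  move=> lc c0 cd; split; rewrite /add3 /scal3 /v /mk3 /pz /pc /= addrAC subrr add0r cabsM.
    by apply: le_lt_trans cd; rewrite ler_pM ?cabs_ge0// ltW.
  by apply: le_lt_trans cd; rewrite ler_pM ?cabs_ge0// ltW.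
(* The target [y] is at [l = 1]. Since [y] is within [r / 8], radius 4 stays in the large bidisc and
   radius [l0] in the small one; the interpolated bound at radius 2 controls the series at modulus
   1. *)
pose phi (l : C) := a (add3 q (scal3 l v)) n.
have phid l c d : cabs l <= c -> 0 <= c -> c * (r / 8) < d -> d <= r -> exists b, cdiff phi l b.
  move=> lc c0 cd dr; have /holo_atP[b Db] := a_holo n (tube_le dr (vt l c d lc c0 cd)).
  by exists (dot b v); exact: hdiff_line Db.
have r20 : 0 < r2 ^+ n by rewrite exprn_gt0.
have [|B [cB hB]] := @taylor_expansion R phi 4 (ltr0n R 4).
  by move=> l l4; apply: (phid l 4 r) => //; move: r_gt0; lra.
have {}hB : forall m, cabs (B m) * 4 ^+ m <= 2 * (2 * M / r2 ^+ n).
  apply: hB => l l4; apply: a_le; apply: (vt l 4 r); rewrite ?l4//; move: r_gt0; lra.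
have lr : l0 * (r / 8) < rho / 3.
  rewrite /l0; have -> : rho / r * (r / 8) = rho / 8 by field; rewrite gt_eqF.
  by move: rho_gt0; lra.
have [|D [cD hD]] := @taylor_expansion R phi l0 l00.
  move=> l ll; apply: (phid l l0 (rho / 3)) => //; first exact: ltW.
  by move: rho_le rho_gt0; lra.
have {}hD : forall m, cabs (D m) * l0 ^+ m <= 2 * (K / Q ^+ n).
  apply: hD => l ll; rewrite ler_pdivlMr ?exprn_gt0//; apply: HK.
  by apply: (vt l l0) => //; rewrite ?ll// ltW.
have BD : B =1 D.
  have l4 : 0 < Num.min 4 l0 by rewrite lt_min l00 ltr0n.
  apply: (@psum_unique R B D phi 4 l0 _ _ (Num.min 4 l0) _ _ _ hB hD) => //.
  - by move=> z; rewrite lt_min => /andP[z4 _]; exact: cB.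
  - by move=> z; rewrite lt_min => /andP[_ zl]; exact: cD.
have Sn : 0 < S ^+ n by rewrite exprn_gt0.
have Qn : 0 < Q ^+ n by rewrite exprn_gt0.
have hX m : cabs (B m) * 2 ^+ m <= (2 * (2 * M) + 2 * K) / S ^+ n.
  rewrite ler_pdivlMr// -mulrA.
  apply: (@geometric_interpolation _ (4 ^+ m * r2 ^+ n) (l0 ^+ m * Q ^+ n) _ _ _ N0).
  - exact: cabs_ge0.
  - by rewrite mulr_ge0 ?exprn_ge0 ?(ltW r2_gt0).
  - by rewrite mulr_ge0 ?exprn_ge0 ?(ltW Q0) ?(ltW l00).
  - by rewrite mulr_ge0 ?exprn_ge0 ?(ltW S0).
  - by rewrite mulrA -ler_pdivlMr// -mulrA.
  - by rewrite mulrA -ler_pdivlMr// BD -mulrA.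
  rewrite [in leLHS]exprMn [in leRHS]exprMn.
  have -> : (4 ^+ m) ^+ N0 * (r2 ^+ n) ^+ N0 * (l0 ^+ m * Q ^+ n) =
      (4 ^+ N0 * l0) ^+ m * (r2 ^+ N0 * Q) ^+ n.
    by rewrite !exprMn -!exprM ![(_ * N0)%N]mulnC; ring.
  rewrite QE.
  rewrite -!exprM [(m * _)%N]mulnC [(n * _)%N]mulnC !exprM.
  have p1 : (0 : R) <= 2 ^+ N0.+1 by rewrite exprn_ge0.
  have p2 : 2 ^+ N0.+1 <= 4 ^+ N0 * l0.
    have -> : (4 : R) = 2 * 2 by ring.
    by rewrite exprS exprMn -mulrA mulrC ler_pM2l// exprn_gt0.
  have p3 : 0 <= (S ^+ N0.+1) ^+ n by rewrite !exprn_ge0// ltW.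
  apply: ler_pM; [exact: exprn_ge0|exact: p3| |exact: lexx].
  by apply: lerXn2r => //; rewrite nnegrE // (le_trans p1).
have KK : 0 <= (2 * (2 * M) + 2 * K) / S ^+ n.
  by rewrite divr_ge0 ?addr_ge0 ?mulr_ge0// ltW.
have -> : a y n = phi 1.
  by rewrite /phi /a /v /add3 /scal3 /mk3 /pz /pc /= !mul1r ![_ + (_ - _)]addrC !subrK.
have h12 : cabs (1 : C) <= 2 / 2 by rewrite cabs1; lra.
have h14 : cabs (1 : C) < 4 by rewrite cabs1; lra.
have := @psum_lim_tail R B 1 2 _ 0%N _ (ltr0n R 2) KK hX h12 (cB 1 h14).
rewrite /psum big_ord0 subr0 expr0 mulr1 => h.
by rewrite -ler_pdivlMr// -mulrA.
Qed.

Let limits y : exists l, tube q (r / 8) y -> cconv (psum (a y) (ps y - ps q)) l.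
Proof.
case: (pselect (tube q (r / 8) y)) => [ty|nty]; last by exists 0.
have S0 : 0 < 2 * (cabs (ps y - ps q) + 1) by rewrite mulr_gt0// ltr_wpDl ?cabs_ge0.
have [K [K0 HK]] := a_le_large S0.
have [|l hl] := @psum_converges R (a y) (ps y - ps q) _ K S0 K0 (fun n => HK y n ty).
  by have := cabs_ge0 (ps y - ps q); lra.
by exists l.
Qed.

(** The extension is the Taylor series in [s] about [ps q]; bounds at every radius [S], uniform over
    the bidisc, make it converge locally uniformly for all [s]. *)
Lemma hartogs_extension : exists E' : P -> C,
  (forall y, tube q (r / 8) y -> holo_at E' y) /\
  (forall y, ball3 q (r / 8) y -> E' y = f y).
Proof.
have [E' HE'] := choice limits; exists E'.
have r8 : r / 8 < r2 by move: r_gt0; rewrite /r2; lra.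
have r8r : r / 8 <= r by rewrite ltW// (lt_trans r8).
split=> y hy; last first.
  have ty : tube q (r / 8) y by exact: ball3_tube.
  have /norm3_lt[sy _ _] := hy.
  have [ca _] := a_spec (tube_le r8r ty).
  have -> : f y = f (sline y (ps y - ps q)).
    by congr f; apply: P3_eq; rewrite /sline /mk3 /ps /pz /pc /= ?[y.1.1 - _]addrC ?addrA ?subrr ?add0r.
  apply: cconv_unique (HE' y ty) (ca _ _); exact: lt_trans sy r8.
have [d [d0 Hd]] := open_tube hy.
(* All points within distance 1 of [y] have [s] within [S / 4] of the centre, well inside the half
   disc of the tail estimate. *)
pose S := 2 * (cabs (ps y - ps q) + 1) * 2.
have S0 : 0 < S by rewrite !mulr_gt0// ltr_wpDl ?cabs_ge0.
have [K [K0 HK]] := a_le_large S0.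
pose d' := Num.min d 1.
have d'0 : 0 < d' by rewrite lt_min d0 ltr01.
pose F N x := psum (a x) (ps x - ps q) N.
have FH N x : norm3 (sub3 x y) < d' -> holo_at (F N) x.
  rewrite lt_min => /andP[xd _]; apply: holo_psum.
    by move=> n _; apply: a_holo; apply: tube_le r8r _; exact: Hd.
  by apply: holoB; [exact: holo_ps|exact: holo_cst].
have yd : norm3 (sub3 y y) < d' by rewrite norm3_sub_self.
have [B HB] := choice (fun N => (holo_atP (F N) y).1 (FH N y yd)).
have [||b [Db _]] := @weierstrass R F B E' y d' d'0 FH; last first.
- by apply/holo_atP; exists b.
- exact: HB.
move=> e e0; have K1 : 0 < 2 * K + 1 by rewrite ltr_wpDl// mulr_ge0.
have [N HN] := half_pow_small (divr_gt0 e0 K1).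
exists N => n x Nn; rewrite lt_min => /andP[xd x1].
have tx := Hd _ xd.
have sx : cabs (ps x - ps q) <= S / 4.
  apply: le_trans (cabs_dist _ (ps y) _) _.
  have /norm3_lt[h _ _] := x1; have {}h : cabs (ps x - ps y) < 1 by exact: h.
  by rewrite /S; lra.
have sx2 : cabs (ps x - ps q) <= S / 2 by lra.
have := psum_lim_tail n S0 K0 (fun n => HK x n tx) sx2 (HE' x tx).
rewrite cabsBC => h; apply: le_trans h _.
have p0 : (0 : R) <= 2^-1 ^+ N by rewrite exprn_ge0.
have : (cabs (ps x - ps q) / S) ^+ n <= 2^-1 ^+ N.
  apply: (@le_trans _ _ (2^-1 ^+ n)).
    apply: lerXn2r; rewrite ?nnegrE ?divr_ge0 ?cabs_ge0 ?(ltW S0) ?invr_ge0//.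
    by rewrite ler_pdivrMr//; lra.
  by rewrite ler_wiXn2l ?invr_ge0// invf_le1// ler1n.
move: HN; rewrite ltr_pdivlMr//; set u := _ ^+ n; set w := _ ^+ N => h1 h2.
have : 2 * K * u <= 2 * K * w by rewrite ler_wpM2l// mulr_ge0.
have : w * (2 * K + 1) = 2 * K * w + w by ring.
by have : 0 <= w by []; lra.
Qed.

End Extension.
End Hartogs.

(** * Continuation of the difference equations along paths *)

Section Continuation.
Variable R : realType.
Local Notation C := R[i].
Local Notation P := (P3 R).
Implicit Types (f g E : P -> C) (x y p q : P) (U : P -> Prop).

Lemma sub_es y : sub3 y (e_s R) = add3 y (scal3 (-1) (e_s R)).
Proof. by apply: P3_eq; rewrite /add3 /sub3 /scal3 /mk3 /ps /pz /pc /=; ring. Qed.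

Lemma tube_add_s p (r : R) y (w : C) :
  tube p r y -> tube p r (add3 y (scal3 w (e_s R))).
Proof.
by rewrite /tube /add3 /scal3 /mk3 /pz /pc /= !mulr0 !addr0.
Qed.

Lemma tube_sub_es p (r : R) y : tube p r y -> tube p r (sub3 y (e_s R)).
Proof. by rewrite sub_es; exact: tube_add_s. Qed.

Lemma tube_add_es p (r : R) y : tube p r y -> tube p r (add3 y (e_s R)).
Proof. by rewrite /tube /add3 /mk3 /pz /pc /= !addr0. Qed.

Definition dd_minus_on E U := forall y, U y ->
  pz y * dpart E (e_z R) y + pc y * E y = E (sub3 y (e_s R)).

Definition dd_plus_on E U := forall y, U y ->
  dpart E (e_c R) y = - ps y * E (add3 y (e_s R)).

Definition lerch_on E U :=
  [/\ forall y, U y -> holo_at E y, dd_minus_on E U & dd_plus_on E U].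

Lemma lerch_onW E U V : (forall y, V y -> U y) -> lerch_on E U -> lerch_on E V.
Proof. by move=> VU [h1 h2 h3]; split=> y /VU; [exact: h1|exact: h2|exact: h3]. Qed.

Lemma dpart_near f g v y (r : R) : 0 < r -> holo_at f y ->
  (forall x, ball3 y r x -> f x = g x) -> dpart f v y = dpart g v y.
Proof.
move=> r0 hf fg; symmetry; apply: dpartE.
by apply: is_pderiv_ext r0 fg _; exact: dpartP.
Qed.

(** Stability of [U] under shifts makes both sides of each equation holomorphic on [U], so the
    identity principle spreads them from a small ball. *)
Lemma lerch_on_ext E q U (d : R) : open3 U -> starshaped q U -> U q ->
  (forall y, U y -> U (sub3 y (e_s R))) -> (forall y, U y -> U (add3 y (e_s R))) ->
  (forall y, U y -> holo_at E y) -> 0 < d ->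
  dd_minus_on E (ball3 q d) -> dd_plus_on E (ball3 q d) -> lerch_on E U.
Proof.
move=> oU sU Uq Um Up hE d0 hm hp.
have hd v : norm3 v <= 1 -> forall y, U y -> holo_at (dpart E v) y.
  move=> v1 y Uy; have [r [r0 Hr]] := oU y Uy.
  by apply: (holo_dpart r0 v1) => k /Hr; exact: hE.
split=> // y Uy.
- apply: (identity_principle2 (f := fun y => pz y * dpart E (e_z R) y + pc y * E y)
    (g := fun y => E (sub3 y (e_s R))) oU sU _ _ d0 hm Uy) => k Uk.
    apply: holoD; apply: holoM; rewrite ?norm3_ez//.
    - exact: holo_pz.
    - by apply: hd => //; rewrite norm3_ez.
    - exact: holo_pc.
    - exact: hE.
  apply: (holo_at_ext (f := fun y => E (add3 y (scal3 (-1) (e_s R)))) ltr01).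
    by move=> z _; rewrite sub_es.
  by apply: holo_translate; rewrite -sub_es; apply: hE; exact: Um.
- apply: (identity_principle2 (f := dpart E (e_c R))
    (g := fun y => - ps y * E (add3 y (e_s R))) oU sU _ _ d0 hp Uy) => k Uk.
    by apply: hd => //; rewrite norm3_ec.
  apply: holoM; last by apply: holo_translate; apply: hE; exact: Up.
  apply: (holo_at_ext (f := fun y => (-1) * ps y) ltr01).
    by move=> z _; ring.
  by apply: holoZ; exact: holo_ps.
Qed.

(** The new radius [r / 8] depends on the polydisc of [f] only, however small [rho] was; this is
    what [unit_interval_induction] demands. *)
Lemma lerch_transport f E q (r rho M : R) : 0 < r -> 0 < rho -> 0 <= M ->
  (forall y, ball3 q r y -> holo_at f y) -> (forall y, ball3 q r y -> cabs (f y) <= M) ->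
  lerch_on E (tube q rho) -> (forall y, ball3 q rho y -> E y = f y) ->
  exists E', lerch_on E' (tube q (r / 8)) /\ forall y, ball3 q (r / 8) y -> E' y = f y.
Proof.
move=> r0 rho0 M0 hf fM LE Ef.
pose rh := Num.min rho r.
have rh0 : 0 < rh by rewrite lt_min rho0.
have rh_rho : rh <= rho by rewrite ge_min lexx.
have rh_r : rh <= r by rewrite ge_min lexx orbT.
have [hE hm hp] := lerch_onW (fun y => tube_le rh_rho (y := y)) LE.
have [E' [hE' E'f]] := hartogs_extension r0 rh0 rh_r M0 hf fM hE
  (fun y hy => Ef y (ball3_le rh_rho hy)).
exists E'; split=> //.
pose d := Num.min rh (r / 8).
have d0 : 0 < d by rewrite lt_min rh0 divr_gt0.
have d_rh : d <= rh by rewrite ge_min lexx.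
have d_r : d <= r / 8 by rewrite ge_min lexx orbT.
have qd e : 0 < e -> tube q e q by move=> e0; apply: ball3_tube; exact: ball3_self.
(* Equality is needed on a whole tube, since the equations evaluate [E'] at shifted points that lie
   far outside the ball. *)
have EE y : tube q d y -> E' y = E y.
  apply: (identity_principle2 (f := E') (g := E) (@open_tube _ q d) (star_tube (qd d d0)) _ _ d0).
  - by move=> k /(tube_le d_r); exact: hE'.
  - by move=> k /(tube_le d_rh); exact: hE.
  - move=> k kd; rewrite E'f; last exact: ball3_le kd.
    by rewrite Ef//; apply: ball3_le kd; exact: le_trans rh_rho.
have r80 : 0 < r / 8 by rewrite divr_gt0.
have dp v y : ball3 q d y -> dpart E' v y = dpart E v y.
  move=> /ball3_tube ty; have [e [e0 He]] := open_tube ty.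
  apply: (dpart_near _ e0); first by apply: hE'; exact: tube_le ty.
  by move=> x /He; exact: EE.
apply: (@lerch_on_ext _ q _ d) => //.
- exact: open_tube.
- by apply: star_tube; exact: qd.
- exact: qd.
- by move=> y; exact: tube_sub_es.
- by move=> y; exact: tube_add_es.
- move=> y yd; have ty := ball3_tube yd; rewrite dp// !EE//; last exact: tube_sub_es.
  by apply: hm; exact: tube_le ty.
- move=> y yd; have ty := ball3_tube yd; rewrite dp// !EE//; last exact: tube_add_es.
  by apply: hp; exact: tube_le ty.
Qed.

Definition path_cont (g : R -> P) := forall t, 0 <= t <= 1 -> forall eps : R, 0 < eps ->
  exists del : R, 0 < del /\ forall t', 0 <= t' <= 1 -> `|t' - t| < del ->
    norm3 (sub3 (g t') (g t)) < eps.

Definition eq_near p f g := exists rho : R, 0 < rho /\ forall y, ball3 p rho y -> f y = g y.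

(** The part of [cont_along] that survives restriction to a piece of a path: it does not prescribe
    the germ at the start. *)
Definition chain (g : R -> P) (f : R -> P -> C) (r : R -> R) :=
  (forall t, 0 <= t <= 1 -> 0 < r t /\ forall y, ball3 (g t) (r t) y -> holo_at (f t) y) /\
  (forall t, 0 <= t <= 1 -> exists del : R, 0 < del /\
     forall t', 0 <= t' <= 1 -> `|t' - t| < del -> eq_near (g t') (f t) (f t')).

Lemma eq_near_sym p f g : eq_near p f g -> eq_near p g f.
Proof. by case=> r [r0 H]; exists r; split=> // y /H. Qed.

Lemma eq_near_trans p f g h : eq_near p f g -> eq_near p g h -> eq_near p f h.
Proof.
case=> r [r0 H] [s [s0 K]]; exists (Num.min r s); split; first by rewrite lt_min r0.
by move=> y; rewrite /ball3 lt_min => /andP[/H -> /K].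
Qed.

Lemma eq_nearB p f1 f2 g1 g2 : eq_near p f1 g1 -> eq_near p f2 g2 ->
  eq_near p (fun y => f1 y - f2 y) (fun y => g1 y - g2 y).
Proof.
case=> r [r0 H] [s [s0 K]]; exists (Num.min r s); split; first by rewrite lt_min r0.
by move=> y; rewrite /ball3 lt_min => /andP[/H -> /K ->].
Qed.

Lemma chain_propagate (g : R -> P) (f : R -> P -> C) r : path_cont g -> chain g f r ->
  (exists rho E, [/\ 0 < rho, lerch_on E (tube (g 0) rho) &
     forall y, ball3 (g 0) rho y -> E y = f 0 y]) ->
  exists rho E, [/\ 0 < rho, lerch_on E (tube (g 1) rho) &
     forall y, ball3 (g 1) rho y -> E y = f 1 y].
Proof.
move=> cg [hf hc] H0.
pose Q t := exists rho E, [/\ 0 < rho, lerch_on E (tube (g t) rho) &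
     forall y, ball3 (g t) rho y -> E y = f t y].
apply: (@unit_interval_induction R Q H0); last by rewrite ler01 lexx.
move=> t t01; have [r0 Hr] := hf t t01.
have [r1 [M [r10 M0 HM]]] := holo_bounded (Hr _ (ball3_self _ r0)).
pose s := Num.min (r t) r1.
have s0 : 0 < s by rewrite lt_min r0.
(* Transport from the ball of radius [s / 2] about [g t1] gives a tube of radius [s / 16]; as [g t2]
   is within [s / 32] of [g t1], a tube of radius [s / 32] about [g t2] remains. *)
have s64 : 0 < s / 64 by rewrite divr_gt0.
have [d1 [d10 H1]] := cg t t01 _ s64; have [d2 [d20 H2]] := hc t t01.
exists (Num.min d1 d2); split; first by rewrite lt_min d10.
move=> t1 t2 t101 t201; rewrite !lt_min => /andP[h1 k1] /andP[h2 k2].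
have {}h1 : ball3 (g t) (s / 64) (g t1) by exact: H1.
have {}h2 : ball3 (g t) (s / 64) (g t2) by exact: H1.
have [e1 [e10 E1]] := H2 t1 t101 k1; have [e2 [e20 E2]] := H2 t2 t201 k2.
case=> rho [E [rho0 LE Ef]].
have bs y : ball3 (g t1) (s / 2) y -> ball3 (g t) s y.
  by move=> h; apply: ball3_le (ball3_dist h1 h); lra.
pose rh := Num.min rho e1.
have rh0 : 0 < rh by rewrite lt_min rho0.
have rh_rho : rh <= rho by rewrite ge_min lexx.
have rh_e1 : rh <= e1 by rewrite ge_min lexx orbT.
have [|||||E' [LE' E'f]] := @lerch_transport (f t) E (g t1) (s / 2) rh M _ rh0 M0.
- by rewrite divr_gt0.
- by move=> y /bs h; apply: Hr; apply: ball3_le h; rewrite ge_min lexx.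
- by move=> y /bs h; apply: HM; apply: lt_le_trans h _; rewrite ge_min lexx orbT.
- exact: lerch_onW (fun y => tube_le rh_rho (y := y)) LE.
- move=> y h; rewrite Ef; last exact: ball3_le h.
  by rewrite E1//; exact: ball3_le h.
have h12 : ball3 (g t1) (s / 32) (g t2).
  by apply: ball3_le (ball3_dist (ball3_sym h1) h2); lra.
exists (Num.min (s / 32) e2), E'; split.
- by rewrite lt_min e20 andbT divr_gt0.
- apply: lerch_onW LE' => y; rewrite /tube !lt_min => -[/andP[a1 _] /andP[a2 _]].
  have : tube (g t1) (s / 32 + s / 32) y by apply: tube_dist; [exact: ball3_tube h12|split].
  by apply: tube_le; lra.
- move=> y; rewrite /ball3 lt_min => /andP[b1 b2].
  rewrite -E2// E'f//; have := ball3_dist h12 b1.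
  by apply: ball3_le; lra.
Qed.

(** Near [g t1] the functions [f1 t] and [f2 t] inherit the equality known at [t1], and the identity
    principle carries it over a ball that contains [g t2]. *)
Lemma chain_unique (g : R -> P) (f1 f2 : R -> P -> C) r1 r2 : path_cont g -> chain g f1 r1 -> chain g f2 r2 ->
  eq_near (g 0) (f1 0) (f2 0) -> eq_near (g 1) (f1 1) (f2 1).
Proof.
move=> cg [hf1 hc1] [hf2 hc2] H0.
apply: (@unit_interval_induction R (fun t => eq_near (g t) (f1 t) (f2 t)) H0); last first.
  by rewrite ler01 lexx.
move=> t t01; have [r10 Hr1] := hf1 t t01; have [r20 Hr2] := hf2 t t01.
pose s := Num.min (r1 t) (r2 t).
have s0 : 0 < s by rewrite lt_min r10.
have s8 : 0 < s / 8 by rewrite divr_gt0.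
have [d [d0 H]] := cg t t01 _ s8.
have [d1 [d10 H1]] := hc1 t t01; have [d2 [d20 H2]] := hc2 t t01.
exists (Num.min d (Num.min d1 d2)); split; first by rewrite !lt_min d0 d10.
move=> t1 t2 t101 t201; rewrite !lt_min => /andP[h1 /andP[k1 l1]] /andP[h2 /andP[k2 l2]] Q1.
have {}h1 : ball3 (g t) (s / 8) (g t1) by exact: H.
have {}h2 : ball3 (g t) (s / 8) (g t2) by exact: H.
have bs y : ball3 (g t1) (s / 2) y -> ball3 (g t) s y.
  by move=> h; apply: ball3_le (ball3_dist h1 h); lra.
have [e [e0 He]] : eq_near (g t1) (f1 t) (f2 t).
  apply: eq_near_trans (H1 t1 t101 k1) _; apply: eq_near_trans Q1 _.
  exact: eq_near_sym (H2 t1 t101 l1).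
have eqb y : ball3 (g t1) (s / 2) y -> f1 t y = f2 t y.
  apply: (identity_principle2 (@open_ball3 _ (g t1) (s / 2)) (@star_ball3 _ (g t1) (s / 2)) _ _ e0 He).
  - by move=> k /bs h; apply: Hr1; apply: ball3_le h; rewrite ge_min lexx.
  - by move=> k /bs h; apply: Hr2; apply: ball3_le h; rewrite ge_min lexx orbT.
apply: eq_near_trans (eq_near_sym (H1 t2 t201 k2)) _.
apply: eq_near_trans _ (H2 t2 t201 l2).
exists (s / 8); split=> // y h; apply: eqb.
by apply: ball3_le (ball3_dist (ball3_dist (ball3_sym h1) h2) h); lra.
Qed.

(** The constant 1 allows [chain_reparam] to keep the same [del]. The map need not be onto, so
    restriction to a subpath is included. *)
Definition unit_lipschitz (phi : R -> R) :=
  (forall t, 0 <= t <= 1 -> 0 <= phi t <= 1) /\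
  (forall t t', `|phi t - phi t'| <= `|t - t'|).

Lemma chain_reparam (g g' : R -> P) (f : R -> P -> C) r (phi : R -> R) : unit_lipschitz phi ->
  (forall t, 0 <= t <= 1 -> g (phi t) = g' t) -> chain g f r ->
  chain g' (fun t => f (phi t)) (fun t => r (phi t)).
Proof.
move=> [phi01 phiL] gE [hf hc]; split=> t t01.
  by rewrite -gE//; exact/hf/phi01.
have [d [d0 H]] := hc _ (phi01 t t01); exists d; split=> // t' t'01 tt'.
rewrite -gE//; apply: H; first exact: phi01.
exact: le_lt_trans (phiL _ _) tt'.
Qed.

Lemma cont_along_chain (g : R -> P) (f : R -> P -> C) r : cont_along g f r -> chain g f r.
Proof.
move=> [h1 [h2 _]]; split=> t t01; first by have [r0 [_ H]] := h1 t t01.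
have [d [d0 H]] := h2 t t01; exists d; split=> // t' t'01 tt'.
by have [_ [rho [rho0 Hr]]] := H t' t'01 tt'; exists rho.
Qed.

Definition s_leg p (d : C) (u : R) : P := add3 p (mk3 ((u +i* 0)%C * d) 0 0).

Lemma s_leg_cont p d : path_cont (s_leg p d).
Proof.
move=> t t01 e e0; have K0 : 0 < cabs d + 1 by rewrite ltr_wpDl ?cabs_ge0.
exists (e / (cabs d + 1)); split; first by rewrite divr_gt0.
move=> t' _; rewrite ltr_pdivlMr// => h; apply/norm3_lt.
rewrite /s_leg /add3 /sub3 /mk3 /ps /pz /pc /= !addr0 !subrr cabs0 e0.
split=> //.
have -> : p.1.1 + (t' +i* 0)%C * d - (p.1.1 + (t +i* 0)%C * d) = ((t' - t)%:C)%C * d.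
  by rewrite !complexr0 rmorphB; ring.
rewrite cabsM cabs_real; apply: le_lt_trans h.
by rewrite ler_wpM2l// lerDl.
Qed.

Lemma s_leg_tube p d u (r : R) y : ball3 (s_leg p d u) r y -> tube p r y.
Proof.
move=> /ball3_tube; rewrite /tube /s_leg /add3 /mk3 /pz /pc /= !addr0//.
Qed.

(** The constant family is a continuation along the segment, because every ball of radius [rho]
    about it lies in the tube. *)
Lemma chain_s_leg E p d (rho : R) : 0 < rho ->
  (forall y, tube p rho y -> holo_at E y) -> chain (s_leg p d) (fun=> E) (fun=> rho).
Proof.
move=> rho0 hE; split=> t t01; first by split=> // y /s_leg_tube; exact: hE.
by exists 1; split=> // t' _ _; exists 1.
Qed.

Lemma lerch_s_leg E p d (rho : R) (g : R -> P -> C) r : 0 < rho -> (forall y, tube p rho y -> holo_at E y) ->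
  chain (s_leg p d) g r -> eq_near p E (g 0) -> eq_near (s_leg p d 1) E (g 1).
Proof.
move=> rho0 hE cg H; apply: (chain_unique (@s_leg_cont p d) (chain_s_leg d rho0 hE) cg).
have -> // : s_leg p d 0 = p.
apply: P3_eq; rewrite /s_leg /add3 /mk3 /ps /pz /pc /= ?addr0//.
have -> : (0 +i* 0)%C = 0 :> C by [].
by rewrite mul0r addr0.
Qed.

Lemma pconcat_cont (g h : R -> P) : path_cont g -> path_cont h -> g 1 = h 0 ->
  path_cont (pconcat g h).
Proof.
move=> cg ch gh t /andP[t0 t1] e e0.
have left : t <= 2^-1 -> exists del : R, 0 < del /\
   forall t', 0 <= t' <= 2^-1 -> `|t' - t| < del -> norm3 (sub3 (g (2 * t')) (g (2 * t))) < e.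
  move=> th; have [|d [d0 H]] := cg (2 * t) _ e e0; first by lra.
  exists (d / 2); split; first by rewrite divr_gt0.
  move=> s /andP[s0 s1] st; apply: H; first by lra.
  by rewrite -mulrBr normrM gtr0_norm//; lra.
have right : 2^-1 <= t -> exists del : R, 0 < del /\
   forall t', 2^-1 <= t' <= 1 -> `|t' - t| < del ->
     norm3 (sub3 (h (2 * t' - 1)) (h (2 * t - 1))) < e.
  move=> th; have [|d [d0 H]] := ch (2 * t - 1) _ e e0; first by lra.
  exists (d / 2); split; first by rewrite divr_gt0.
  move=> s /andP[s0 s1] st; apply: H; first by lra.
  have -> : 2 * s - 1 - (2 * t - 1) = 2 * (s - t) by ring.
  by rewrite normrM gtr0_norm//; lra.
have t01 : 0 <= t <= 1 by rewrite t0.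
have [tl|tr|te] := ltrgtP t 2^-1.
- have [d [d0 H]] := left (ltW tl).
  exists (Num.min d (2^-1 - t)); split; first by rewrite lt_min d0 subr_gt0.
  move=> t' /andP[t'0 t'1]; rewrite lt_min => /andP[h1 h2].
  have t'h : t' <= 2^-1 by move: h2; rewrite ltr_norml; lra.
  by rewrite /pconcat t'h (ltW tl); apply: H; rewrite ?t'0.
- have [d [d0 H]] := right (ltW tr).
  exists (Num.min d (t - 2^-1)); split; first by rewrite lt_min d0 subr_gt0.
  move=> t' /andP[t'0 t'1]; rewrite lt_min => /andP[h1 h2].
  have t'h : 2^-1 < t' by move: h2; rewrite ltr_norml; lra.
  by rewrite /pconcat !leNgt t'h tr /=; apply: H => //; rewrite (ltW t'h).
- have [|d1 [d10 H1]] := left; first by rewrite te.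
  have [|d2 [d20 H2]] := right; first by rewrite te.
  exists (Num.min d1 d2); split; first by rewrite lt_min d10.
  move=> t' /andP[t'0 t'1]; rewrite lt_min => /andP[h1 h2].
  have E0 : pconcat g h t = g (2 * t) by rewrite /pconcat te lexx.
  have E1 : pconcat g h t = h (2 * t - 1).
    by rewrite E0 te mulfV ?pnatr_eq0// subrr.
  rewrite [in pconcat g h t']/pconcat; case: ifP => t'h.
    by rewrite E0; apply: H1; rewrite ?t'0.
  rewrite E1; apply: H2 => //; rewrite t'1 andbT ltW// ltNge t'h//.
Qed.

(** A single function on a tube induces the three germs. Unlike the continuations themselves this
    form is stable under subtraction, hence applies to the monodromy. *)
Definition lerch_germs p (G Gm Gp : P -> C) := exists rho E, [/\ 0 < rho,
  lerch_on E (tube p rho), eq_near p E G, eq_near (sub3 p (e_s R)) E Gm &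
  eq_near (add3 p (e_s R)) E Gp].

Lemma lerch_germsB p G1 G2 Gm1 Gm2 Gp1 Gp2 :
  lerch_germs p G1 Gm1 Gp1 -> lerch_germs p G2 Gm2 Gp2 ->
  lerch_germs p (fun y => G1 y - G2 y) (fun y => Gm1 y - Gm2 y) (fun y => Gp1 y - Gp2 y).
Proof.
case=> r1 [E1 [r10 L1 n1 m1 p1]] [r2 [E2 [r20 L2 n2 m2 p2]]].
pose r := Num.min r1 r2.
have rr1 : r <= r1 by rewrite ge_min lexx.
have rr2 : r <= r2 by rewrite ge_min lexx orbT.
have [h1 dm1 dp1] := lerch_onW (fun y => tube_le rr1 (y := y)) L1.
have [h2 dm2 dp2] := lerch_onW (fun y => tube_le rr2 (y := y)) L2.
have dB v y : tube p r y -> dpart (fun y => E1 y - E2 y) v y = dpart E1 v y - dpart E2 v y.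
  move=> ty; have /holo_atP[a Da] := h1 y ty; have /holo_atP[b Db] := h2 y ty.
  rewrite (dpartE (hdiff_pderiv v (hdiffB Da Db))).
  by rewrite (dpartE (hdiff_pderiv v Da)) (dpartE (hdiff_pderiv v Db)) dotB.
exists r, (fun y => E1 y - E2 y); split.
- by rewrite lt_min r10.
- split=> y ty; first by apply: holoB; [exact: h1|exact: h2].
    by rewrite dB// -dm1// -dm2//; ring.
  by rewrite dB// dp1// dp2//; ring.
- exact: eq_nearB.
- exact: eq_nearB.
- exact: eq_nearB.
Qed.

Lemma eq_near_at p f g : eq_near p f g -> f p = g p.
Proof. by case=> r [r0 H]; apply: H; exact: ball3_self. Qed.

Lemma lerch_germs_equations p G Gm Gp : lerch_germs p G Gm Gp ->
  DD_minus G Gm p /\ DD_plus G Gp p /\ PDE_at G p.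
Proof.
case=> r [E [r0 [hE dm dp] nG nm np]].
have tp : tube p r p by apply: ball3_tube; exact: ball3_self.
have [e [e0 He]] := nG.
have pderG v w y (d : R) : 0 < d -> (forall x, ball3 y d x -> E x = G x) ->
    tube p r y -> is_pderiv G y v w -> w = dpart E v y.
  move=> d0 Hd ty D; symmetry; apply: dpartE; apply: is_pderiv_ext d0 _ D.
  by move=> x /Hd.
split; [|split].
- move=> w D; rewrite (pderG _ _ _ _ e0 He tp D) -(eq_near_at nG) -(eq_near_at nm).
  exact: dm.
- move=> w D; rewrite (pderG _ _ _ _ e0 He tp D) -(eq_near_at np).
  exact: dp.
move=> H rho w rho0 HH Dw.
pose d := Num.min (Num.min e r) rho.
have d0 : 0 < d by rewrite !lt_min e0 r0.
(* [H] is identified on a whole neighbourhood so that it can be differentiated in [z]; the first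
   equation is then used at [p + e_s], and its shift leads back to [p]. *)
have HE y : ball3 p d y -> H y = - ps y * E (add3 y (e_s R)).
  rewrite /ball3 !lt_min => /andP[/andP[ye yr] yrho].
  have ty : tube p r y by exact: ball3_tube.
  rewrite -dp//; have [d1 [d10 Hd1]] := open_ball3 (ye : ball3 p e y).
  apply: (pderG _ _ _ _ d10 _ ty (HH y yrho)) => x /Hd1; exact: He.
set q := add3 p (e_s R).
have tq : tube p r q by exact: tube_add_es.
have /holo_atP[a Da] := hE q tq.
have Df : hdiff (fun y => - ps y * E (add3 y (e_s R))) p
   (scal3 (-1) (add3 (scal3 (ps p) a) (scal3 (E q) (e_s R)))).
  have := hdiffZ (-1) (hdiffM (hdiff_ps p) (hdiff_translate Da)).
  apply: hdiff_ext ltr01 _ => y _; ring.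
have wE : w = - ps p * dot a (e_z R).
  apply: is_pderiv_unique Dw _; apply: (is_pderiv_ext d0 _ _).
    by move=> y yd; symmetry; apply: HE yd.
  have := hdiff_pderiv (e_z R) Df; congr is_pderiv.
  by rewrite /dot /add3 /scal3 /mk3 /e_z /e_s /ps /pz /pc /=; ring.
rewrite wE (HE _ (ball3_self _ d0)) -(eq_near_at nG).
have := dm q tq; rewrite (dpartE (hdiff_pderiv (e_z R) Da)).
have -> : sub3 q (e_s R) = p.
  by apply: P3_eq; rewrite /q /add3 /sub3 /mk3 /ps /pz /pc /=; ring.
have -> : pz q = pz p by rewrite /q /pz /= addr0.
have -> : pc q = pc p by rewrite /q /pc /= addr0.
by move=> <-; rewrite -/q; ring.
Qed.

End Continuation.

(** * The Lerch series *)

Section Logarithm.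
Variable R : realType.
Local Notation C := R[i].
Implicit Types (w z h : C).

Lemma cargP w : w != 0 ->
  [/\ cos (carg w) = reC w / cabs w, sin (carg w) = imC w / cabs w & `|carg w| <= pi].
Proof.
move=> w0; have c0 : 0 < cabs w by rewrite cabs_gt0.
have x1 : -1 <= reC w / cabs w <= 1.
  rewrite -ler_norml normrM normfV (gtr0_norm c0) ler_pdivrMr// mul1r.
  exact: cabs_re.
have co : cos (acos (reC w / cabs w)) = reC w / cabs w by rewrite acosK// in_itv.
have si : sin (acos (reC w / cabs w)) = `|imC w| / cabs w.
  have -> : `|imC w| / cabs w = Num.sqrt ((imC w / cabs w) ^+ 2).
    by rewrite sqrtr_sqr normrM normfV (gtr0_norm c0).
  rewrite sin_acos//; congr Num.sqrt; rewrite !expr_div_n.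
  have c2 : cabs w ^+ 2 = reC w ^+ 2 + imC w ^+ 2.
    by rewrite /cabs sqr_sqrtr// addr_ge0 ?sqr_ge0.
  have c20 : cabs w ^+ 2 != 0 by rewrite expf_neq0// gt_eqF.
  by rewrite -[1](divff c20) -mulrBl [in X in X / _]c2 addrAC subrr add0r.
have pl : `|acos (reC w / cabs w)| <= pi.
  by rewrite ger0_norm ?acos_ge0// acos_lepi.
rewrite /carg; case: ifP => i0; first by rewrite co si ger0_norm.
rewrite cosN sinN normrN co si ltr0_norm; first by rewrite mulNr opprK.
by rewrite ltNge i0.
Qed.

Lemma cexp_cLog w : w != 0 -> cexp (cLog w) = w.
Proof.
move=> w0; have c0 : 0 < cabs w by rewrite cabs_gt0.
have [co si _] := cargP w0.
apply: complex_eqP; rewrite ?reC_cexp ?imC_cexp /cLog {1}/reC {1}/imC /= lnK ?posrE//.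
  by rewrite co mulrC divfK// gt_eqF.
by rewrite si mulrC divfK// gt_eqF.
Qed.

(** On the right half-plane this removes the case split on the sign of the imaginary part, across
    which continuity of [carg] is not apparent. *)
Lemma carg_atan w : 0 < reC w -> carg w = atan (imC w / reC w).
Proof.
move=> r0; have w0 : w != 0.
  by apply: contraTneq r0 => ->; rewrite /reC /= ltxx.
have c0 : 0 < cabs w by rewrite cabs_gt0.
have [co si pl] := cargP w0.
have t : tan (carg w) = imC w / reC w.
  by rewrite /tan co si; field; rewrite !gt_eqF.
rewrite -t tanK// in_itv /= -ltr_norml.
have pi20 : 0 < pi / 2 :> R by rewrite divr_gt0// pi_gt0.
have pip : pi / 2 <= pi :> R by rewrite ler_pdivrMr//; have := pi_gt0 R; lra.
rewrite -(@ltr_cos R) ?in_itv /= ?normr_ge0 ?(ltW pi20)//.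
by rewrite cos_pihalf cos_norm co divr_gt0.
Qed.

Lemma cLog_continuous w : 0 < reC w -> ccontinuous_at (@cLog R) w.
Proof.
move=> r0 e e0; have e2 : 0 < e / 2 by rewrite divr_gt0.
have w0 : w != 0.
  by apply: contraTneq r0 => ->; rewrite /reC /= ltxx.
have c0 : 0 < cabs w by rewrite cabs_gt0.
have /cvgrPdist_lt/(_ _ e2)[d1 /= d10 H1] := continuous_ln c0.
have /cvgrPdist_lt/(_ _ e2)[d2 /= d20 H2] := @continuous_atan R (imC w / reC w).
(* A Lipschitz constant at [w] for the quotient [imC / reC], as long as the real part stays above
   [reC w / 2]. *)
pose K := 2 * (reC w + `|imC w|) / reC w ^+ 2.
have K0 : 0 < K by rewrite divr_gt0 ?mulr_gt0 ?exprn_gt0// ltr_pwDl.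
exists (Num.min d1 (Num.min (reC w / 2) (d2 / K))); split.
  by rewrite !lt_min d10 (divr_gt0 r0) ?(divr_gt0 d20 K0).
move=> v; rewrite !lt_min => /andP[h1 /andP[h2 h3]].
have re_d : `|reC v - reC w| <= cabs (v - w) by rewrite -reCN -reCD cabs_re.
have im_d : `|imC v - imC w| <= cabs (v - w) by rewrite -imCN -imCD cabs_im.
have rv : reC w / 2 < reC v.
  by have := le_lt_trans re_d h2; rewrite ltr_norml; lra.
have rv0 : 0 < reC v by apply: lt_trans rv; rewrite divr_gt0.
apply: le_lt_trans (cabs_le_reim _) _.
rewrite reCD imCD reCN imCN /cLog {1 2}/reC {1 2}/imC /= !carg_atan// [e]splitr.
apply: ltrD; rewrite distrC.
  by apply: H1; rewrite /= distrC; apply: le_lt_trans (cabs_lip _ _) h1.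
apply: H2; rewrite /= distrC.
have -> : imC v / reC v - imC w / reC w =
   ((imC v - imC w) * reC w - imC w * (reC v - reC w)) / (reC v * reC w).
  by field; rewrite !gt_eqF.
rewrite normrM normfV (gtr0_norm (mulr_gt0 rv0 r0)) ltr_pdivrMr ?mulr_gt0//.
apply: le_lt_trans (ler_normB _ _) _; rewrite !normrM (gtr0_norm r0).
have b1 : `|imC v - imC w| * reC w <= cabs (v - w) * reC w by rewrite ler_wpM2r// ltW.
have b2 : `|imC w| * `|reC v - reC w| <= `|imC w| * cabs (v - w) by rewrite ler_wpM2l.
apply: le_lt_trans (lerD b1 b2) _.
have {}h3 : cabs (v - w) * K < d2 by rewrite -ltr_pdivlMr.
have -> : cabs (v - w) * reC w + `|imC w| * cabs (v - w) =
    cabs (v - w) * K * (reC w / 2 * reC w) by rewrite /K; field; rewrite gt_eqF.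
apply: (@lt_le_trans _ _ (d2 * (reC w / 2 * reC w))).
  by rewrite ltr_pM2r// mulr_gt0// divr_gt0.
by rewrite ler_pM2l// ler_pM2r// ltW.
Qed.

Lemma cdiff_cexp w : cdiff (@cexp R) w (cexp w).
Proof.
move=> e e0; pose K := cabs (cexp w) * 4 * expR 1 + 1.
have K0 : 0 < K by rewrite ltr_wpDl// !mulr_ge0 ?cabs_ge0 ?expR_ge0.
exists (Num.min 1 (e / K)); split; first by rewrite lt_min ltr01 divr_gt0.
move=> h; rewrite lt_min ltr_pdivlMr// => /andP[h1 h2].
rewrite cexpD; have -> : cexp w * cexp h - cexp w - cexp w * h = cexp w * (cexp h - 1 - h) by ring.
rewrite cabsM; have := cexp_second_order h.
have : expR (cabs h) <= expR 1 by rewrite ler_expR ltW.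
have ch := cabs_ge0 h; have cw := cabs_ge0 (cexp w).
move=> he /(ler_wpM2l cw)/le_trans; apply.
apply: (@le_trans _ _ (cabs (cexp w) * (4 * cabs h ^+ 2 * expR 1))).
  by rewrite ler_wpM2l// ler_wpM2l// mulr_ge0// sqr_ge0.
have -> : cabs (cexp w) * (4 * cabs h ^+ 2 * expR 1) =
    cabs h * (cabs (cexp w) * 4 * expR 1) * cabs h by ring.
rewrite ler_wpM2r//; apply: le_trans (ltW h2).
by rewrite ler_wpM2l// lerDl.
Qed.

(** Differentiation of an inverse function: for the increment [k] of the logarithm,
    [cexp k = 1 + h / w], so [k - h / w] is the second-order remainder of the exponential at [k];
    continuity makes [k] small. *)
Lemma cdiff_cLog w : 0 < reC w -> cdiff (@cLog R) w w^-1.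
Proof.
move=> r0; have w0 : w != 0.
  by apply: contraTneq r0 => ->; rewrite /reC /= ltxx.
have c0 : 0 < cabs w by rewrite cabs_gt0.
move=> e e0; pose E1 := expR (1 : R).
have E0 : 0 < E1 by exact: expR_gt0.
(* The bound 1 controls the exponential factor, the second makes the remainder at most half of
   [cabs k] and hence [cabs k <= 2 * (cabs h / cabs w)], and the third yields [e]. *)
pose kap := Num.min 1 (Num.min (8 * E1)^-1 (e * cabs w / (8 * E1))).
have k0 : 0 < kap by rewrite !lt_min ltr01 invr_gt0 divr_gt0 mulr_gt0// mulr_gt0.
have [d [d0 Hd]] := cLog_continuous r0 k0.
exists (Num.min d (reC w)); split; first by rewrite lt_min d0.
move=> h; rewrite lt_min => /andP[hd hr].
have rwh : 0 < reC (w + h).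
  rewrite reCD; have := le_lt_trans (cabs_re h) hr; rewrite ltr_norml; lra.
have wh0 : w + h != 0.
  by apply: contraTneq rwh => ->; rewrite /reC /= ltxx.
pose k := cLog (w + h) - cLog w.
have kk : cabs k < kap by apply: Hd; rewrite addrAC subrr add0r.
have ek : cexp k = 1 + h / w.
  have : cexp (cLog w) * cexp k = w + h.
    by rewrite -cexpD /k addrC subrK cexp_cLog.
  by rewrite cexp_cLog// => H; rewrite -[cexp k](mulKf w0) H; field.
have kE : k - h / w = - (cexp k - 1 - k) by rewrite ek; ring.
rewrite -/k mulrC kE cabsN.
move: kk; rewrite !lt_min => /andP[k1 /andP[k2 k3]].
have sq : cabs (cexp k - 1 - k) <= 4 * E1 * cabs k * cabs k.
  apply: le_trans (cexp_second_order k) _.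
  have : expR (cabs k) <= E1 by rewrite ler_expR ltW.
  have -> : 4 * E1 * cabs k * cabs k = 4 * cabs k ^+ 2 * E1 by ring.
  by move=> he; rewrite ler_wpM2l// mulr_ge0// sqr_ge0.
have ck := cabs_ge0 k.
have k2' : 4 * E1 * cabs k <= 2^-1.
  move: k2; rewrite -[(8 * E1)^-1]mul1r ltr_pdivlMr ?mulr_gt0//; lra.
have k3' : 4 * E1 * cabs k <= e * cabs w / 2.
  move: k3; rewrite ltr_pdivlMr ?mulr_gt0//; lra.
have half : cabs (cexp k - 1 - k) <= 2^-1 * cabs k.
  by apply: le_trans sq _; rewrite ler_wpM2r.
have kh : cabs k <= 2 * (cabs h / cabs w).
  have := cabsD (h / w) (- (cexp k - 1 - k)); rewrite -kE [h / w + _]addrC subrK kE.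
  by rewrite cabsN cabs_div; lra.
apply: le_trans sq _.
apply: (@le_trans _ _ (e * cabs w / 2 * (2 * (cabs h / cabs w)))).
  by rewrite ler_pM// !mulr_ge0// ltW.
by rewrite le_eqVlt; apply/orP; left; apply/eqP; field; rewrite gt_eqF.
Qed.

End Logarithm.

(** * The difference equations for the Lerch series and its extension *)

Section LerchSeries.
Variable R : realType.
Local Notation C := R[i].
Local Notation P := (P3 R).
Implicit Types (x y : P).

Lemma hdiff_comp (phi : C -> C) (f : P -> C) x a b :
  hdiff f x a -> cdiff phi (f x) b -> hdiff (fun y => phi (f y)) x (scal3 b a).
Proof.
move=> Df Dp e e0.
pose na := cabs (ps a) + cabs (pz a) + cabs (pc a).
have na0 : 0 <= na by rewrite !addr_ge0 ?cabs_ge0.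
have adot h : cabs (dot a h) <= na * norm3 h.
  rewrite /na !mulrDl; apply: le_trans (cabsD _ _) _; rewrite lerD//.
    by apply: le_trans (cabsD _ _) _; rewrite lerD// cabsM ler_wpM2l ?cabs_ge0 ?ps_le ?pz_le.
  by rewrite cabsM ler_wpM2l ?cabs_ge0 ?pc_le.
have K0 : 0 < 1 + na by rewrite ltr_pwDl.
have B0 : 0 < cabs b + 1 by rewrite ltr_wpDl ?cabs_ge0.
have e1 : 0 < e / (2 * (1 + na)) by rewrite divr_gt0// mulr_gt0.
have [d1 [d10 H1]] := Dp _ e1.
pose e2 := Num.min 1 (e / (2 * (cabs b + 1))).
have e20 : 0 < e2 by rewrite lt_min ltr01 divr_gt0// mulr_gt0.
have [d2 [d20 H2]] := Df _ e20.
exists (Num.min d2 (d1 / (1 + na))); split; first by rewrite lt_min d20 divr_gt0.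
move=> h; rewrite lt_min ltr_pdivlMr// => /andP[/H2 h2 h1].
set k := f (add3 x h) - f x.
have n0 := norm3_ge0 h.
have kb : cabs k <= (1 + na) * norm3 h.
  have -> : k = (k - dot a h) + dot a h by ring.
  apply: le_trans (cabsD _ _) _; rewrite mulrDl lerD//.
  by apply: le_trans h2 _; rewrite ler_wpM2r// ge_min lexx.
have kd : cabs k < d1 by apply: le_lt_trans kb _; rewrite mulrC.
have := H1 k kd; rewrite /k [f x + _]addrC subrK -/k => h3.
have -> : phi (f (add3 x h)) - phi (f x) - dot (scal3 b a) h =
    (phi (f (add3 x h)) - phi (f x) - b * k) + b * (k - dot a h).
  by rewrite /dot /scal3 /ps /pz /pc /=; ring.
apply: le_trans (cabsD _ _) _.
have -> : e * norm3 h = e / 2 * norm3 h + e / 2 * norm3 h by field.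
apply: lerD.
  apply: le_trans h3 _.
  have -> : e / 2 * norm3 h = e / (2 * (1 + na)) * ((1 + na) * norm3 h).
    by field; rewrite gt_eqF.
  by rewrite ler_wpM2l// ltW.
rewrite cabsM; apply: (@le_trans _ _ ((cabs b + 1) * (e / (2 * (cabs b + 1)) * norm3 h))).
  rewrite ler_pM ?cabs_ge0 ?lerDl//; apply: le_trans h2 _.
  by rewrite ler_wpM2r// ge_min lexx orbT.
by rewrite le_eqVlt; apply/orP; left; apply/eqP; field; rewrite gt_eqF.
Qed.

Definition lerch_coef x n : C := cpow (n%:R + pc x) (- ps x).

Lemma Phi_partialE x N : Phi_partial x N = psum (lerch_coef x) (pz x) N.
Proof. by apply: eq_bigr => n _; rewrite mulrC. Qed.

Lemma hdiff_expr_pz x n :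
  hdiff (fun y : P => pz y ^+ n) x (scal3 (n%:R * pz x ^+ n.-1) (e_z R)).
Proof.
elim: n => [|n IH].
  have -> : (fun y : P => pz y ^+ 0) = (fun _ => dot (mk3 0 0 0) x + 1).
    by apply/funext => y; rewrite expr0 /dot /ps /pz /pc /=; ring.
  have -> : scal3 (0%:R * pz x ^+ 0.-1) (e_z R) = mk3 0 0 0.
    by apply: P3_eq; rewrite /scal3 /mk3 /ps /pz /pc /=; ring.
  move=> e e0; exists 1; split=> // h _.
  have -> : dot (mk3 0 0 0) x + 1 - (dot (mk3 0 0 0) x + 1) - dot (mk3 0 0 0) h = 0 :> C.
    by rewrite /dot /ps /pz /pc /=; ring.
  by rewrite cabs0 mulr_ge0 ?norm3_ge0 ?ltW.
have := hdiffM (hdiff_pz x) IH.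
have -> : (fun y : P => pz y * pz y ^+ n) = (fun y => pz y ^+ n.+1).
  by apply/funext => y; rewrite exprS.
congr hdiff; apply: P3_eq; rewrite /add3 /scal3 /mk3 /ps /pz /pc /=; try ring.
by case: n {IH} => [|n] /=; rewrite ?expr0 ?exprS -?natr1; ring.
Qed.

Lemma re_natD n (c : C) : 0 < reC c -> 0 < reC (n%:R + c).
Proof.
move=> c0; rewrite reCD; apply: ltr_wpDl => //.
have -> : (n%:R : C) = ((n%:R : R)%:C)%C by rewrite rmorph_nat.
exact: ler0n.
Qed.

Lemma hdiff_lerch_coef x n : 0 < reC (pc x) ->
  hdiff (fun y => lerch_coef y n) x (scal3 (lerch_coef x n)
    (add3 (scal3 (- ps x / (n%:R + pc x)) (e_c R)) (scal3 (- cLog (n%:R + pc x)) (e_s R)))).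
Proof.
move=> c0; have r0 := re_natD n c0.
have Dc : hdiff (fun y : P => n%:R + pc y) x (e_c R).
  have := @hdiff_dot R (e_c R) x n%:R; apply: hdiff_ext ltr01 _ => y _.
  by rewrite /dot /ps /pz /pc /=; ring.
have D1 := hdiff_comp Dc (cdiff_cLog r0).
have D2 := hdiffM (hdiffZ (-1) (hdiff_ps x)) D1.
have D3 := hdiff_comp D2 (cdiff_cexp _).
have : (fun y : P => cexp (-1 * ps y * cLog (n%:R + pc y))) = (fun y => lerch_coef y n).
  by apply/funext => y; rewrite /lerch_coef /cpow; congr cexp; ring.
move=> E; move: D3; rewrite E; congr hdiff.
have -> : cexp (-1 * ps x * cLog (n%:R + pc x)) = lerch_coef x n.
  by rewrite /lerch_coef /cpow; congr cexp; ring.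
by apply: P3_eq; rewrite /add3 /scal3 /mk3 /ps /pz /pc /=; ring.
Qed.

Lemma lerch_coef_shift x n (w : C) : 0 < reC (pc x) ->
  lerch_coef (add3 x (scal3 w (e_s R))) n = lerch_coef x n * cexp (- w * cLog (n%:R + pc x)).
Proof.
move=> c0; rewrite /lerch_coef /cpow -cexpD /add3 /scal3 /mk3 /ps /pc /= mulr0 addr0.
by congr cexp; ring.
Qed.

(** The operator [z d/dz + c] multiplies [z ^+ n] by [n + c], which lowers [s] by one, and [d/dc]
    raises it. The principal branch is harmless because [n + c] stays in the right half-plane. *)
Lemma Phi_partial_derivatives x N : 0 < reC (pc x) -> exists a,
  [/\ hdiff (fun y => Phi_partial y N) x a,
      pz x * pz a + pc x * Phi_partial x N = Phi_partial (sub3 x (e_s R)) N &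
      pc a = - ps x * Phi_partial (add3 x (e_s R)) N].
Proof.
move=> c0; elim: N => [|N [a [Da az ac]]].
  exists (mk3 0 0 0); split.
  - move=> e e0; exists 1; split=> // h _.
    rewrite /Phi_partial !big_ord0.
    have -> : 0 - 0 - dot (mk3 0 0 0) h = 0 by rewrite /dot /ps /pz /pc /=; ring.
    by rewrite cabs0 mulr_ge0 ?norm3_ge0 ?ltW.
  - by rewrite /Phi_partial !big_ord0 /pz /=; ring.
  - by rewrite /Phi_partial !big_ord0 /pc /=; ring.
have r0 := re_natD N c0.
have w0 : N%:R + pc x != 0.
  by apply: contraTneq r0 => ->; rewrite /reC /= ltxx.
have D1 := hdiffM (hdiff_expr_pz x N) (hdiff_lerch_coef N c0).
have D2 := hdiffB Da (hdiffZ (-1) D1).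
have PS y : Phi_partial y N.+1 = Phi_partial y N - -1 * (pz y ^+ N * lerch_coef y N).
  by rewrite {1}/Phi_partial big_ord_recr /=; rewrite mulN1r opprK.
eexists; split.
- by apply: hdiff_ext ltr01 _ D2 => y _; rewrite PS.
- rewrite !PS.
  have -> : lerch_coef (sub3 x (e_s R)) N = lerch_coef x N * (N%:R + pc x).
    rewrite sub_es lerch_coef_shift//; congr (_ * _).
    by rewrite opprK mul1r cexp_cLog.
  have -> : pz (sub3 x (e_s R)) = pz x by rewrite /pz /= subr0.
  rewrite -az /add3 /sub3 /scal3 /mk3 /ps /pz /pc /=.
  have -> : x.1.2 * (a.1.2 - -1 * (x.1.2 ^+ N * (lerch_coef x N * (- x.1.1 / (N%:R + x.2) * 0 + - cLog (N%:R + x.2) * 0)) +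
     lerch_coef x N * (N%:R * x.1.2 ^+ N.-1 * 1))) =
    x.1.2 * a.1.2 + lerch_coef x N * (N%:R * (x.1.2 ^+ N.-1 * x.1.2)) by ring.
  have -> : N%:R * (x.1.2 ^+ N.-1 * x.1.2) = N%:R * x.1.2 ^+ N.
    by case: (N) => [|n]; rewrite ?mul0r// -exprSr.
  by ring.
- rewrite !PS.
  have -> : lerch_coef (add3 x (e_s R)) N = lerch_coef x N / (N%:R + pc x).
    have -> : add3 x (e_s R) = add3 x (scal3 1 (e_s R)).
      by apply: P3_eq; rewrite /add3 /scal3 /mk3 /ps /pz /pc /=; ring.
    rewrite lerch_coef_shift//; congr (_ * _).
    apply: (mulIf w0); rewrite mulVf// -{2}(cexp_cLog w0) -cexpD.
    by rewrite mulN1r addNr cexp0.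
  have -> : pz (add3 x (e_s R)) = pz x by rewrite /pz /= addr0.
  rewrite mulrBr -ac /add3 /sub3 /scal3 /mk3 /ps /pz /pc /=.
  by ring.
Qed.

(** At [s = 4] the shift [s - 1] keeps real part above 1 on a ball of radius [1/8]; [z = - 1/4]
    keeps [cabs z <= 1/2] and [Re z < 0] there. *)
Definition series_center : P := mk3 4%:R (- 4^-1) (2^-1).

(** A convex part of [regionD], stable under shifts of [s], that contains both [series_center] and
    the base point. *)
Definition left_half y := reC (pz y) < 0 /\ 0 < reC (pc y) < 1.

Lemma left_half_regionD y : left_half y -> regionD y.
Proof. by move=> [h1 h2]; split=> // -[_]; rewrite leNgt h1. Qed.

Lemma re_add_scal (t : R) (u v : C) : reC (u + (t%:C)%C * (v - u)) = (1 - t) * reC u + t * reC v.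
Proof. by rewrite reCD reC_real reCD reCN; ring. Qed.

Lemma left_half_star p : left_half p -> starshaped p left_half.
Proof.
move=> [p1 /andP[p2 p3]] y t [y1 /andP[y2 y3]] /andP[t0 t1].
rewrite /left_half /add3 /scal3 /sub3 /mk3 {1}/pz {1 2}/pc /= !re_add_scal.
have [t1'|t1'] := ltP t 1; last first.
  have -> : t = 1 by apply/eqP; rewrite eq_le t1 t1'.
  by rewrite subrr !mul0r !add0r !mul1r y1 y2 y3.
rewrite -/(pz p) -/(pz y) -/(pc p) -/(pc y).
by split; [nra|apply/andP; split; nra].
Qed.

Lemma left_half_open : open3 left_half.
Proof.
move=> y [y1 /andP[y2 y3]].
exists (Num.min (- reC (pz y)) (Num.min (reC (pc y)) (1 - reC (pc y)))); split.
  by rewrite !lt_min oppr_gt0 y1 y2 subr_gt0.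
move=> k; rewrite !lt_min => /andP[h1 /andP[h2 h3]].
have hz := le_lt_trans (cabs_re (pz (sub3 k y))) (le_lt_trans (pz_le _) h1).
have hc1 := le_lt_trans (cabs_re (pc (sub3 k y))) (le_lt_trans (pc_le _) h2).
have hc2 := le_lt_trans (cabs_re (pc (sub3 k y))) (le_lt_trans (pc_le _) h3).
move: hz hc1 hc2; rewrite /sub3 /mk3 {1}/pz {1}/pc {1}/pc /= !reCD !reCN !ltr_norml.
rewrite -/(pz k) -/(pz y) -/(pc k) -/(pc y) /left_half.
by move=> *; split; [lra|apply/andP; split; lra].
Qed.

Lemma series_center_ball y : ball3 series_center 8^-1 y ->
  [/\ left_half y, 3 < reC (ps y) < 5, `|imC (ps y)| < 1, cabs (pz y) <= 1 / 2 &
      4^-1 < reC (pc y)].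
Proof.
move=> /norm3_lt[]; rewrite /sub3 /mk3 /series_center {1}/ps {1}/pz {1}/pc /=.
set s := y.1.1; set z := y.1.2; set c := y.2 => h1 h2 h3.
have re4 : reC (4%:R : C) = 4.
  have -> : (4%:R : C) = ((4%:R : R)%:C)%C by rewrite rmorph_nat.
  by [].
have im4 : imC (4%:R : C) = 0.
  have -> : (4%:R : C) = ((4%:R : R)%:C)%C by rewrite rmorph_nat.
  by [].
have i4 : (4^-1 : C) = ((4^-1 : R)%:C)%C by rewrite fmorphV rmorph_nat.
have i2 : (2^-1 : C) = ((2^-1 : R)%:C)%C by rewrite fmorphV rmorph_nat.
have a1 := le_lt_trans (cabs_re _) h1; have a2 := le_lt_trans (cabs_im _) h1.
have b1 := le_lt_trans (cabs_re _) h2.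
have c1 := le_lt_trans (cabs_re _) h3.
rewrite reCD reCN re4 ltr_norml in a1; rewrite imCD imCN im4 oppr0 addr0 in a2.
rewrite opprK reCD i4 {2}/reC /= ltr_norml in b1.
rewrite reCD reCN i2 {2}/reC /= ltr_norml in c1.
have z2 : cabs z <= 1 / 2.
  have := cabs_dist z (- 4^-1) 0; rewrite !subr0 => /le_trans; apply.
  have : cabs (- 4^-1 : C) = 4^-1 by rewrite cabsN i4 cabs_real ger0_norm// invr_ge0.
  by move=> ->; lra.
rewrite /left_half /ps /pz /pc -/s -/z -/c.
split => //.
- by split; [lra|apply/andP; split; lra].
- by apply/andP; split; lra.
- by apply: lt_trans a2 _; lra.
- by lra.
Qed.

(** The modulus is [expR (- Re s * ln (cabs (n + c)) + Im s * carg (n + c))]. Here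
    [cabs (n + c) >= 1/4] and [0 < Re s < 5] give [5 * ln 4], while [cabs (Im s) < 1] and [pi <= 4]
    give 4. The factor [1 ^+ n] is the radius required by [psum_lim_tail]. *)
Lemma lerch_coef_le y n : ball3 series_center 8^-1 y ->
  cabs (lerch_coef y n) * 1 ^+ n <= expR (5 * ln 4 + 4).
Proof.
move=> /series_center_ball[_ /andP[s3 s5] si _ c4].
have r0 : 0 < reC (n%:R + pc y) by apply: re_natD; lra.
have w0 : n%:R + pc y != 0.
  by apply: contraTneq r0 => ->; rewrite /reC /= ltxx.
have cw : 4^-1 <= cabs (n%:R + pc y).
  apply: le_trans (cabs_re _); rewrite gtr0_norm// reCD.
  have -> : (n%:R : C) = ((n%:R : R)%:C)%C by rewrite rmorph_nat.
  have : (0 : R) <= n%:R by exact: ler0n.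
  by rewrite {1}/reC /=; lra.
rewrite expr1n mulr1 /lerch_coef /cpow cabs_cexp ler_expR reCM reCN imCN.
rewrite /cLog {2}/reC {2}/imC /=.
have [_ _ cpi] := cargP w0.
have pi4 : (pi : R) <= 4 by have := @pihalf_lt2 R; rewrite ltr_pdivrMr//; lra.
have l4 : - ln 4 <= ln (cabs (n%:R + pc y)).
  by rewrite -lnV ?posrE// ler_ln ?posrE ?invr_gt0// cabs_gt0.
have l40 : 0 <= ln (4 : R) by rewrite ln_ge0// ler1n.
set L := ln (cabs _) in l4 *; set a := carg _ in cpi *.
have h1 : - reC (ps y) * L <= 5 * ln 4 by nra.
have h2 : `|imC (ps y) * a| <= 4.
  rewrite normrM; apply: le_trans (_ : 1 * 4 <= _); last by rewrite mul1r.
  by rewrite ler_pM// ?(ltW si)// (le_trans cpi).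
by move: h2; rewrite ler_norml => /andP[_ h2]; lra.
Qed.

Lemma Phi_ext_series F y : Phi_ext F -> ball3 series_center 8^-1 y ->
  [/\ cconv (Phi_partial y) (F y), cconv (Phi_partial (sub3 y (e_s R))) (F (sub3 y (e_s R))) &
      cconv (Phi_partial (add3 y (e_s R))) (F (add3 y (e_s R)))].
Proof.
move=> [_ HF] /series_center_ball[lh /andP[s3 _] _ z2 _].
have lh' w : left_half (add3 y (scal3 w (e_s R))).
  move: lh; rewrite /left_half /add3 /scal3 /mk3 /pz /pc /= !mulr0 !addr0//.
have [_ lhc] := lh.
have z1 : cabs (pz y) < 1 by lra.
have one : reC (1 : C) = 1 by [].
split; apply: HF.
- exact: left_half_regionD.
- by split; [lra|split].
- by rewrite sub_es; apply: left_half_regionD.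
- split; first by rewrite /sub3 /mk3 {1}/ps /= reCD reCN one -/(ps y); lra.
  by rewrite /sub3 /mk3 /pz /pc /= !subr0.
- have -> : add3 y (e_s R) = add3 y (scal3 1 (e_s R)).
    by apply: P3_eq; rewrite /add3 /scal3 /mk3 /ps /pz /pc /=; ring.
  exact: left_half_regionD.
- split; first by rewrite /add3 /mk3 {1}/ps /= reCD one -/(ps y); lra.
  by rewrite /add3 /mk3 /pz /pc /= !addr0.
Qed.

Lemma series_center_left_half : left_half series_center.
Proof.
have r8 : 0 < (8^-1 : R) by rewrite invr_gt0.
by have [] := series_center_ball (ball3_self series_center r8).
Qed.

(** The partial sums converge uniformly near each point, and since [weierstrass] also gives
    convergence of gradients, the relations for partial sums pass to the limit. *)
Lemma lerch_on_series F : Phi_ext F ->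
  dd_minus_on F (ball3 series_center 8^-1) /\ dd_plus_on F (ball3 series_center 8^-1).
Proof.
move=> PF.
have key y : ball3 series_center 8^-1 y -> exists a, [/\ hdiff F y a,
    pz y * pz a + pc y * F y = F (sub3 y (e_s R)) & pc a = - ps y * F (add3 y (e_s R))].
  move=> yb; have [d [d0 Hd]] := open_ball3 yb.
  have cpos x : ball3 series_center 8^-1 x -> 0 < reC (pc x).
    by case/series_center_ball => _ _ _ _; lra.
  have [A HA] := choice (fun N => Phi_partial_derivatives N (cpos y yb)).
  have [|||a [Da Ha]] := @weierstrass R (fun N x => Phi_partial x N) A F y d d0.
  - move=> N x /Hd xb; apply/holo_atP.
    by have [b [Db _ _]] := Phi_partial_derivatives N (cpos x xb); exists b.
  - move=> e e0; pose K : R := expR (5 * ln 4 + 4).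
    have K0 : 0 <= K by exact: expR_ge0.
    have K1 : 0 < 2 * K + 1 by rewrite ltr_wpDl// mulr_ge0.
    have [N HN] := half_pow_small (divr_gt0 e0 K1).
    exists N => n x Nn /Hd xb; rewrite Phi_partialE cabsBC.
    have [cF _ _] := Phi_ext_series PF xb.
    have [_ _ _ z2 _] := series_center_ball xb.
    have {}cF : cconv (psum (lerch_coef x) (pz x)) (F x).
      by apply: cconv_ext cF => k; rewrite Phi_partialE.
    apply: le_trans (psum_lim_tail n ltr01 K0 (fun k => lerch_coef_le k xb) z2 cF) _.
    rewrite divr1.
    have : cabs (pz x) ^+ n <= 2^-1 ^+ N.
      apply: (@le_trans _ _ (2^-1 ^+ n)).
        by apply: lerXn2r; rewrite ?nnegrE ?cabs_ge0 ?invr_ge0//; lra.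
      by rewrite ler_wiXn2l ?invr_ge0// invf_le1// ler1n.
    move: HN; rewrite ltr_pdivlMr//; set u := _ ^+ n; set w := _ ^+ N => h1 h2.
    have : 2 * K * u <= 2 * K * w by rewrite ler_wpM2l// mulr_ge0.
    have : w * (2 * K + 1) = 2 * K * w + w by ring.
    have : 0 <= w by rewrite exprn_ge0// invr_ge0.
    by lra.
  - by move=> N; have [] := HA N.
  have [c0 cm cp] := Phi_ext_series PF yb.
  exists a; split=> //.
  - have := cconvD (cconvZ (pz y) (Ha (e_z R))) (cconvZ (pc y) c0).
    rewrite dot_ez => H; apply: cconv_unique H _; apply: cconv_ext cm => N.
    by have [_ h _] := HA N; rewrite dot_ez -h.
  - have := Ha (e_c R); rewrite dot_ec => H; apply: cconv_unique H _.
    apply: cconv_ext (cconvZ (- ps y) cp) => N.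
    by have [_ _ h] := HA N; rewrite dot_ec -h.
split=> y /key[a [Da h1 h2]].
  by rewrite (dpartE (hdiff_pderiv (e_z R) Da)) dot_ez.
by rewrite (dpartE (hdiff_pderiv (e_c R) Da)) dot_ec.
Qed.

(** This reaches the base point, where [Re s = 1/2] and [Phi_ext] ties [F] to no series. *)
Lemma lerch_on_left_half F : Phi_ext F -> lerch_on F left_half.
Proof.
move=> PF; have [dm dp] := lerch_on_series PF.
have r8 : 0 < (8^-1 : R) by rewrite invr_gt0.
apply: (lerch_on_ext left_half_open _ series_center_left_half _ _ _ r8 dm dp).
- exact: left_half_star series_center_left_half.
- by move=> y; rewrite /left_half /sub3 /mk3 /pz /pc /= !subr0.
- by move=> y; rewrite /left_half /add3 /mk3 /pz /pc /= !addr0.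
- by move=> y /left_half_regionD; have [h _] := PF; exact: h.
Qed.

(** Every [cont_along] carries its own extension; this makes the initial germs of two continuations
    comparable. *)
Lemma Phi_ext_unique F1 F2 y : Phi_ext F1 -> Phi_ext F2 -> left_half y -> F1 y = F2 y.
Proof.
move=> P1 P2 ly; have r8 : 0 < (8^-1 : R) by rewrite invr_gt0.
apply: (identity_principle2 left_half_open (left_half_star series_center_left_half) _ _ r8 _ ly).
- by move=> k /left_half_regionD; have [h _] := P1; exact: h.
- by move=> k /left_half_regionD; have [h _] := P2; exact: h.
move=> k kb; have [c1 _ _] := Phi_ext_series P1 kb; have [c2 _ _] := Phi_ext_series P2 kb.
exact: cconv_unique c1 c2.
Qed.

Lemma tube_x0_left_half y : tube (x0' R) 4^-1 y -> left_half y.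
Proof.
move=> []; rewrite /x0' /mk3 {2}/pz {2}/pc /= => h1 h2.
have a1 := le_lt_trans (cabs_re _) h1; have a2 := le_lt_trans (cabs_re _) h2.
have i2 : (2^-1 : C) = ((2^-1 : R)%:C)%C by rewrite fmorphV rmorph_nat.
rewrite opprK reCD {2}/reC /= ltr_norml in a1.
rewrite reCD reCN i2 {2}/reC /= ltr_norml in a2.
by split; [lra|apply/andP; split; lra].
Qed.

End LerchSeries.

(** * Germs at shifted endpoints, and the monodromy *)

Section Endgame.
Variable R : realType.
Local Notation C := R[i].
Local Notation P := (P3 R).

Lemma lerch_on_cont_along (p : R -> P) f r : path_cont p -> p 0 = x0' R -> cont_along p f r ->
  exists rho E, [/\ 0 < rho, lerch_on E (tube (p 1) rho) &
    forall y, ball3 (p 1) rho y -> E y = f 1 y].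
Proof.
move=> cp p0 cf; apply: (chain_propagate cp (cont_along_chain cf)).
have [_ [_ [F [PF [rho [rho0 Hr]]]]]] := cf.
exists (Num.min rho 4^-1), F; split.
- by rewrite lt_min rho0 invr_gt0 ltr0n.
- rewrite p0; apply: lerch_onW (lerch_on_left_half PF) => y ty; apply: tube_x0_left_half.
  by apply: tube_le ty; rewrite ge_min lexx orbT.
- by move=> y; rewrite p0 /ball3 lt_min => /andP[h _]; rewrite Hr.
Qed.

Lemma cont_along_start (p q : R -> P) f g r s :
  cont_along p f r -> cont_along q g s -> eq_near (x0' R) (f 0) (g 0).
Proof.
move=> [_ [_ [F [PF [rho [rho0 Hr]]]]]] [_ [_ [F' [PF' [rho' [rho'0 Hr']]]]]].
exists (Num.min 4^-1 (Num.min rho rho')); split.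
  by rewrite !lt_min invr_gt0 ltr0n rho0 rho'0.
move=> y; rewrite /ball3 !lt_min => /andP[h4 /andP[h1 h2]].
rewrite Hr// Hr'//; apply: (Phi_ext_unique PF PF'); apply: tube_x0_left_half.
exact: ball3_tube.
Qed.

(* The path [q] is [p] followed by a segment in the [s]-direction, up to the
   parametrisations [phi] of the first part and [psi] of the second one. *)
Definition s_extension (p q : R -> P) (d : C) (phi psi : R -> R) :=
  [/\ unit_lipschitz phi, unit_lipschitz psi,
      [/\ phi 0 = 0, phi 1 = psi 0 & psi 1 = 1],
      forall t, 0 <= t <= 1 -> q (phi t) = p t &
      forall u, 0 <= u <= 1 -> q (psi u) = s_leg (p 1) d u].

(** Restricted to the first part of [q], the continuation [g] competes with [f], and on the segment
    with the constant family [E]; uniqueness applies to each part in turn. *)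
Lemma s_extension_germ (p q : R -> P) (d : C) phi psi f g r s E (rho : R) :
  path_cont p -> p 0 = x0' R -> s_extension p q d phi psi ->
  cont_along p f r -> cont_along q g s -> 0 < rho ->
  (forall y, tube (p 1) rho y -> holo_at E y) ->
  (forall y, ball3 (p 1) rho y -> E y = f 1 y) ->
  eq_near (s_leg (p 1) d 1) E (g 1).
Proof.
move=> cp p0 [L1 L2 [phi0 phi1 psi1] qphi qpsi] cf cg rho0 hE Ef.
have start : eq_near (p 0) (f 0) (g (phi 0)).
  by rewrite phi0 p0; exact: cont_along_start cf cg.
have cg' := cont_along_chain cg.
have := chain_unique cp (cont_along_chain cf) (chain_reparam L1 qphi cg') start.
rewrite phi1 => H.
have := lerch_s_leg rho0 hE (chain_reparam L2 qpsi cg'); rewrite psi1; apply.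
by apply: eq_near_trans H; exists rho.
Qed.

Lemma lerch_germs_s_extension (p qm qp : R -> P) phi psi (G Gm Gp : P -> C) :
  path_cont p -> p 0 = x0' R -> s_extension p qm (-1) phi psi ->
  s_extension p qp 1 phi psi -> Zgerm p G -> Zgerm qm Gm -> Zgerm qp Gp ->
  lerch_germs (p 1) G Gm Gp.
Proof.
move=> cp p0 Sm Sp [f [r [cf ->]]] [gm [rm [cm ->]]] [gp [rp [cgp ->]]].
have [rho [E [rho0 LE Ef]]] := lerch_on_cont_along cp p0 cf.
have [hE _ _] := LE.
exists rho, E; split=> //; first by exists rho.
- have := s_extension_germ cp p0 Sm cf cm rho0 hE Ef; congr eq_near.
  by apply: P3_eq; rewrite /s_leg /add3 /sub3 /mk3 /ps /pz /pc /= ?complexr0 ?rmorph1; ring.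
- have := s_extension_germ cp p0 Sp cf cgp rho0 hE Ef; congr eq_near.
  by apply: P3_eq; rewrite /s_leg /add3 /mk3 /ps /pz /pc /= ?complexr0 ?rmorph1; ring.
Qed.

Lemma sshift_half (g : R -> P) (d : C) t : t <= 1 -> sshift g d (t / 2) = g t.
Proof.
move=> t1; rewrite /sshift /pconcat ler_pdivrMr// mulVf ?pnatr_eq0// t1.
by rewrite mulrC divfK ?pnatr_eq0.
Qed.

Lemma sshift_leg (g : R -> P) (d : C) u : 0 <= u ->
  sshift g d (2^-1 + u / 2) = s_leg (g 1) d u.
Proof.
(* At [u = 0] the parameter is [1/2], where [pconcat] still takes the first path. *)
rewrite le_eqVlt => /predU1P[<-|u0].
  rewrite mul0r addr0 /sshift /pconcat lexx mulfV ?pnatr_eq0//.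
  apply: P3_eq; rewrite /s_leg /add3 /mk3 /ps /pz /pc /= ?addr0//.
  by rewrite complexr0 rmorph0 mul0r addr0.
rewrite /sshift /pconcat leNgt ltrDl divr_gt0//=.
by have -> : 2 * (2^-1 + u / 2) - 1 = u by field.
Qed.

Lemma sshift_s_extension (g : R -> P) (d : C) :
  s_extension g (sshift g d) d (fun t => t / 2) (fun u => 2^-1 + u / 2).
Proof.
split.
- split=> [t t01|t t']; first by lra.
  rewrite -mulrBl normrM [X in _ * X]gtr0_norm ?invr_gt0 ?ltr0n//.
  by have := normr_ge0 (t - t'); lra.
- split=> [t t01|t t']; first by lra.
  have -> : 2^-1 + t / 2 - (2^-1 + t' / 2) = (t - t') / 2 by field.
  rewrite normrM [X in _ * X]gtr0_norm ?invr_gt0 ?ltr0n//.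
  by have := normr_ge0 (t - t'); lra.
- by split; [rewrite mul0r|field|field].
- by move=> t /andP[_ t1]; exact: sshift_half.
- by move=> u /andP[u0 _]; exact: sshift_leg.
Qed.

(** Concatenation is not associative: [tau] occupies [[0, 1/2]], [g] the third quarter and the
    segment the last. Hence [tau] keeps its speed while [g] is slowed down by 2, which the minimum
    of two affine maps expresses. *)
Lemma pconcat_s_extension (tau g : R -> P) (d : C) : tau 1 = g 0 ->
  s_extension (pconcat tau g) (pconcat tau (sshift g d)) d
    (fun t => Num.min t (t / 2 + 4^-1)) (fun u => 3 / 4 + u / 4).
Proof.
move=> tg; split.
- split=> [t t01|t t'].
    by case: (leP t (t / 2 + 4^-1)) => h; lra.
  have := ler_norm (t - t'); have := ler_norm (- (t - t')); rewrite normrN => h1 h2.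
  rewrite ler_norml.
  by case: (leP t (t / 2 + 4^-1)) => h; case: (leP t' (t' / 2 + 4^-1)) => h'; lra.
- split=> [t t01|t t']; first by lra.
  have -> : 3 / 4 + t / 4 - (3 / 4 + t' / 4) = (t - t') / 4 by field.
  rewrite normrM [X in _ * X]gtr0_norm ?invr_gt0 ?ltr0n//.
  by have := normr_ge0 (t - t'); lra.
- split; last by field.
    by rewrite mul0r add0r min_l// invr_ge0.
  rewrite mul0r addr0 min_r; [by field|lra].
- move=> t /andP[t0 t1]; have [th|th] := leP t 2^-1.
    by rewrite min_l; [rewrite /pconcat th|lra].
  have th' : 2^-1 < t / 2 + 4^-1 by lra.
  rewrite min_r; last by lra.
  rewrite /pconcat !leNgt th th' /=.
  have -> : 2 * (t / 2 + 4^-1) - 1 = (2 * t - 1) / 2 by field.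
  by rewrite -/(pconcat _ _ _) -/(sshift g d _) sshift_half//; lra.
- move=> u /andP[u0 u1].
  have h : 2^-1 < 3 / 4 + u / 4 by lra.
  rewrite {1}/pconcat leNgt h /=.
  have -> : 2 * (3 / 4 + u / 4) - 1 = 2^-1 + u / 2 by field.
  rewrite sshift_leg//; congr s_leg.
  rewrite /pconcat leNgt invf_lt1 ?ltr1n//=.
  by have -> : 2 * 1 - 1 = 1 :> R by ring.
Qed.

End Endgame.

Theorem theorem4p1 (R : realType) :
  (* (1) and (2): Ztilde *)
  (forall gam : R -> P3 R, path_from_x0 gam ->
     forall G Gm Gp : P3 R -> R[i],
       Zgerm gam G -> Zgerm (sshift gam (-1)) Gm -> Zgerm (sshift gam 1) Gp ->
       DD_minus G Gm (gam 1) /\ DD_plus G Gp (gam 1) /\ PDE_at G (gam 1)) /\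
  (* (3): monodromy M_[tau](Ztilde)([gam]) = Ztilde([tau gam]) - Ztilde([gam]) *)
  (forall tau gam : R -> P3 R, loop_at_x0 tau -> path_from_x0 gam ->
     forall G1 G2 Gm1 Gm2 Gp1 Gp2 : P3 R -> R[i],
       Zgerm (pconcat tau gam) G1 -> Zgerm gam G2 ->
       Zgerm (pconcat tau (sshift gam (-1))) Gm1 -> Zgerm (sshift gam (-1)) Gm2 ->
       Zgerm (pconcat tau (sshift gam 1)) Gp1 -> Zgerm (sshift gam 1) Gp2 ->
       DD_minus (fun y => G1 y - G2 y) (fun y => Gm1 y - Gm2 y) (gam 1) /\
       DD_plus (fun y => G1 y - G2 y) (fun y => Gp1 y - Gp2 y) (gam 1) /\
       PDE_at (fun y => G1 y - G2 y) (gam 1)).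
Proof.
have base (gam : R -> P3 R) G Gm Gp : path_from_x0 gam ->
    Zgerm gam G -> Zgerm (sshift gam (-1)) Gm -> Zgerm (sshift gam 1) Gp ->
    lerch_germs (gam 1) G Gm Gp.
  move=> [[_ cg] g0]; apply: lerch_germs_s_extension => //; exact: sshift_s_extension.
split=> [gam pg G Gm Gp hG hm hp|tau gam [[[_ ct] t0] t1] pg G1 G2 Gm1 Gm2 Gp1 Gp2 h1 h2 m1 m2 p1 p2].
  by apply: lerch_germs_equations; exact: base.
apply: lerch_germs_equations; apply: lerch_germsB; last exact: base.
have [[_ cg] g0] := pg; have tg : tau 1 = gam 0 by rewrite t1 g0.
(* The first germ belongs to the path [tau] followed by [gam]; its endpoint must be displayed as the
   end of that path. *)
have -> : gam 1 = pconcat tau gam 1.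
  rewrite /pconcat leNgt invf_lt1 ?ltr1n//=.
  by have -> : 2 * 1 - 1 = 1 :> R by ring.
apply: (lerch_germs_s_extension _ _ (pconcat_s_extension (-1) tg) (pconcat_s_extension 1 tg)) => //.
  exact: pconcat_cont.
by rewrite /pconcat invr_ge0 ler0n mulr0.
Qed.
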